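(* Let $0<R_1<R_2$. There exists $C>0$ such that for all $\epsilon\in(0,\frac\pi2)$, $$\frac{j_{2,1}^2}{R_2^2}\le\lambda_1^{DDD}(\widehat{\mathfrak D}(2,\epsilon))\le\frac{j_{2,1}^2}{R_2^2}+C\left(\frac\pi2-\epsilon\right)^2.$$
   Context: Let $(r,\theta)$ be polar coordinates in $\mathbb R^2$. For $\epsilon\in[0,\frac\pi2]$, $$\widehat{\mathfrak D}(2,\epsilon)=\{0<r<R_2,\ 0<\theta<\tfrac\pi2\}\setminus\{r=R_1,\ \epsilon\le\theta<\tfrac\pi2\},$$ i.e. the open quarter disc of radius $R_2$ from which a circular-arc crack on the circle of radius $R_1$ has been removed. $\lambda_1^{DDD}(\widehat{\mathfrak D}(2,\epsilon))$ is the lowest eigenvalue of $-\Delta$ in $\widehat{\mathfrak D}(2,\epsilon)$ with homogeneous Dirichlet condition on the whole boundary: the radii $\theta=0$ and $\theta=\frac\pi2$, the exterior arc $r=R_2$, and the crack. $j_{\ell,k}$ is the $k$-th positive zero of the Bessel function $J_\ell$. The constant $C$ may depend on $R_1,R_2$ but not on $\epsilon$. *)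

(* Defs.v *)
From HB Require Import structures.
From mathcomp Require Import all_boot all_order all_algebra.
From mathcomp Require Import all_classical all_reals all_analysis.

Set Implicit Arguments.
Unset Strict Implicit.
Unset Printing Implicit Defensive.

Import Order.TTheory GRing.Theory Num.Theory.
Import numFieldNormedType.Exports.

Local Open Scope classical_set_scope.
Local Open Scope ring_scope.

Section Bessel.
Variable R : realType.

Definition bessel_coef (l : nat) (x : R) (m : nat) : R :=
  (-1) ^+ m / (m`! * (m + l)`!)%:R * (x / 2) ^+ (m.*2 + l).

Definition bessel (l : nat) (x : R) : R := limn (series (bessel_coef l x)).

(* The zeros of J_l are isolated and the positive ones are unbounded, so each
   infimum is that of a nonempty set and is attained: bessel_zero l k is the
   k-th positive zero of J_l for k >= 1. *)
Fixpoint bessel_zero (l k : nat) : R :=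
  if k is k'.+1 then inf [set x : R | bessel_zero l k' < x /\ bessel l x = 0]
  else 0.

End Bessel.

Section DirichletLaplacian.
Variable R : realType.

Definition plane_measure : set (measurableTypeR R * measurableTypeR R) -> \bar R :=
  (@lebesgue_measure R \x @lebesgue_measure R)%E.

Definition partial1 (f : R * R -> R) (p : R * R) : R := 'D_(1, 0) f p.
Definition partial2 (f : R * R -> R) (p : R * R) : R := 'D_(0, 1) f p.

(* C^1 functions with compact support contained in Omega. *)
Definition C1c (Omega : set (R * R)) (phi : R * R -> R) : Prop :=
  [/\ forall p, differentiable phi p,
      continuous (partial1 phi) /\ continuous (partial2 phi),
      compact (closure [set p | phi p != 0]) &
      closure [set p | phi p != 0] `<=` Omega].

Definition cvg_L2 (Omega : set (R * R)) (f_ : nat -> R * R -> R)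
    (f : R * R -> R) : Prop :=
  (\int[plane_measure]_(p in Omega) ((f_ n p - f p) ^+ 2)%:E)%E
    @[n --> \oo] --> 0%E.

(* u belongs to H^1_0(Omega), the closure of C^1_c(Omega) in the H^1 norm, and
   has weak gradient (g1, g2).  Square integrability of u, g1, g2, and the fact
   that g1, g2 are the weak partial derivatives of u, follow from the L^2
   convergences. *)
Definition H10 (Omega : set (R * R)) (u g1 g2 : R * R -> R) : Prop :=
  [/\ measurable_fun (Omega : set (measurableTypeR R * measurableTypeR R)) u,
      measurable_fun (Omega : set (measurableTypeR R * measurableTypeR R)) g1,
      measurable_fun (Omega : set (measurableTypeR R * measurableTypeR R)) g2 &
      exists phi : nat -> R * R -> R,
        [/\ forall n, C1c Omega (phi n),
            cvg_L2 Omega phi u,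
            cvg_L2 Omega (fun n => partial1 (phi n)) g1 &
            cvg_L2 Omega (fun n => partial2 (phi n)) g2]].

(* lam is an eigenvalue of the Dirichlet realization of -Delta in Omega: there
   is u in H^1_0(Omega), not a.e. zero, with
   int grad u . grad v = lam int u v for all v in H^1_0(Omega). *)
Definition dirichlet_eigenvalue (Omega : set (R * R)) (lam : R) : Prop :=
  exists u g1 g2 : R * R -> R,
    [/\ H10 Omega u g1 g2,
        ~ {ae plane_measure, forall p, Omega p -> u p = 0} &
        forall v h1 h2 : R * R -> R, H10 Omega v h1 h2 ->
          \int[plane_measure]_(p in Omega) (g1 p * h1 p + g2 p * h2 p) =
          lam * \int[plane_measure]_(p in Omega) (u p * v p)].

Definition lowest_dirichlet_eigenvalue (Omega : set (R * R)) (lam : R) : Prop :=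
  dirichlet_eigenvalue Omega lam /\
  forall mu, dirichlet_eigenvalue Omega mu -> lam <= mu.

Definition polar (q : R * R) : R * R := (q.1 * cos q.2, q.1 * sin q.2).

Definition cracked_quarter_disc (R1 R2 eps : R) : set (R * R) :=
  polar @` [set q | 0 < q.1 < R2 /\ 0 < q.2 < pi / 2] `\`
  polar @` [set q | q.1 = R1 /\ eps <= q.2 < pi / 2].

End DirichletLaplacian.

(* Main.v *)
Require Import Defs.
From HB Require Import structures.
From mathcomp Require Import all_boot all_order all_algebra.
From mathcomp Require Import all_classical all_reals all_analysis.
From mathcomp Require Import measurable_realfun ring lra.

Set Implicit Arguments.
Unset Strict Implicit.
Unset Printing Implicit Defensive.

Import Order.TTheory GRing.Theory Num.Theory.
Import numFieldNormedType.Exports.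

Local Open Scope classical_set_scope.
Local Open Scope ring_scope.

(** The eigenvalue is compared with the one of the quarter disc without crack,
    whose first Dirichlet eigenfunction is J_2(j r / R2) sin(2 theta), with j
    the first positive zero of J_2.  Write J_l(x) = (x/2)^l C_l(x^2/4), where
    C_l is an entire function; up to a constant the eigenfunction is
    w(x, y) = x y C_2(k (x^2 + y^2)) with k = (j/2)^2 / R2^2.  It solves
    - Laplacian w = 4 k w, where 4 k = j^2 / R2^2, it is positive in the quarter
    disc, and it vanishes on the boundary.

    The lowest eigenvalue exists and is variational
    ([lowest_dirichlet_eigenvalue_variational]): the infimum lam of the Rayleigh
    quotients of compactly supported C^1 functions is attained in H^1_0.  Since
    energy - lam * mass is a nonnegative quadratic form, the parallelogram
    identity makes it small on differences of members of a minimizing sequence.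
    The Poincare inequality on a grid of small squares ([poincare_grid])
    controls the mass of such a difference by its averages over finitely many
    cells, which converge along a subsequence, plus a small part of its energy.
    So the subsequence is Cauchy in H^1, its limit has Rayleigh quotient lam,
    and the Cauchy-Schwarz inequality for the nonnegative form gives the
    eigenvalue equation.

    Both bounds rest on the Picone identity ([picone_identity]): for a compactly
    supported C^1 function psi, the energy of w psi is 4 k times its mass plus
    the integral of w^2 |grad psi|^2.  Lower bound: every admissible phi is
    w psi with psi = phi / w, so its energy is at least 4 k times its mass
    ([energy_ge_positive_ground_state]).  Upper bound for a short crack: the
    crack lies within distance sqrt 2 * d of the point (0, R1), where
    d = R1 cos eps <= R1 (pi/2 - eps).  Take for psi the product of a cutoff
    [hole], which vanishes near (0, R1) and has a gradient of order 1/d on a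
    region of diameter of order d, and of a cutoff [bump] near the boundary of
    the quarter disc.  As w = O(x), the function w^2 |grad hole|^2 is bounded
    and its integral is O(d^2); as w is at most a constant times the distance to
    the boundary, w^2 |grad bump|^2 tends to 0 in the mean when the boundary
    cutoff is removed.  This gives lam <= 4 k + O(d^2)
    ([small_crack_upper_bound]).  For a long crack pi/2 - eps is bounded below,
    and it is enough to bound lam by the Rayleigh quotient of one function
    supported in the quarter disc of radius R1 ([uniform_upper_bound]).

    The same lower bound shows that C_2 has a positive zero: otherwise w would be
    positive for every k > 0 and all energies would be infinite
    ([clifford2_root]). *)

(** * Functions of class C^1 in the plane *)

(** The remainder estimate in linear form, avoiding Landau symbols. *)
Lemma is_diff_linearP (R : realFieldType) (V W : normedModType R) (f : V -> W)
    (l : {linear V -> W}) p : continuous l ->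
  is_diff p f l <-> forall e, 0 < e -> \forall v \near 0,
    `|f (v + p) - f p - l v| <= e * `|v|.
Proof.
move=> cl; split=> [[df E] e e0|h].
  have /eqaddoP/(_ e e0) := diff_locally df; rewrite E.
  apply: filterS => v /=.
  by rewrite [X in `|X| <= _ -> _](_ : _ = f (v + p) - f p - l v)// opprD addrA.
have E : f \o shift p = cst (f p) + l +o_ 0 id.
  apply/eqaddoP => e e0; have := h e e0; apply: filterS => v /=.
  by rewrite [X in _ -> `|X| <= _](_ : _ = f (v + p) - f p - l v)// opprD addrA.
have D := diff_unique cl E.
by split => //; apply/diff_locallyP; rewrite D; split.
Qed.

Section Gradient.
Variable R : realType.
Implicit Types (f g : R * R -> R) (p : R * R) (a b : R).

Definition has_grad f p a b : Prop :=
  is_diff p f (fun v : R * R => a * v.1 + b * v.2).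

Lemma has_grad_diff f p a b : has_grad f p a b -> differentiable f p.
Proof. by case. Qed.

Lemma has_grad_partial1 f p a b : has_grad f p a b -> partial1 f p = a.
Proof.
move=> h; rewrite /partial1 deriveE; last exact: has_grad_diff h.
by case: h => _ ->; rewrite /= mulr1 mulr0 addr0.
Qed.

Lemma has_grad_partial2 f p a b : has_grad f p a b -> partial2 f p = b.
Proof.
move=> h; rewrite /partial2 deriveE; last exact: has_grad_diff h.
by case: h => _ ->; rewrite /= mulr1 mulr0 add0r.
Qed.

Lemma has_grad_eq f p a b a' b' :
  has_grad f p a b -> a = a' -> b = b' -> has_grad f p a' b'.
Proof. by move=> h <- <-. Qed.

Lemma differentiable_has_grad f p :
  differentiable f p -> has_grad f p (partial1 f p) (partial2 f p).
Proof.
move=> df; split => //; apply/funext => -[x y] /=.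
have -> : (x, y) = x *: (1, 0) + y *: (0, 1) :> R * R.
  by congr pair; rewrite /= /GRing.scale/= !(mulr1, mulr0) ?addr0 ?add0r.
rewrite linearD !linearZ /partial1 /partial2 !deriveE// /GRing.scale/=.
exact: (congr2 +%R (mulrC _ _) (mulrC _ _)).
Qed.

Lemma has_grad_cst (c : R) p : has_grad (fun=> c) p 0 0.
Proof.
apply: is_diff_eq; apply/funext => v /=; by rewrite !mul0r addr0.
Qed.

Lemma fst_continuous : continuous (fst : R * R -> R).
Proof. by move=> p; exact: cvg_fst. Qed.

Lemma snd_continuous : continuous (snd : R * R -> R).
Proof. by move=> p; exact: cvg_snd. Qed.

Lemma has_grad_fst p : has_grad fst p 1 0.
Proof.
have lin : linear (fst : R * R -> R) by move=> k [x y] [x' y'].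
pose L := GRing.isLinear.Build _ _ _ _ _ lin.
pose f : {linear (R * R)%type -> R} := HB.pack (fst : R * R -> R) L.
have cf : continuous f by exact: fst_continuous.
split; first exact: (@linear_differentiable _ _ _ f).
by rewrite (@diff_lin _ _ _ f)//; apply/funext => v /=; rewrite mul1r mul0r addr0.
Qed.

Lemma has_grad_snd p : has_grad snd p 0 1.
Proof.
have lin : linear (snd : R * R -> R) by move=> k [x y] [x' y'].
pose L := GRing.isLinear.Build _ _ _ _ _ lin.
pose f : {linear (R * R)%type -> R} := HB.pack (snd : R * R -> R) L.
have cf : continuous f by exact: snd_continuous.
split; first exact: (@linear_differentiable _ _ _ f).
by rewrite (@diff_lin _ _ _ f)//; apply/funext => v /=; rewrite mul1r mul0r add0r.
Qed.

Lemma has_gradD f g p a b a' b' : has_grad f p a b -> has_grad g p a' b' ->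
  has_grad (fun q => f q + g q) p (a + a') (b + b').
Proof.
move=> hf hg; apply: (is_diff_eq (is_diffD hf hg)).
by apply/funext => v /=; rewrite [LHS]/GRing.add/=; ring.
Qed.

Lemma has_gradM f g p a b a' b' : has_grad f p a b -> has_grad g p a' b' ->
  has_grad (fun q => f q * g q) p (f p * a' + g p * a) (f p * b' + g p * b).
Proof.
move=> hf hg; apply: (is_diff_eq (is_diffM hf hg)).
apply/funext => v; transitivity (f p * (a' * v.1 + b' * v.2) + g p * (a * v.1 + b * v.2)) => //.
ring.
Qed.

Lemma has_grad_comp (h : R -> R) (h' : R) f p a b : has_grad f p a b ->
  is_derive (f p) 1 h h' -> has_grad (fun q => h (f q)) p (h' * a) (h' * b).
Proof.
move=> hf hh.
have dh : is_diff (f p) h (fun t => t * h').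
  have : derivable h (f p) 1 by [].
  move=> /derivable1_diffP dh; split => //.
  by rewrite diff1E// derive1E derive_val.
apply: (is_diff_eq (is_diff_comp hf dh)).
by apply/funext => v /=; ring.
Qed.

Lemma has_gradP f p a b : has_grad f p a b <->
  forall e, 0 < e -> \forall v \near (0 : (R * R)%type),
    `|f (v + p) - f p - (a * v.1 + b * v.2)| <= e * `|v|.
Proof.
have lin : linear (fun v : R * R => a * v.1 + b * v.2).
  by move=> k [x y] [x' y'] /=; rewrite /GRing.scale/=; ring.
pose L := GRing.isLinear.Build _ _ _ _ _ lin.
pose l : {linear (R * R)%type -> R} := HB.pack (fun v : R * R => a * v.1 + b * v.2) L.
have cl : continuous l.
  move=> v; apply: cvgD; apply: cvgM; try exact: cvg_cst.
    exact: cvg_fst.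
  exact: cvg_snd.
exact: (is_diff_linearP f p cl).
Qed.

Lemma has_grad_near f g p a b : (\forall q \near p, f q = g q) ->
  has_grad f p a b -> has_grad g p a b.
Proof.
move=> fg /has_gradP H; apply/has_gradP => e e0.
have fgp : f p = g p by exact: nbhs_singleton fg.
have fg' : \forall v \near (0 : (R * R)%type), f (v + p) = g (v + p).
  by rewrite (near_shift (0 : (R * R)%type) p)/= in fg; move: fg; apply: filterS => v; rewrite /= subr0.
have := H e e0; move: fg'; apply: filterS2 => v -> ; by rewrite fgp.
Qed.

(** The partial derivatives are explicit arguments, so that the algebra of such
    functions computes them; [partial1] and [partial2] are then equal to them. *)
Definition C1fun f (f1 f2 : R * R -> R) : Prop :=
  [/\ forall p, has_grad f p (f1 p) (f2 p), continuous f1 & continuous f2].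

Lemma C1fun_continuous f f1 f2 : C1fun f f1 f2 -> continuous f.
Proof. by move=> [h _ _] p; exact/differentiable_continuous/has_grad_diff/h. Qed.

Lemma C1fun_partial1 f f1 f2 : C1fun f f1 f2 -> partial1 f = f1.
Proof. by move=> [h _ _]; apply/funext => p; exact: has_grad_partial1 (h p). Qed.

Lemma C1fun_partial2 f f1 f2 : C1fun f f1 f2 -> partial2 f = f2.
Proof. by move=> [h _ _]; apply/funext => p; exact: has_grad_partial2 (h p). Qed.

Lemma C1fun_cst (c : R) : C1fun (fun=> c) (fun=> 0) (fun=> 0).
Proof. by split => [p||]; [exact: has_grad_cst|move=> ?; exact: cvg_cst..]. Qed.

Lemma C1fun_fst : C1fun fst (fun=> 1) (fun=> 0).
Proof. by split => [p||]; [exact: has_grad_fst|move=> ?; exact: cvg_cst..]. Qed.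

Lemma C1fun_snd : C1fun snd (fun=> 0) (fun=> 1).
Proof. by split => [p||]; [exact: has_grad_snd|move=> ?; exact: cvg_cst..]. Qed.

Lemma C1funD f f1 f2 g g1 g2 : C1fun f f1 f2 -> C1fun g g1 g2 ->
  C1fun (fun q => f q + g q) (fun q => f1 q + g1 q) (fun q => f2 q + g2 q).
Proof.
move=> [hf cf1 cf2] [hg cg1 cg2]; split.
- by move=> p; exact: has_gradD.
- by move=> p; apply: cvgD; [exact: cf1|exact: cg1].
- by move=> p; apply: cvgD; [exact: cf2|exact: cg2].
Qed.

Lemma C1funM f f1 f2 g g1 g2 : C1fun f f1 f2 -> C1fun g g1 g2 ->
  C1fun (fun q => f q * g q) (fun q => f q * g1 q + g q * f1 q)
    (fun q => f q * g2 q + g q * f2 q).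
Proof.
move=> Hf Hg; have cf := C1fun_continuous Hf; have cg := C1fun_continuous Hg.
case: Hf Hg => [hf cf1 cf2] [hg cg1 cg2]; split.
- by move=> p; exact: has_gradM.
- by move=> p; apply: cvgD; apply: cvgM;
    [exact: cf|exact: cg1|exact: cg|exact: cf1].
- by move=> p; apply: cvgD; apply: cvgM;
    [exact: cf|exact: cg2|exact: cg|exact: cf2].
Qed.

Lemma C1funZ (c : R) f f1 f2 : C1fun f f1 f2 ->
  C1fun (fun q => c * f q) (fun q => c * f1 q) (fun q => c * f2 q).
Proof.
move=> Hf; have := C1funM (C1fun_cst c) Hf.
rewrite (_ : (fun q => c * f1 q + f q * 0) = (fun q => c * f1 q)); last first.
  by apply/funext => q; rewrite mulr0 addr0.
rewrite (_ : (fun q => c * f2 q + f q * 0) = (fun q => c * f2 q))//.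
by apply/funext => q; rewrite mulr0 addr0.
Qed.

Lemma C1fun_comp (h h' : R -> R) f f1 f2 : C1fun f f1 f2 ->
  (forall t : R, is_derive t 1 h (h' t)) -> continuous h' ->
  C1fun (fun q => h (f q)) (fun q => h' (f q) * f1 q) (fun q => h' (f q) * f2 q).
Proof.
move=> Hf hh ch; have cf := C1fun_continuous Hf.
case: Hf => [hf cf1 cf2]; split.
- by move=> p; exact: has_grad_comp.
- move=> p; apply: cvgM; last exact: cf1.
  by apply: (continuous_comp (cf p)); exact: ch.
- move=> p; apply: cvgM; last exact: cf2.
  by apply: (continuous_comp (cf p)); exact: ch.
Qed.

Lemma C1fun_eq f f1 f2 g1 g2 : C1fun f f1 f2 -> f1 =1 g1 -> f2 =1 g2 ->
  C1fun f g1 g2.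
Proof. by move=> h /funext <- /funext <-. Qed.

Lemma has_grad_slice1 f x y a b :
  has_grad f (x, y) a b -> is_derive x 1 (fun t => f (t, y)) a.
Proof.
move=> h.
have d : is_diff x (fun t : R => (t, y)) (fun t : R => (t, 0 : R)).
  exact: (is_diff_pair (is_diff_id x) (is_diff_cst y x)).
have := is_diff_comp d h; rewrite /comp => D.
have dd : derivable (fun t => f (t, y)) x 1 by apply/derivable1_diffP.
split => //; rewrite deriveE; last exact/derivable1_diffP.
by case: D => _ ->; rewrite /= mulr1 mulr0 addr0.
Qed.

Lemma has_grad_slice2 f x y a b :
  has_grad f (x, y) a b -> is_derive y 1 (fun t => f (x, t)) b.
Proof.
move=> h.
have d : is_diff y (fun t : R => (x, t)) (fun t : R => (0 : R, t)).
  exact: (is_diff_pair (is_diff_cst x y) (is_diff_id y)).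
have := is_diff_comp d h; rewrite /comp => D.
have dd : derivable (fun t => f (x, t)) y 1 by apply/derivable1_diffP.
split => //; rewrite deriveE; last exact/derivable1_diffP.
by case: D => _ ->; rewrite /= mulr1 mulr0 add0r.
Qed.

End Gradient.

(** * Integration in the plane *)

Section PlaneMeasure.
Variable R : realType.
Notation T1 := (measurableTypeR R).
Notation T2 := (measurableTypeR R * measurableTypeR R)%type.
Notation mu1 := (@lebesgue_measure R).
Notation mu2 := (@plane_measure R).

Lemma plane_measureX (A B : set R) : measurable (A : set T1) ->
  measurable (B : set T1) -> mu2 (A `*` B) = (mu1 A * mu1 B)%E.
Proof. by move=> mA mB; rewrite /plane_measure product_measure1E. Qed.

(** The measurable structure of the plane is the product one; an open set belongs
    to it as a countable union of boxes with rational corners. *)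
Lemma open_measurable_plane (U : set (R * R)) : open U -> measurable (U : set T2).
Proof.
move=> oU.
pose box (q : (rat * rat) * (rat * rat)) : set T2 :=
  `]ratr q.1.1 : R, ratr q.1.2[%classic `*` `]ratr q.2.1 : R, ratr q.2.2[%classic.
pose F q := if `[< box q `<=` U >] then box q else set0.
have -> : U = \bigcup_(q in setT) F q.
  apply/seteqP; split => [[x y] Uxy|p [q _]]; last first.
    by rewrite /F; case: asboolP => // + ?; apply.
  have /nbhs_ballP[e /= e0 be] := open_nbhs_nbhs (conj oU Uxy).
  have /rat_in_itvoo[a /itvP ha] : x - e < x by rewrite ltrBlDr ltrDl.
  have /rat_in_itvoo[b /itvP hb] : x < x + e by rewrite ltrDl.
  have /rat_in_itvoo[c /itvP hc] : y - e < y by rewrite ltrBlDr ltrDl.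
  have /rat_in_itvoo[d /itvP hd] : y < y + e by rewrite ltrDl.
  have bx : box ((a, b), (c, d)) (x, y).
    by split; rewrite /= in_itv/= ?ha ?hb ?hc ?hd.
  exists ((a, b), (c, d)) => //; rewrite /F; case: asboolP => // -[].
  move=> [x' y'] [] /=; rewrite !in_itv/= => /andP[ax' x'b] /andP[cy' y'd].
  apply: be; split => /=; rewrite /ball/= ltr_distlC.
    by rewrite (lt_trans _ ax') ?ha//= (lt_trans x'b) ?hb.
  by rewrite (lt_trans _ cy') ?hc//= (lt_trans y'd) ?hd.
apply: countable_bigcupT_measurable; first exact: countableP.
move=> q; rewrite /F; case: asboolP => // _.
by apply: measurableX; exact: measurable_itv.
Qed.

Lemma continuous_measurable_plane (f : R * R -> R) : continuous f ->
  measurable_fun (setT : set T2) (f : T2 -> T1).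
Proof.
move=> cf; apply: (measurability _ (measurable_realfun.RGenOpens.measurableE R)) => _ [_ [a [b ->] <-]].
rewrite setTI; apply: open_measurable_plane.
move/continuousP : cf; apply; exact: interval_open.
Qed.

Lemma continuous_measurable_plane_on (D : set (R * R)) (f : R * R -> R) : continuous f ->
  measurable_fun (D : set T2) (f : T2 -> T1).
Proof. by move=> cf; apply: measurable_funTS; exact: continuous_measurable_plane. Qed.

Definition cube (M : R) : set (R * R) := `[- M, M]%classic `*` `[- M, M]%classic.

Lemma cubeP M p : cube M p <-> `|p| <= M.
Proof.
case: p => x y; rewrite /cube/= !in_itv/= -!ler_norml /Num.norm/= ge_max.
by split => [[-> ->]|/andP[]].
Qed.

Lemma measurable_cube M : measurable (cube M : set T2).
Proof. by apply: measurableX; exact: measurable_itv. Qed.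

Lemma compact_cube M : compact (cube M).
Proof. by apply: compact_setX; exact: segment_compact. Qed.

Lemma cube_finite M : (mu2 (cube M) < +oo)%E.
Proof.
rewrite plane_measureX; [|exact: measurable_itv..].
by rewrite lebesgue_measure_itv/=; case: ifP => _; rewrite ?mule0// -EFinB -EFinM ltry.
Qed.

Lemma bounded_set_finite (A : set (R * R)) M : measurable (A : set T2) ->
  A `<=` cube M -> (mu2 A < +oo)%E.
Proof.
move=> mA AM; apply: le_lt_trans (cube_finite M).
by apply: le_measure => //; rewrite inE//; exact: measurable_cube.
Qed.

Lemma continuous_bounded_cube (f : R * R -> R) M : continuous f ->
  exists2 K, 0 < K & forall p, cube M p -> `|f p| <= K.
Proof.
move=> cf.
have cfc : compact (f @` cube M).
  apply: continuous_compact; last exact: compact_cube.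
  exact: continuous_subspaceT.
have [K [_ HK]] := compact_bounded cfc.
exists (`|K| + 1) => [|p cp]; first by rewrite ltr_pwDr.
apply: HK; last by exists p.
by rewrite (le_lt_trans (ler_norm K))// ltrDl.
Qed.

Lemma continuous_integrable_bounded (A : set (R * R)) M (f : R * R -> R) :
  continuous f -> measurable (A : set T2) -> A `<=` cube M ->
  mu2.-integrable A (EFin \o f).
Proof.
move=> cf mA AM; apply: measurable_bounded_integrable => //.
- exact: bounded_set_finite AM.
- exact: continuous_measurable_plane_on.
- have [K K0 HK] := continuous_bounded_cube M cf.
  exists K; split; first exact: gtr0_real.
  by move=> x Kx p /AM /HK /le_trans; apply; exact: ltW.
Qed.

Definition cc (f : R * R -> R) : Prop :=
  continuous f /\ exists M, forall p, M < `|p| -> f p = 0.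

Lemma integrable_cc f : cc f -> mu2.-integrable setT (EFin \o f).
Proof.
move=> [cf [M fM]].
have -> : EFin \o f = (EFin \o f) \_ (cube M).
  apply/funext => p; rewrite patchE; case: ifPn => // /negP pM /=.
  by rewrite fM// ltNge; apply/negP => h; apply: pM; rewrite inE; exact/cubeP.
apply/(integrable_mkcond _ (measurable_cube M)).
exact: (continuous_integrable_bounded cf (measurable_cube M) (@subset_refl _ _)).
Qed.

Lemma ccD f g : cc f -> cc g -> cc (fun p => f p + g p).
Proof.
move=> [cf [M fM]] [cg [N gN]]; split.
  by move=> p; apply: cvgD; [exact: cf|exact: cg].
exists (Num.max M N) => p; rewrite gt_max => /andP[Mp Np].
by rewrite fM// gN// addr0.
Qed.

Lemma ccMl f g : cc f -> continuous g -> cc (fun p => f p * g p).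
Proof.
move=> [cf [M fM]] cg; split.
  by move=> p; apply: cvgM; [exact: cf|exact: cg].
by exists M => p Mp; rewrite fM// mul0r.
Qed.

Lemma ccMr (f g : R * R -> R) : continuous f -> cc g -> cc (fun p => f p * g p).
Proof.
move=> cf cg; have := ccMl cg cf.
by congr cc; apply/funext => p; rewrite mulrC.
Qed.

Lemma cc_sqr f : cc f -> cc (fun p => f p ^+ 2).
Proof. by move=> cf; apply: ccMl => //; case: cf. Qed.

Lemma C1fun_support f f1 f2 M : C1fun f f1 f2 ->
  (forall p : R * R, M < `|p| -> f p = 0) ->
  forall p : R * R, M < `|p| -> f1 p = 0 /\ f2 p = 0.
Proof.
move=> [hf _ _] fM p Mp.
have n0 : \forall q \near p, (fun=> 0 : R) q = f q.
  have /(_ p Mp) : open [set q : R * R | M < `|q|].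
    apply: (@open_comp _ _ (fun q : R * R => `|q|) [set x | M < x]).
      by move=> q _; exact: norm_continuous.
    exact: open_gt.
  by apply: filterS => q /= /fM ->.
have := has_grad_near n0 (has_grad_cst 0 p) => h0.
by rewrite -(has_grad_partial1 (hf p)) -(has_grad_partial2 (hf p))
  (has_grad_partial1 h0) (has_grad_partial2 h0).
Qed.

Lemma C1fun_cc f f1 f2 M : C1fun f f1 f2 ->
  (forall p : R * R, M < `|p| -> f p = 0) -> [/\ cc f, cc f1 & cc f2].
Proof.
move=> Hf fM; have cf := C1fun_continuous Hf; have H := C1fun_support Hf fM.
case: Hf => [_ cf1 cf2]; split; split => //; exists M => // p Mp.
  by have [-> _] := H p Mp.
by have [_ ->] := H p Mp.
Qed.

Lemma integral_derive (f f' : R -> R) a b : a < b ->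
  (forall t : R, is_derive t 1 f (f' t)) -> continuous f' ->
  (\int[mu1]_(t in `[a, b]) (f' t)%:E = (f b - f a)%:E)%E.
Proof.
move=> ab df cf'; rewrite (@continuous_FTC2 _ f' f)//.
- exact: continuous_subspaceT.
- have cf : continuous f.
    move=> t; apply: differentiable_continuous; apply/derivable1_diffP.
    by have := df t; case.
  split.
  + by move=> t _; have := df t; case.
  + by apply: cvg_at_right_filter; exact: cf.
  + by apply: cvg_at_left_filter; exact: cf.
- by move=> t _; rewrite derive1E; exact: derive_val.
Qed.

Lemma integral_derive0 (f f' : R -> R) (M : R) : 
  (forall t : R, is_derive t 1 f (f' t)) -> continuous f' ->
  (forall t, M < `|t| -> f t = 0 /\ f' t = 0) ->
  (\int[mu1]_t (f' t)%:E = 0)%E.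
Proof.
move=> df cf' fM.
pose N : R := `|M| + 1.
have N0 : 0 < N by rewrite /N ltr_pwDr.
have MN : M < N by rewrite /N (le_lt_trans (ler_norm M))// ltrDl.
transitivity (\int[mu1]_(t in `[(- N)%R, N]) (f' t)%:E)%E.
  rewrite [RHS]integral_mkcond; apply: eq_integral => t _.
  rewrite patchE; case: ifPn => // /negP tN.
  have [_ -> //] : f t = 0 /\ f' t = 0.
  apply: fM; rewrite (lt_trans MN)// ltNge; apply/negP => h; apply: tN.
  by rewrite inE/= in_itv/= -ler_norml.
rewrite (integral_derive _ df)//; last by rewrite gt0_cp.
have [-> _] : f N = 0 /\ f' N = 0 by apply: fM; rewrite gtr0_norm.
have [-> _] : f (- N) = 0 /\ f' (- N) = 0.
  by apply: fM; rewrite normrN gtr0_norm.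
by rewrite subrr.
Qed.

Lemma continuous_slice1 (f : R * R -> R) (y : R) : continuous f ->
  continuous (fun x => f (x, y)).
Proof.
move=> cf x; apply: (cvg_comp (fun x => (x, y)) f _ (cf (x, y))).
apply: (@differentiable_continuous _ _ _ x (fun t : R => (t, y))).
by have [] := is_diff_pair (is_diff_id x) (is_diff_cst y x).
Qed.

Lemma continuous_slice2 (f : R * R -> R) (x : R) : continuous f ->
  continuous (fun y => f (x, y)).
Proof.
move=> cf y; apply: (cvg_comp (fun y => (x, y)) f _ (cf (x, y))).
apply: (@differentiable_continuous _ _ _ y (fun t : R => (x, t))).
by have [] := is_diff_pair (is_diff_cst x y) (is_diff_id y).
Qed.

(** Fubini reduces the integral to those of the derivatives of the slices, which
    vanish by the fundamental theorem of calculus. *)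
Lemma divergence1 f f1 f2 M : C1fun f f1 f2 ->
  (forall p : R * R, M < `|p| -> f p = 0) -> \int[mu2]_p f1 p = 0.
Proof.
move=> Hf fM; have [_ cf1 _] := C1fun_cc Hf fM.
rewrite /Rintegral -(integral21_prod_meas1 (integrable_cc cf1)).
rewrite (eq_integral (cst 0%E)) ?integral0// => y _.
rewrite /fubini_G/=.
apply: (@integral_derive0 (fun x => f (x, y)) (fun x => f1 (x, y)) M).
- by move=> t; have [hf _ _] := Hf; exact: has_grad_slice1 (hf (t, y)).
- by apply: continuous_slice1; case: cf1.
- move=> t Mt; have Mty : M < `|(t, y)|.
    by rewrite (lt_le_trans Mt)// /Num.norm/= le_max lexx.
  by rewrite fM//; have [-> _] := C1fun_support Hf fM Mty.
Qed.

Lemma divergence2 f f1 f2 M : C1fun f f1 f2 ->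
  (forall p : R * R, M < `|p| -> f p = 0) -> \int[mu2]_p f2 p = 0.
Proof.
move=> Hf fM; have [_ _ cf2] := C1fun_cc Hf fM.
rewrite /Rintegral -(integral12_prod_meas1 (integrable_cc cf2)).
rewrite (eq_integral (cst 0%E)) ?integral0// => x _.
rewrite /fubini_F/=.
apply: (@integral_derive0 (fun y => f (x, y)) (fun y => f2 (x, y)) M).
- by move=> t; have [hf _ _] := Hf; exact: has_grad_slice2 (hf (x, t)).
- by apply: continuous_slice2; case: cf2.
- move=> t Mt; have Mty : M < `|(x, t)|.
    by rewrite (lt_le_trans Mt)// /Num.norm/= le_max lexx orbT.
  by rewrite fM//; have [_ ->] := C1fun_support Hf fM Mty.
Qed.

End PlaneMeasure.

Section RealIntegral.
Context d (T : measurableType d) (R : realType) (mu : {measure set T -> \bar R}).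
Variables (D : set T) (mD : measurable D).
Implicit Types f g : T -> R.

Definition Rintegrable f := mu.-integrable D (EFin \o f).

Lemma RintegrableD f g : Rintegrable f -> Rintegrable g ->
  Rintegrable (fun x => f x + g x).
Proof. by move=> hf hg; have := integrableD mD hf hg. Qed.

Lemma RintegrableB f g : Rintegrable f -> Rintegrable g ->
  Rintegrable (fun x => f x - g x).
Proof. by move=> hf hg; have := integrableB mD hf hg. Qed.

Lemma RintegrableZ c f : Rintegrable f -> Rintegrable (fun x => c * f x).
Proof. by move=> hf; have := integrableZl mD c hf. Qed.

Lemma Rintegrable_cst c : (mu D < +oo)%E -> Rintegrable (fun=> c).
Proof.
move=> fin; apply: measurable_bounded_integrable => //.
exists `|c|; split; first exact: num_real.
by move=> x cx y _ /=; exact: ltW.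
Qed.

Lemma eq_Rintegrable f g : (forall x, D x -> f x = g x) -> Rintegrable f -> Rintegrable g.
Proof.
by move=> fg; apply: eq_integrable => // x; rewrite inE => /fg /= ->.
Qed.

Lemma le_Rintegrable f g : measurable_fun D f ->
  (forall x, D x -> `|f x| <= g x) -> Rintegrable g -> Rintegrable f.
Proof.
move=> mf fg; apply: le_integrable => //; first exact/measurable_EFinP.
move=> x Dx /=; rewrite lee_fin.
by rewrite (le_trans (fg x Dx))// ler_norm.
Qed.

(** Integrability travels together with the value, so that linear combinations
    of integrals are handled without separate integrability proofs. *)
Definition has_Rint f (v : R) := Rintegrable f /\ \int[mu]_(x in D) f x = v.

Lemma has_Rint_int f : Rintegrable f -> has_Rint f (\int[mu]_(x in D) f x).
Proof. by []. Qed.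

Lemma has_RintD f g u v : has_Rint f u -> has_Rint g v ->
  has_Rint (fun x => f x + g x) (u + v).
Proof.
move=> [hf <-] [hg <-]; split; first exact: RintegrableD.
by rewrite RintegralD.
Qed.

Lemma has_RintB f g u v : has_Rint f u -> has_Rint g v ->
  has_Rint (fun x => f x - g x) (u - v).
Proof.
move=> [hf <-] [hg <-]; split; first exact: RintegrableB.
by rewrite RintegralB.
Qed.

Lemma has_RintZ c f u : has_Rint f u -> has_Rint (fun x => c * f x) (c * u).
Proof.
move=> [hf <-]; split; first exact: RintegrableZ.
by rewrite RintegralZl.
Qed.

Lemma has_Rint_cst c : (mu D < +oo)%E -> has_Rint (fun=> c) (c * fine (mu D)).
Proof. by move=> h; split; [exact: Rintegrable_cst|rewrite Rintegral_cst]. Qed.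

Lemma has_Rint_le f g u v : has_Rint f u -> has_Rint g v ->
  (forall x, D x -> f x <= g x) -> u <= v.
Proof. by move=> [hf <-] [hg <-] fg; exact: le_Rintegral. Qed.

Lemma has_Rint_ge0 f u : has_Rint f u -> (forall x, D x -> 0 <= f x) -> 0 <= u.
Proof. by move=> [_ <-] h; exact: Rintegral_ge0. Qed.

End RealIntegral.

(** * The Poincare inequality on squares and grids *)

Section Poincare.
Variable R : realType.
Notation T1 := (measurableTypeR R).
Notation T2 := (measurableTypeR R * measurableTypeR R)%type.
Notation mu1 := (@lebesgue_measure R).
Notation mu2 := (@plane_measure R).

Lemma continuous_Rintegrable_itv (f : R -> R) a b : continuous f ->
  mu1.-integrable `[a, b] (EFin \o f).
Proof.
move=> cf; apply: continuous_compact_integrable; first exact: segment_compact.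
exact: continuous_subspaceT.
Qed.

(** The Cauchy-Schwarz inequality for the integral of f' over [x, y], obtained by
    integrating (f' - m)^2 where m is the mean slope of f. *)
Lemma sqr_increment_le_energy_itv (f f' : R -> R) x y : x <= y ->
  (forall t : R, is_derive t 1 f (f' t)) -> continuous f' ->
  (f y - f x) ^+ 2 <= (y - x) * \int[mu1]_(t in `[x, y]) (f' t ^+ 2).
Proof.
move=> xy df cf'; have [<-|xNy] := eqVneq x y.
  by rewrite !subrr mul0r expr2 mul0r.
have {xy xNy} xy : x < y by rewrite lt_neqAle xNy.
have mI : measurable (`[x, y]%classic : set T1) by exact: measurable_itv.
have If := has_Rint_int (continuous_Rintegrable_itv x y cf').
have cf2 : continuous (fun t => f' t ^+ 2).
  by move=> t; apply: cvgM; exact: cf'.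
have If2 := has_Rint_int (continuous_Rintegrable_itv x y cf2).
have E : \int[mu1]_(t in `[x, y]) f' t = f y - f x.
  by rewrite /Rintegral (integral_derive xy df cf').
rewrite E in If.
have len : fine (mu1 `[x, y]) = y - x by rewrite lebesgue_measure_itv/= lte_fin xy.
have fin : (mu1 `[x, y] < +oo)%E.
  by rewrite lebesgue_measure_itv/= lte_fin xy -EFinB ltry.
set m := (f y - f x) / (y - x).
have yx0 : 0 < y - x by rewrite subr_gt0.
have := has_RintD mI (has_RintB mI If2 (has_RintZ mI (2 * m) If))
  (has_Rint_cst mI (m ^+ 2) fin).
move=> /has_Rint_ge0 H.
have : 0 <= \int[mu1]_(t in `[x, y]) (f' t ^+ 2) - 2 * m * (f y - f x) + m ^+ 2 * (y - x).
  rewrite -len; apply: H => t _.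
  by rewrite [X in 0 <= X](_ : _ = (f' t - m) ^+ 2) ?sqr_ge0//; ring.
have -> : f y - f x = m * (y - x) by rewrite /m -mulrA mulVf ?mulr1// gt_eqF.
move=> h.
have : 0 <= (y - x) * (\int[mu1]_(t in `[x, y]) f' t ^+ 2 -
    2 * m * (m * (y - x)) + m ^+ 2 * (y - x)).
  by rewrite mulr_ge0// ltW.
by move=> {}h; rewrite -subr_ge0; apply: le_trans h _; rewrite le_eqVlt; apply/orP; left; apply/eqP; ring.
Qed.

Lemma sqr_increment_le_energy (f f' : R -> R) a h x y :
  (forall t : R, is_derive t 1 f (f' t)) -> continuous f' ->
  `[a, a + h[%classic x -> `[a, a + h[%classic y ->
  (f y - f x) ^+ 2 <= h * \int[mu1]_(t in `[a, a + h[) (f' t ^+ 2).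
Proof.
move=> df cf'; wlog xy : x y / x <= y.
  move=> H hx hy; have /orP[xy|yx] := le_total x y; first exact: H.
  by rewrite -sqrrN opprB; exact: H.
rewrite /= !in_itv/= => /andP[ax xb] /andP[ay yb].
apply: le_trans (sqr_increment_le_energy_itv xy df cf') _.
have cf2 : continuous (fun t => f' t ^+ 2).
  by move=> t; apply: cvgM; exact: cf'.
apply: ler_pM => //; first by rewrite subr_ge0.
- by apply: Rintegral_ge0 => t _; exact: sqr_ge0.
- by lra.
- rewrite Rintegral_itv_bndo_bndc; last first.
    apply: integrableS (continuous_Rintegrable_itv a (a + h) cf2) => //.
    exact: subset_itv_co_cc.
  rewrite /Rintegral fine_le//.
  + apply: integrable_fin_num => //; exact: continuous_Rintegrable_itv.
  + apply: integrable_fin_num => //; exact: continuous_Rintegrable_itv.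
  + apply: ge0_subset_integral => //.
    * apply/measurable_EFinP/measurable_funTS; exact: continuous_measurable_fun.
    * by move=> t _; rewrite lee_fin sqr_ge0.
    * by move=> t /=; rewrite !in_itv/= => /andP[? ?]; apply/andP; split; lra.
Qed.

Lemma tonelli_rect2 (A B : set R) (f : T2 -> \bar R) :
  measurable (A : set T1) -> measurable (B : set T1) ->
  measurable_fun (setT : set T2) f -> (forall p, 0 <= f p)%E ->
  (\int[mu2]_(p in A `*` B) f p = \int[mu1]_(y in B) \int[mu1]_(x in A) f (x, y))%E.
Proof.
move=> mA mB mf f0.
rewrite integral_mkcond fubini_tonelli2; last 2 first.
- by apply/(measurable_restrictT _ _).1; [exact: measurableX|exact: measurable_funTS].
- by apply: erestrict_ge0 => p _; exact: f0.
rewrite [RHS]integral_mkcond; apply: eq_integral => y _.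
rewrite /fubini_G/= [RHS]patchE; case: ifPn => yB.
  rewrite [RHS]integral_mkcond; apply: eq_integral => x _.
  by rewrite !patchE in_setX/= yB andbT.
apply: integral0_eq => x _; rewrite patchE in_setX/= (negbTE yB) andbF//.
Qed.

Lemma tonelli_rect1 (A B : set R) (f : T2 -> \bar R) :
  measurable (A : set T1) -> measurable (B : set T1) ->
  measurable_fun (setT : set T2) f -> (forall p, 0 <= f p)%E ->
  (\int[mu2]_(p in A `*` B) f p = \int[mu1]_(x in A) \int[mu1]_(y in B) f (x, y))%E.
Proof.
move=> mA mB mf f0.
rewrite integral_mkcond fubini_tonelli1; last 2 first.
- by apply/(measurable_restrictT _ _).1; [exact: measurableX|exact: measurable_funTS].
- by apply: erestrict_ge0 => p _; exact: f0.
rewrite [RHS]integral_mkcond; apply: eq_integral => x _.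
rewrite /fubini_F/= [RHS]patchE; case: ifPn => xA.
  rewrite [RHS]integral_mkcond; apply: eq_integral => y _.
  by rewrite !patchE in_setX/= xA.
apply: integral0_eq => y _; rewrite patchE in_setX/= (negbTE xA)//.
Qed.

Let itv_len (a h : R) : 0 < h -> mu1 `[a, a + h[ = h%:E.
Proof.
by move=> h0; rewrite lebesgue_measure_itv/= lte_fin ltrDl h0 -EFinB addrAC subrr add0r.
Qed.

Let itv_meas (a h : R) : measurable (`[a, a + h[%classic : set T1).
Proof. exact: measurable_itv. Qed.

Definition rect (a b c d : R) : set (R * R) := `[a, b[%classic `*` `[c, d[%classic.

Lemma measurable_rect a b c d : measurable (rect a b c d : set T2).
Proof. by apply: measurableX; exact: measurable_itv. Qed.

Lemma rect_cube a b c d : exists M, rect a b c d `<=` cube M.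
Proof.
exists (`|a| + `|b| + (`|c| + `|d|)) => -[x y]; rewrite /rect /cube/= !in_itv/=.
move=> [/andP[ax xb] /andP[cy yd]].
have := ler_norm b; have := ler_norm d; have := ler_norm (- a); have := ler_norm (- c).
rewrite !normrN => h1 h2 h3 h4.
have := normr_ge0 a; have := normr_ge0 b; have := normr_ge0 c; have := normr_ge0 d.
by move=> ????; split; apply/andP; split; lra.
Qed.

Lemma rect_finite a b c d : (mu2 (rect a b c d) < +oo)%E.
Proof.
have [M HM] := rect_cube a b c d.
exact: bounded_set_finite (measurable_rect _ _ _ _) HM.
Qed.

Lemma continuous_Rintegrable_rect (f : R * R -> R) a b c d : continuous f ->
  Rintegrable mu2 (rect a b c d) f.
Proof.
move=> cf; have [M HM] := rect_cube a b c d.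
exact: continuous_integrable_bounded cf (measurable_rect _ _ _ _) HM.
Qed.

Lemma square_measure a b h : 0 < h -> fine (mu2 (rect a (a + h) b (b + h))) = h ^+ 2.
Proof.
by move=> h0; rewrite plane_measureX ?itv_len//; exact: itv_meas.
Qed.

Lemma slice1_integral_fin (f : R * R -> R) (a h y : R) : continuous f ->
  (\int[mu1]_(x in `[a, (a + h)%R[) (f (x, y))%:E =
  (\int[mu1]_(x in `[a, (a + h)%R[) f (x, y))%R%:E)%E.
Proof.
move=> cf; rewrite fineK//; apply: integrable_fin_num => //.
have := continuous_Rintegrable_itv a (a + h) (continuous_slice1 (y := y) cf).
by apply: integrableS => //; exact: subset_itv_co_cc.
Qed.

Lemma slice2_integral_fin (f : R * R -> R) (b h x : R) : continuous f ->
  (\int[mu1]_(y in `[b, (b + h)%R[) (f (x, y))%:E =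
  (\int[mu1]_(y in `[b, (b + h)%R[) f (x, y))%R%:E)%E.
Proof.
move=> cf; rewrite fineK//; apply: integrable_fin_num => //.
have := continuous_Rintegrable_itv b (b + h) (continuous_slice2 (x := x) cf).
by apply: integrableS => //; exact: subset_itv_co_cc.
Qed.

Lemma slice1_integral_measurable (f : R * R -> R) (a h : R) : continuous f ->
  (forall p, 0 <= f p) ->
  measurable_fun (setT : set T1) (fun y : T1 => \int[mu1]_(x in `[a, a + h[) f (x, y)).
Proof.
move=> cf f0; apply/measurable_EFinP => /=.
pose F := (fun p : T2 => (f p)%:E) \_ (`[a, a + h[%classic `*` setT).
rewrite (_ : _ \o _ = fubini_G mu1 F).
  apply: measurable_fun_fubini_tonelli_G.
    apply/(measurable_restrictT _ _).1; first exact: measurableX.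
    by apply/measurable_EFinP; exact: continuous_measurable_plane_on.
  by apply: erestrict_ge0 => p _; rewrite lee_fin.
apply/funext => y; rewrite /= -slice1_integral_fin// /fubini_G [LHS]integral_mkcond.
by apply: eq_integral => x _; rewrite /F !patchE in_setX/= in_setT andbT.
Qed.

Lemma slice2_integral_measurable (f : R * R -> R) (b h : R) : continuous f ->
  (forall p, 0 <= f p) ->
  measurable_fun (setT : set T1) (fun x : T1 => \int[mu1]_(y in `[b, b + h[) f (x, y)).
Proof.
move=> cf f0; apply/measurable_EFinP => /=.
pose F := (fun p : T2 => (f p)%:E) \_ (setT `*` `[b, b + h[%classic).
rewrite (_ : _ \o _ = fubini_F mu1 F).
  apply: measurable_fun_fubini_tonelli_F.
    apply/(measurable_restrictT _ _).1; first exact: measurableX.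
    by apply/measurable_EFinP; exact: continuous_measurable_plane_on.
  by apply: erestrict_ge0 => p _; rewrite lee_fin.
apply/funext => x; rewrite /= -slice2_integral_fin// /fubini_F [LHS]integral_mkcond.
by apply: eq_integral => y _; rewrite /F !patchE in_setX/= in_setT.
Qed.

Let has_Rint_of_integral (A : set T2) (f : T2 -> R) (v : R) : 
  measurable_fun A f -> (forall p, A p -> 0 <= f p) ->
  (\int[mu2]_(p in A) (f p)%:E = v%:E)%E -> has_Rint mu2 A f v.
Proof.
move=> mf f0 E; split; last by rewrite /Rintegral E.
apply/integrableP; split; first exact/measurable_EFinP.
rewrite (eq_integral (fun p => (f p)%:E)) ?E ?ltry// => p /set_mem Ap.
by rewrite /= ger0_norm// f0.
Qed.

Lemma has_Rint_slice1 (f : R * R -> R) a b h : 0 < h -> continuous f ->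
  (forall p, 0 <= f p) ->
  has_Rint mu2 (rect a (a + h) b (b + h))
    (fun p => \int[mu1]_(x in `[a, a + h[) f (x, p.2))
    (h * \int[mu2]_(p in rect a (a + h) b (b + h)) f p).
Proof.
move=> h0 cf f0; have mA := slice1_integral_measurable a h cf f0.
have mA2 : measurable_fun (setT : set T2)
    (fun p => \int[mu1]_(x in `[a, a + h[) f (x, p.2)).
  by apply: (measurableT_comp mA); exact: measurable_snd.
have A0 y : 0 <= \int[mu1]_(x in `[a, a + h[) f (x, y).
  by apply: Rintegral_ge0.
apply: has_Rint_of_integral => //; first exact: measurable_funTS.
rewrite tonelli_rect2//; last 2 first.
- exact/measurable_EFinP.
- by move=> p; rewrite lee_fin.
rewrite (eq_integral (fun y : T1 => (\int[mu1]_(x in `[a, a + h[) f (x, y))%R%:E * h%:E)%E); last first.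
  by move=> y _ /=; rewrite integral_cst//; congr (_ * _)%E; exact: itv_len.
rewrite ge0_integralZr//; last 3 first.
- by apply: measurable_funTS; exact/measurable_EFinP.
- by move=> y _; rewrite lee_fin.
- by rewrite lee_fin ltW.
rewrite EFinM muleC; congr (_ * _)%E.
under eq_integral do rewrite -slice1_integral_fin//.
rewrite -(@tonelli_rect2 _ _ (fun p => (f p)%:E))//; last first.
  by apply/measurable_EFinP; exact: continuous_measurable_plane.
rewrite fineK//; apply: integrable_fin_num; first exact: measurable_rect.
exact: continuous_Rintegrable_rect.
Qed.

Lemma has_Rint_slice2 (f : R * R -> R) a b h : 0 < h -> continuous f ->
  (forall p, 0 <= f p) ->
  has_Rint mu2 (rect a (a + h) b (b + h))
    (fun p => \int[mu1]_(y in `[b, b + h[) f (p.1, y))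
    (h * \int[mu2]_(p in rect a (a + h) b (b + h)) f p).
Proof.
move=> h0 cf f0; have mA := slice2_integral_measurable b h cf f0.
have mA2 : measurable_fun (setT : set T2)
    (fun p => \int[mu1]_(y in `[b, b + h[) f (p.1, y)).
  by apply: (measurableT_comp mA); exact: measurable_fst.
have A0 x : 0 <= \int[mu1]_(y in `[b, b + h[) f (x, y).
  by apply: Rintegral_ge0.
apply: has_Rint_of_integral => //; first exact: measurable_funTS.
rewrite tonelli_rect1//; last 2 first.
- exact/measurable_EFinP.
- by move=> p; rewrite lee_fin.
rewrite (eq_integral (fun x : T1 => (\int[mu1]_(y in `[b, b + h[) f (x, y))%R%:E * h%:E)%E); last first.
  by move=> x _ /=; rewrite integral_cst//; congr (_ * _)%E; exact: itv_len.
rewrite ge0_integralZr//; last 3 first.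
- by apply: measurable_funTS; exact/measurable_EFinP.
- by move=> y _; rewrite lee_fin.
- by rewrite lee_fin ltW.
rewrite EFinM muleC; congr (_ * _)%E.
under eq_integral do rewrite -slice2_integral_fin//.
rewrite -(@tonelli_rect1 _ _ (fun p => (f p)%:E))//; last first.
  by apply/measurable_EFinP; exact: continuous_measurable_plane.
rewrite fineK//; apply: integrable_fin_num; first exact: measurable_rect.
exact: continuous_Rintegrable_rect.
Qed.

(** A horizontal and a vertical segment join two points p and q of the square, so
    (f p - f q)^2 is bounded by the energies of f along these segments;
    integrating over p and then over q gives the inequality. *)
Lemma poincare_square f f1 f2 (a b h : R) : 0 < h -> C1fun f f1 f2 ->
  let Q := rect a (a + h) b (b + h) in
  \int[mu2]_(p in Q) (f p ^+ 2) <=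
    h ^- 2 * (\int[mu2]_(p in Q) f p) ^+ 2
    + h ^+ 2 * \int[mu2]_(p in Q) (f1 p ^+ 2 + f2 p ^+ 2).
Proof.
move=> h0 Hf /=; set Q := rect _ _ _ _; have cf := C1fun_continuous Hf; have [hf cf1 cf2] := Hf.
have sqc (g : R * R -> R) : continuous g -> continuous (fun p => g p ^+ 2).
  by move=> cg p; apply: cvgM; exact: cg.
have mQ : measurable (Q : set T2) := measurable_rect _ _ _ _.
have fQ : (mu2 Q < +oo)%E := rect_finite _ _ _ _.
have muQ : fine (mu2 Q) = h ^+ 2 := square_measure a b h0.
set M := \int[mu2]_(p in Q) (f p ^+ 2).
set A := \int[mu2]_(p in Q) f p.
pose E1 := \int[mu2]_(p in Q) (f1 p ^+ 2).
pose E2 := \int[mu2]_(p in Q) (f2 p ^+ 2).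
have IM : has_Rint mu2 Q (fun p => f p ^+ 2) M.
  by apply: has_Rint_int; apply: continuous_Rintegrable_rect; exact: sqc.
have IA : has_Rint mu2 Q f A.
  by apply: has_Rint_int; exact: continuous_Rintegrable_rect.
have IE1 : has_Rint mu2 Q (fun p => f1 p ^+ 2) E1.
  by apply: has_Rint_int; apply: continuous_Rintegrable_rect; exact: sqc.
have IE2 : has_Rint mu2 Q (fun p => f2 p ^+ 2) E2.
  by apply: has_Rint_int; apply: continuous_Rintegrable_rect; exact: sqc.
pose al y := \int[mu1]_(x in `[a, a + h[) (f1 (x, y) ^+ 2).
pose be x := \int[mu1]_(y in `[b, b + h[) (f2 (x, y) ^+ 2).
have Ial : has_Rint mu2 Q (fun p => al p.2) (h * E1).
  by apply: (@has_Rint_slice1 (fun p => f1 p ^+ 2)) => //;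
    [exact: sqc|move=> p; exact: sqr_ge0].
have Ibe : has_Rint mu2 Q (fun p => be p.1) (h * E2).
  by apply: (@has_Rint_slice2 (fun p => f2 p ^+ 2)) => //;
    [exact: sqc|move=> p; exact: sqr_ge0].
(* the path from p to q goes through (q.1, p.2) *)
have pw p q : Q p -> Q q -> f p ^+ 2 - 2 * f q * f p + f q ^+ 2 <=
    2 * h * al p.2 + 2 * h * be q.1.
  case: p q => [x y] [x' y'] [/= xa yb] [/= xa' yb'].
  have h1 : (f (x, y) - f (x', y)) ^+ 2 <= h * al y.
    apply: (@sqr_increment_le_energy (fun t => f (t, y)) (fun t => f1 (t, y)) a h) => //.
      by move=> t; exact: has_grad_slice1 (hf (t, y)).
    exact: continuous_slice1.
  have h2 : (f (x', y) - f (x', y')) ^+ 2 <= h * be x'.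
    apply: (@sqr_increment_le_energy (fun t => f (x', t)) (fun t => f2 (x', t)) b h) => //.
      by move=> t; exact: has_grad_slice2 (hf (x', t)).
    exact: continuous_slice2.
  have h3 := sqr_ge0 ((f (x, y) - f (x', y)) - (f (x', y) - f (x', y'))).
  nra.
have step q : Q q -> M - 2 * f q * A + f q ^+ 2 * h ^+ 2 <=
    2 * h * (h * E1) + 2 * h * be q.1 * h ^+ 2.
  move=> Qq; rewrite -muQ.
  apply: (has_Rint_le mQ (has_RintD mQ (has_RintB mQ IM (has_RintZ mQ (2 * f q) IA))
     (has_Rint_cst mQ (f q ^+ 2) fQ))
     (has_RintD mQ (has_RintZ mQ (2 * h) Ial) (has_Rint_cst mQ (2 * h * be q.1) fQ))).
  by move=> p Qp; exact: pw.
have fin : M * h ^+ 2 - 2 * A * A + h ^+ 2 * M <=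
    2 * h * (h * E1) * h ^+ 2 + 2 * h * h ^+ 2 * (h * E2).
  rewrite -{1 2}muQ -{1}muQ.
  apply: (has_Rint_le mQ (has_RintD mQ (has_RintB mQ (has_Rint_cst mQ M fQ)
     (has_RintZ mQ (2 * A) IA)) (has_RintZ mQ (fine (mu2 Q)) IM))
     (has_RintD mQ (has_Rint_cst mQ (2 * h * (h * E1)) fQ) (has_RintZ mQ (2 * h * h ^+ 2) Ibe))).
  by move=> q Qq; rewrite muQ; have := step q Qq; lra.
have -> : \int[mu2]_(p in Q) (f1 p ^+ 2 + f2 p ^+ 2) = E1 + E2.
  by have [_ ->] := has_RintD mQ IE1 IE2.
have h20 : 0 < h ^+ 2 by rewrite exprn_gt0.
rewrite -(ler_pM2l h20) mulrDr mulrA mulfV ?gt_eqF// mul1r.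
nra.
Qed.

Lemma rect_splitl a m b c d : a <= m -> m <= b ->
  rect a b c d = rect a m c d `|` rect m b c d.
Proof.
move=> am mb; apply/seteqP; split => -[x y]; rewrite /rect/= !in_itv/=.
  move=> [/andP[ax xb] /andP[cy yd]].
  by have [xm|mx] := ltP x m; [left|right]; split; apply/andP; split.
by case=> -[/andP[ax xb] /andP[cy yd]]; split; apply/andP; split => //; lra.
Qed.

Lemma rect_splitr a b c m d : c <= m -> m <= d ->
  rect a b c d = rect a b c m `|` rect a b m d.
Proof.
move=> am mb; apply/seteqP; split => -[x y]; rewrite /rect/= !in_itv/=.
  move=> [/andP[ax xb] /andP[cy yd]].
  by have [xm|mx] := ltP y m; [left|right]; split; apply/andP; split.
by case=> -[/andP[ax xb] /andP[cy yd]]; split; apply/andP; split => //; lra.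
Qed.

Lemma Rintegral_rect_splitl (f : R * R -> R) a m b c d : continuous f ->
  a <= m -> m <= b -> \int[mu2]_(p in rect a b c d) f p =
  \int[mu2]_(p in rect a m c d) f p + \int[mu2]_(p in rect m b c d) f p.
Proof.
move=> cf am mb; rewrite (rect_splitl c d am mb) Rintegral_setU//.
- exact: measurable_rect.
- exact: measurable_rect.
- by rewrite -rect_splitl//; exact: continuous_Rintegrable_rect.
- apply/disj_setPS => -[x y] [] /=; rewrite /rect/= !in_itv/=.
  by move=> [/andP[_ h] _] [/andP[h' _] _]; lra.
Qed.

Lemma Rintegral_rect_splitr (f : R * R -> R) a b c m d : continuous f ->
  c <= m -> m <= d -> \int[mu2]_(p in rect a b c d) f p =
  \int[mu2]_(p in rect a b c m) f p + \int[mu2]_(p in rect a b m d) f p.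
Proof.
move=> cf am mb; rewrite (rect_splitr a b am mb) Rintegral_setU//.
- exact: measurable_rect.
- exact: measurable_rect.
- by rewrite -rect_splitr//; exact: continuous_Rintegrable_rect.
- apply/disj_setPS => -[x y] [] /=; rewrite /rect/= !in_itv/=.
  by move=> [_ /andP[_ h]] [_ /andP[h' _]]; lra.
Qed.

Definition cell (a b h : R) (i j : nat) : set (R * R) :=
  rect (a + i%:R * h) (a + i%:R * h + h) (b + j%:R * h) (b + j%:R * h + h).

(** Squares are half-open so that they tile: a grid is built by adding cells to a
    row, and then rows to the grid. *)
Lemma poincare_row f f1 f2 (a b h : R) (n j : nat) : 0 < h -> C1fun f f1 f2 ->
  \int[mu2]_(p in rect a (a + n%:R * h) (b + j%:R * h) (b + j%:R * h + h)) (f p ^+ 2) <=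
    h ^- 2 * \sum_(i < n) (\int[mu2]_(p in cell a b h i j) f p) ^+ 2
    + h ^+ 2 * \int[mu2]_(p in rect a (a + n%:R * h) (b + j%:R * h) (b + j%:R * h + h))
        (f1 p ^+ 2 + f2 p ^+ 2).
Proof.
move=> h0 Hf; have cf := C1fun_continuous Hf; have [_ cf1 cf2] := Hf.
have cff : continuous (fun p => f p ^+ 2) by move=> p; apply: cvgM; exact: cf.
have cgg : continuous (fun p => f1 p ^+ 2 + f2 p ^+ 2).
  by move=> p; apply: cvgD; apply: cvgM; [exact: cf1|exact: cf1|exact: cf2|exact: cf2].
have rect0 c d : rect a (a + 0%:R * h) c d = set0.
  apply/seteqP; split => // -[x y]; rewrite /rect/= !in_itv/=.
  by move=> [/andP[h1 h2] _]; lra.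
elim: n => [|n IH].
  by rewrite !rect0 big_ord0 !Rintegral_set0 !mulr0 addr0.
have e : a + n.+1%:R * h = a + n%:R * h + h.
  by rewrite -addn1 natrD mulrDl mul1r addrA.
have am : a <= a + n%:R * h by rewrite lerDl mulr_ge0// ltW.
have mb : a + n%:R * h <= a + n.+1%:R * h by rewrite e lerDl ltW.
rewrite !(Rintegral_rect_splitl _ _ _ am mb)// big_ord_recr/=.
have := poincare_square (a + n%:R * h) (b + j%:R * h) h0 Hf.
rewrite /= e => H.
have -> : cell a b h n j = rect (a + n%:R * h) (a + n%:R * h + h)
  (b + j%:R * h) (b + j%:R * h + h) by [].
by move: IH H; rewrite !mulrDr; lra.
Qed.

Lemma poincare_grid f f1 f2 (a b h : R) (n m : nat) : 0 < h -> C1fun f f1 f2 ->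
  \int[mu2]_(p in rect a (a + n%:R * h) b (b + m%:R * h)) (f p ^+ 2) <=
    h ^- 2 * \sum_(j < m) \sum_(i < n) (\int[mu2]_(p in cell a b h i j) f p) ^+ 2
    + h ^+ 2 * \int[mu2]_(p in rect a (a + n%:R * h) b (b + m%:R * h))
        (f1 p ^+ 2 + f2 p ^+ 2).
Proof.
move=> h0 Hf; have cf := C1fun_continuous Hf; have [_ cf1 cf2] := Hf.
have cff : continuous (fun p => f p ^+ 2) by move=> p; apply: cvgM; exact: cf.
have cgg : continuous (fun p => f1 p ^+ 2 + f2 p ^+ 2).
  by move=> p; apply: cvgD; apply: cvgM; [exact: cf1|exact: cf1|exact: cf2|exact: cf2].
have rect0 c d : rect c d b (b + 0%:R * h) = set0.
  apply/seteqP; split => // -[x y]; rewrite /rect/= !in_itv/=.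
  by move=> [_ /andP[h1 h2]]; lra.
elim: m => [|m IH].
  by rewrite !rect0 big_ord0 !Rintegral_set0 !mulr0 addr0.
have e : b + m.+1%:R * h = b + m%:R * h + h.
  by rewrite -addn1 natrD mulrDl mul1r addrA.
have am : b <= b + m%:R * h by rewrite lerDl mulr_ge0// ltW.
have mb : b + m%:R * h <= b + m.+1%:R * h by rewrite e lerDl ltW.
rewrite !(Rintegral_rect_splitr _ _ _ am mb)// big_ord_recr/=.
have := poincare_row a b n m h0 Hf.
rewrite e => H.
by move: IH H; rewrite !mulrDr; lra.
Qed.

End Poincare.

(** * Square-integrable functions *)

Section SquareIntegrable.
Context d (T : measurableType d) (R : realType) (mu : {measure set T -> \bar R}).
Variables (D : set T) (mD : measurable D).
Implicit Types f g : T -> R.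
Notation Rintble := (Rintegrable mu D).

Definition sqint f := measurable_fun D f /\ Rintble (fun x => f x ^+ 2).

Definition ip f g : R := \int[mu]_(x in D) (f x * g x).
Definition nsq f : R := \int[mu]_(x in D) (f x ^+ 2).

Lemma ipC f g : ip f g = ip g f.
Proof. by apply: eq_Rintegral => x _; rewrite mulrC. Qed.

Lemma sqint_lty f : measurable_fun D f ->
  (\int[mu]_(x in D) ((f x) ^+ 2)%:E < +oo)%E -> sqint f.
Proof.
move=> mf fin; split => //; apply/integrableP; split.
  by apply/measurable_EFinP; exact: measurable_funX.
rewrite (eq_integral (fun x => (f x ^+ 2)%:E))// => x _.
by rewrite /= ger0_norm// sqr_ge0.
Qed.

Lemma nsq_fin f : sqint f ->
  (\int[mu]_(x in D) ((f x) ^+ 2)%:E = (nsq f)%:E)%E.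
Proof. by move=> [_ h]; rewrite fineK//; exact: integrable_fin_num. Qed.

Lemma sqintM f g : sqint f -> sqint g -> Rintble (fun x => f x * g x).
Proof.
move=> [mf If] [mg Ig]; apply: le_Rintegrable (RintegrableD mD If Ig) => //.
  exact: measurable_funM.
move=> x _; rewrite ler_norml; apply/andP; split.
  have := sqr_ge0 (f x + g x); have := sqr_ge0 (f x); have := sqr_ge0 (g x); nra.
have := sqr_ge0 (f x - g x); have := sqr_ge0 (f x); have := sqr_ge0 (g x); nra.
Qed.

Lemma sqintZ c f : sqint f -> sqint (fun x => c * f x).
Proof.
move=> [mf If]; split; first by apply: measurable_funM.
by apply: eq_Rintegrable (RintegrableZ mD (c ^+ 2) If) => // x _; rewrite exprMn.
Qed.

Lemma sqintD f g : sqint f -> sqint g -> sqint (fun x => f x + g x).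
Proof.
move=> sf sg; have Ifg := sqintM sf sg; case: sf sg => [mf If] [mg Ig].
split; first exact: measurable_funD.
apply: eq_Rintegrable (RintegrableD mD (RintegrableD mD If Ig) (RintegrableZ mD 2 Ifg)) => //.
by move=> x _; ring.
Qed.

Lemma sqintB f g : sqint f -> sqint g -> sqint (fun x => f x - g x).
Proof.
move=> sf /(sqintZ (-1)) sg; have := sqintD sf sg.
by under eq_fun do rewrite mulN1r.
Qed.

Lemma nsq_ge0 f : 0 <= nsq f.
Proof. by apply: Rintegral_ge0 => x _; exact: sqr_ge0. Qed.

Lemma nsqD f g t : sqint f -> sqint g ->
  nsq (fun x => f x + t * g x) = nsq f + 2 * t * ip f g + t ^+ 2 * nsq g.
Proof.
move=> sf sg; have Ifg := has_Rint_int (sqintM sf sg).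
have If := has_Rint_int sf.2; have Ig := has_Rint_int sg.2.
have [_ <-] := has_RintD mD (has_RintD mD If (has_RintZ mD (2 * t) Ifg))
  (has_RintZ mD (t ^+ 2) Ig).
by apply: eq_Rintegral => x _; ring.
Qed.

Lemma ipBl f g h : sqint f -> sqint g -> sqint h ->
  ip (fun x => f x - g x) h = ip f h - ip g h.
Proof.
move=> sf sg sh.
have [_ <-] := has_RintB mD (has_Rint_int (sqintM sf sh)) (has_Rint_int (sqintM sg sh)).
by apply: eq_Rintegral => x _; rewrite mulrBl.
Qed.

Lemma ipBr f g h : sqint f -> sqint g -> sqint h ->
  ip f (fun x => g x - h x) = ip f g - ip f h.
Proof. by move=> sf sg sh; rewrite ipC ipBl// ![ip _ f]ipC. Qed.

(** The discriminant of a nonnegative quadratic polynomial, possibly degenerate;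
    it serves every Cauchy-Schwarz argument below. *)
Lemma quadratic_ge0 (a b c : R) : 0 <= c ->
  (forall t, 0 <= a + 2 * t * b + t ^+ 2 * c) -> b ^+ 2 <= a * c.
Proof.
rewrite le_eqVlt => /predU1P[<-|c0] H.
  rewrite mulr0; have [->|b0] := eqVneq b 0; first by rewrite expr0n.
  have := H (- (a + 1) / (2 * b)).
  rewrite mulr0 addr0 (_ : 2 * _ * b = - (a + 1)); last first.
    by field.
  by move=> ?; exfalso; lra.
have := H (- b / c); rewrite (_ : _ + _ = (a * c - b ^+ 2) / c); last first.
  by field; rewrite gt_eqF.
by rewrite pmulr_lge0 ?invr_gt0// subr_ge0.
Qed.

Lemma cauchy_schwarz f g : sqint f -> sqint g -> ip f g ^+ 2 <= nsq f * nsq g.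
Proof.
move=> sf sg; apply: quadratic_ge0 => [|t]; first exact: nsq_ge0.
by rewrite -nsqD//; exact: nsq_ge0.
Qed.

Lemma nsq_eq0 (u : T -> R) : sqint u ->
  nsq u = 0 <-> {ae mu, forall p, D p -> u p = 0}.
Proof.
move=> su; have mu2u : measurable_fun D (fun p => (u p ^+ 2)%:E).
  by apply/measurable_EFinP; apply: measurable_funX; case: su.
have := @ae_eq_integral_abs _ _ _ mu D mD (fun p => (u p ^+ 2)%:E) mu2u.
rewrite (eq_integral (fun p => (u p ^+ 2)%:E)); last first.
  by move=> p _; rewrite /= ger0_norm// sqr_ge0.
rewrite (nsq_fin su) => E; split=> [u0|ae0].
  have /E : ((nsq u)%:E = 0)%E by rewrite u0.
  apply: filterS => p /= H Op; have := H Op; move=> [/eqP].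
  by rewrite sqrf_eq0 => /eqP.
suff : ((nsq u)%:E = 0)%E by move=> [].
apply/E; apply: filterS ae0 => p /= H /H ->; by rewrite expr0n.
Qed.

Definition cvg_sq (f_ : nat -> T -> R) f : Prop :=
  (\int[mu]_(x in D) ((f_ n x - f x) ^+ 2)%:E)%E @[n --> \oo] --> 0%E.

Lemma cvg_sq_sqint (f_ : nat -> T -> R) f : (forall n, sqint (f_ n)) -> measurable_fun D f ->
  cvg_sq f_ f -> sqint f.
Proof.
move=> sf mf /fine_cvgP[[N _ /(_ N (leqnn N)) fin] _].
have sd : sqint (fun x => f_ N x - f x).
  apply: sqint_lty; first by apply: measurable_funB => //; case: (sf N).
  by rewrite ltey_eq fin.
have := sqintB (sf N) sd.
by under eq_fun do rewrite opprB addrC subrK.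
Qed.

Lemma cvg_sq_nsq (f_ : nat -> T -> R) f : (forall n, sqint (f_ n)) -> sqint f ->
  cvg_sq f_ f <-> nsq (fun x => f_ n x - f x) @[n --> \oo] --> 0.
Proof.
move=> sf sg; split=> [/fine_cvgP[]//|h]; apply/fine_cvgP; split => //.
apply: nearW => n; rewrite nsq_fin//; exact: sqintB.
Qed.

(** With a = f_n - f and b = g_n - g the difference of the inner products is
    (a, b) + (a, g) + (f, b). *)
Lemma ip_cvg (f_ g_ : nat -> T -> R) f g : (forall n, sqint (f_ n)) -> (forall n, sqint (g_ n)) ->
  measurable_fun D f -> measurable_fun D g -> cvg_sq f_ f -> cvg_sq g_ g ->
  ip (f_ n) (g_ n) @[n --> \oo] --> ip f g.
Proof.
move=> sf_ sg_ mf mg cf cg.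
have sf := cvg_sq_sqint sf_ mf cf; have sg := cvg_sq_sqint sg_ mg cg.
have {}cf := (cvg_sq_nsq sf_ sf).1 cf; have {}cg := (cvg_sq_nsq sg_ sg).1 cg.
set a := fun n => nsq (fun x => f_ n x - f x) in cf.
set b := fun n => nsq (fun x => g_ n x - g x) in cg.
apply/subr_cvg0.
pose c n := 3 * (a n * b n + a n * nsq g + nsq f * b n).
have c0 : c n @[n --> \oo] --> 0.
  rewrite -[X in _ --> X](mulr0 3); apply: cvgMl_tmp.
  rewrite (_ : 0 = 0 * 0 + 0 * nsq g + nsq f * 0); last by ring.
  apply: cvgD; last exact: cvgMl_tmp.
  by apply: cvgD; [exact: cvgM|exact: cvgMr_tmp].
have le n : (ip (f_ n) (g_ n) - ip f g) ^+ 2 <= c n.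
  have sfn := sf_ n; have sgn := sg_ n.
  have su := sqintB sfn sf; have sv := sqintB sgn sg.
  have h1 := cauchy_schwarz su sv; have h2 := cauchy_schwarz su sg.
  have h3 := cauchy_schwarz sf sv; move: h1 h2 h3.
  rewrite -[nsq (fun x => f_ n x - f x)]/(a n) -[nsq (fun x => g_ n x - g x)]/(b n).
  rewrite (ipBl sfn sf sv) (ipBl sfn sf sg) !(ipBr _ sgn sg)// /c.
  set p := ip (f_ n) (g_ n); set q := ip f g; set r := ip f (g_ n); set w := ip (f_ n) g.
  move=> h1 h2 h3; have := sqr_ge0 ((p - w - (r - q)) - (w - q)).
  have := sqr_ge0 ((p - w - (r - q)) - (r - q)); have := sqr_ge0 ((w - q) - (r - q)).
  nra.
apply/cvgr0Pnorm_le => e e0.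
have /cvgr0Pnorm_le/(_ (e ^+ 2)) := c0; rewrite exprn_gt0// => /(_ isT).
apply: filterS => n h; rewrite -(ler_pXn2r (ltn0Sn 1)) ?nnegrE ?normr_ge0 ?(ltW e0)//.
rewrite real_normK ?num_real// (le_trans (le n))//.
exact: le_trans (ler_norm _) h.
Qed.

Lemma limn_einf_le (u : nat -> \bar R) (l : \bar R) :
  (forall n, u n <= l)%E -> (limn_einf u <= l)%E.
Proof.
move=> ul; rewrite limn_einf_lim; apply: lime_le; first exact: is_cvg_einfs.
apply: nearW => n; apply: le_trans (ul n).
by apply: ereal_inf_lbound; exists n => //=.
Qed.

(** The Riesz-Fischer theorem.  Along a fast subsequence the sum S of the terms
    4^k |f_(s (k+1)) - f_(s k)|^2 is integrable, hence finite almost everywhere,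
    and there the increments decay like 2^-k; weighting the squares replaces the
    triangle inequality in L^2.  Fatou's lemma identifies the limit. *)
Lemma sq_complete (f_ : nat -> T -> R) : (forall n, sqint (f_ n)) ->
  (forall e, 0 < e -> exists N, forall n m, (N <= n)%N -> (N <= m)%N ->
    nsq (fun x => f_ n x - f_ m x) <= e) ->
  exists2 f : T -> R, measurable_fun D f & cvg_sq f_ f.
Proof.
move=> sf Cf.
pose tol k : R := (4 ^+ k)^-1 * (1 / (2 ^ k.+1)%:R).
have tol0 k : 0 < tol k.
  by rewrite mulr_gt0 ?invr_gt0 ?exprn_gt0// divr_gt0// ltr0n expn_gt0.
have /choice[N HN] := fun k => Cf _ (tol0 k).
pose s k := (\max_(i < k.+1) N i)%N.
have Ns j k : (j <= k)%N -> (N j <= s k)%N.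
  by move=> jk; exact: (@leq_bigmax_cond _ xpredT (fun i : 'I_k.+1 => N i) (Ordinal (jk : (j < k.+1)%N))).
pose dk k x := f_ (s k.+1) x - f_ (s k) x.
have sdk k : sqint (dk k) by exact: sqintB.
pose S x := (\sum_(0 <= k <oo) (4 ^+ k * dk k x ^+ 2)%:E)%E.
have mdk k : measurable_fun D (fun x => (4 ^+ k * dk k x ^+ 2)%:E).
  apply/measurable_EFinP; apply: measurable_funM => //; apply: measurable_funX.
  by case: (sdk k).
have dk0 k x : D x -> (0 <= (4 ^+ k * dk k x ^+ 2)%:E)%E.
  by move=> _; rewrite lee_fin mulr_ge0 ?sqr_ge0// exprn_ge0.
have IS : (\int[mu]_(x in D) S x <= 1%:E)%E.
  rewrite integral_nneseries//; apply: le_trans (epsilon_trick0 xpredT ler01).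
  apply: lee_nneseries => [k *|k *]; first by apply: integral_ge0 => x Dx; exact: dk0.
  under eq_integral do rewrite EFinM.
  have md2 : measurable_fun D (fun x => (dk k x ^+ 2)%:E).
    by apply/measurable_EFinP; apply: measurable_funX; case: (sdk k).
  have d20 x : D x -> (0 <= (dk k x ^+ 2)%:E)%E by rewrite lee_fin sqr_ge0.
  have k40 : (0 <= (4 ^+ k : R)%:E)%E by rewrite lee_fin exprn_ge0.
  rewrite ge0_integralZl//.
  rewrite nsq_fin// -EFinM lee_fin -ler_pdivlMl ?exprn_gt0//.
  apply: HN; first exact: Ns.
  exact: Ns.
have mS : measurable_fun D S.
  by apply: ge0_emeasurable_sum => // k x Dx _; exact: dk0.
have S0 x : D x -> (0 <= S x)%E.
  by move=> Dx; apply: nneseries_ge0 => k _ _; exact: dk0.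
have iS : mu.-integrable D S.
  apply/integrableP; split => //; apply: le_lt_trans (ltry 1).
  apply: le_trans IS; rewrite le_eqVlt; apply/orP; left; apply/eqP.
  by apply: eq_integral => x /set_mem Dx; rewrite gee0_abs// S0.
have ae := integrable_ae mD iS.
pose g k x := (f_ (s k) x)%:E.
pose f x := fine (limn_esup (g ^~ x)).
have conv x : D x -> S x \is a fin_num -> f_ (s k) x @[k --> \oo] --> f x.
  move=> Dx Sx.
  have cv : cvgn (fun k => f_ (s k) x).
    rewrite (_ : (fun k => _) = (fun k => f_ (s 0%N) x + series (fun k => dk k x) k)); last first.
      apply/funext => k; rewrite (eq_sum_telescope (fun k => f_ (s k) x)).
      by congr (_ + _); rewrite /series/=; apply: eq_bigr.
    apply: is_cvgD; first exact: is_cvg_cst.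
    apply: normed_cvg; pose M := Num.sqrt (fine (S x)).
    apply: (@series_le_cvg _ _ (geometric M (2^-1))).
    - by move=> n; exact: normr_ge0.
    - by move=> n /=; rewrite mulr_ge0 ?sqrtr_ge0// exprn_ge0// invr_ge0.
    - move=> k /=; rewrite -(ler_pXn2r (ltn0Sn 1)) ?nnegrE//; last first.
        by rewrite mulr_ge0 ?sqrtr_ge0// exprn_ge0// invr_ge0.
      rewrite real_normK ?num_real// exprMn sqr_sqrtr ?fine_ge0 ?S0//.
      have -> : (2^-1 ^+ k) ^+ 2 = (4 ^+ k)^-1 :> R.
        by rewrite -exprM mulnC exprM (_ : 2^-1 ^+ 2 = 4^-1 :> R) ?exprVn//; field.
      rewrite ler_pdivlMr ?exprn_gt0// mulrC -lee_fin fineK//.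
      have := nneseries_lim_ge k.+1 (fun n (_ : (0 <= n)%N) (_ : true) => dk0 n x Dx).
      apply: le_trans; rewrite big_nat_recr//= leeDr// sume_ge0// => i _; exact: dk0.
    - by apply: is_cvg_geometric_series; rewrite ger0_norm ?invr_ge0// invf_lt1// ltr1n.
  have cvE : g k x @[k --> \oo] --> (limn (fun k => f_ (s k) x))%:E.
    by apply: cvg_EFin; [exact: nearW|exact: cv].
  by rewrite /f (cvg_limn_einf_sup cvE).2/=.
have mf : measurable_fun D f.
  apply: (measurableT_comp (fine_measurable measurableT)) => //.
  apply: measurable_fun_limn_esup => k; apply/measurable_EFinP.
  by case: (sf (s k)).
exists f => //.
(* Fatou's lemma in the index of the subsequence *)
have main j n : (N j <= n)%N ->
    (\int[mu]_(x in D) ((f_ n x - f x) ^+ 2)%:E <= (tol j)%:E)%E.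
  move=> Nn.
  pose h k x := ((f_ n x - f_ (s (k + j)%N) x) ^+ 2)%:E.
  have mh k : measurable_fun D (h k).
    apply/measurable_EFinP; apply: measurable_funX.
    by case: (sqintB (sf n) (sf (s (k + j)%N))).
  have h0 k x : D x -> (0 <= h k x)%E by move=> _; rewrite lee_fin sqr_ge0.
  have := fatou mu mD mh h0.
  move=> fat; apply: le_trans (_ : \int[mu]_(x in D) limn_einf (h ^~ x) <= _)%E.
    rewrite le_eqVlt; apply/orP; left; apply/eqP; apply: ae_eq_integral => //.
    - by apply/measurable_EFinP; apply: measurable_funX; apply: measurable_funB => //; case: (sf n).
    - rewrite (_ : (fun x => _) = (fun x => - limn_esup (fun k => - h k x))%E)//.
      apply: measurableT_comp => //; apply: measurable_fun_limn_esup => k.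
      exact: measurableT_comp.
    - apply: filterS ae => x Sx Dx; have := conv x Dx (Sx Dx) => cx.
      apply/esym; apply: (@cvg_limn_einf_sup _ _ _ _).1.
      apply: cvg_EFin; first exact: nearW.
      apply: cvgM; apply: cvgB; try exact: cvg_cst.
        by rewrite (cvg_shiftn j (fun k => f_ (s k) x)).
      by rewrite (cvg_shiftn j (fun k => f_ (s k) x)).
  apply: le_trans fat _; apply: limn_einf_le => k.
  rewrite /h nsq_fin ?lee_fin; last exact: sqintB.
  by apply: HN => //; apply: Ns; exact: leq_addl.
have sff : sqint f.
  have sd : sqint (fun x => f_ (N 0%N) x - f x).
    apply: sqint_lty; first by apply: measurable_funB => //; case: (sf (N 0%N)).
    by apply: le_lt_trans (main 0%N _ (leqnn _)) _; rewrite ltry.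
  have := sqintB (sf (N 0%N)) sd.
  by under eq_fun do rewrite opprB addrC subrK.
apply/(cvg_sq_nsq sf sff)/cvgr0Pnorm_le => e e0.
have [j je] : exists j, tol j <= e.
  have := @cvg_geometric R 1 (4^-1).
  rewrite ger0_norm ?invr_ge0// invf_lt1// ltr1n => /(_ isT)/cvgr0Pnorm_le/(_ e e0).
  move=> [j _ /(_ j (leqnn _))/=]; rewrite mul1r ger0_norm; last by rewrite exprn_ge0// invr_ge0.
  move=> h; exists j; apply: le_trans h; rewrite /tol exprVn ler_piMr ?invr_ge0 ?exprn_ge0//.
  by rewrite div1r invf_le1 ?ltr0n ?expn_gt0// ler1n expn_gt0.
exists (N j) => // n /= Nn; rewrite ger0_norm ?nsq_ge0//.
apply: le_trans je; rewrite -lee_fin -nsq_fin; last exact: sqintB.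
exact: main.
Qed.

End SquareIntegrable.

(** * Mass and energy of compactly supported C^1 functions *)

Section CompactlySupported.
Variable R : realType.
Notation T2 := (measurableTypeR R * measurableTypeR R)%type.
Notation mu2 := (@plane_measure R).
Variable Om : set (R * R).
Implicit Types (phi psi : R * R -> R).

Lemma C1c_C1fun phi : C1c Om phi -> C1fun phi (partial1 phi) (partial2 phi).
Proof. by move=> [d [c1 c2] _ _]; split => // p; exact: differentiable_has_grad. Qed.

Lemma C1cI phi f1 f2 (K : set (R * R)) : C1fun phi f1 f2 -> compact K -> K `<=` Om ->
  (forall p, ~ K p -> phi p = 0) -> C1c Om phi.
Proof.
move=> Hf cK KO phi0.
have clK : closure [set p | phi p != 0] `<=` K.
  have Kc : closed K.
    by apply: compact_closed => //; exact: norm_hausdorff.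
  rewrite [X in _ `<=` X](closure_id K).1//.
  apply: closureS => p /= /eqP pn0; apply: contrapT => /phi0; exact: pn0.
split.
- by move=> p; case: Hf => h _ _; exact: has_grad_diff (h p).
- by rewrite (C1fun_partial1 Hf) (C1fun_partial2 Hf); case: Hf.
- by apply: subclosed_compact cK clK; exact: closed_closure.
- exact: subset_trans clK KO.
Qed.

Lemma C1c_near0 phi p : C1c Om phi -> ~ Om p -> \forall q \near p, 0 = phi q.
Proof.
move=> [_ _ _ sO] nOp.
have o : open (~` closure [set p | phi p != 0]) by apply: closed_openC; exact: closed_closure.
have : (~` closure [set p | phi p != 0]) p by move=> /sO.
move=> /(conj o)/open_nbhs_nbhs; apply: filterS => q /= nq; apply/esym/eqP/negPn/negP => h.
by apply: nq; exact: subset_closure.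
Qed.

Lemma C1c_out phi p : C1c Om phi -> ~ Om p ->
  [/\ phi p = 0, partial1 phi p = 0 & partial2 phi p = 0].
Proof.
move=> cphi nOp; have near0 := C1c_near0 cphi nOp.
have h0 := has_grad_near near0 (has_grad_cst 0 p).
by split; [exact/esym/(nbhs_singleton near0)|exact: has_grad_partial1 h0|
  exact: has_grad_partial2 h0].
Qed.

Lemma C1c_support phi : C1c Om phi -> exists M, forall p : R * R, M < `|p| -> phi p = 0.
Proof.
move=> [_ _ cS _]; have [M [_ HM]] := compact_bounded cS.
exists (`|M| + 1) => p Mp; apply/eqP/negPn/negP => h.
have M1 : M < `|M| + 1 by rewrite (le_lt_trans (ler_norm M)) ?ltrDl.
by have := HM _ M1 p (@subset_closure _ [set p | phi p != 0] p h); rewrite /= leNgt Mp.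
Qed.

Lemma C1c_cc phi : C1c Om phi -> [/\ cc phi, cc (partial1 phi) & cc (partial2 phi)].
Proof.
move=> cphi; have [M HM] := C1c_support cphi.
exact: C1fun_cc (C1c_C1fun cphi) HM.
Qed.

Hypothesis mOm : measurable (Om : set T2).

Lemma cc_sqint phi : cc phi -> sqint mu2 Om phi.
Proof.
move=> cphi; split; first by apply: continuous_measurable_plane_on; case: cphi.
have := integrable_cc (cc_sqr cphi).
by apply: integrableS => //.
Qed.

Lemma C1c_sqint phi : C1c Om phi ->
  [/\ sqint mu2 Om phi, sqint mu2 Om (partial1 phi) & sqint mu2 Om (partial2 phi)].
Proof. by move=> /C1c_cc[h h1 h2]; split; exact: cc_sqint. Qed.

Lemma C1c_sqint0 phi : C1c Om phi -> sqint mu2 Om phi.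
Proof. by move=> /C1c_sqint[h _ _]; exact: h. Qed.

Lemma C1c_sqint1 phi : C1c Om phi -> sqint mu2 Om (partial1 phi).
Proof. by move=> /C1c_sqint[_ h _]; exact: h. Qed.

Lemma C1c_sqint2 phi : C1c Om phi -> sqint mu2 Om (partial2 phi).
Proof. by move=> /C1c_sqint[_ _ h]; exact: h. Qed.

Lemma Rintegral_subset_support (A : set T2) (f : T2 -> R) :
  Om `<=` A -> (forall p, ~ Om p -> f p = 0) ->
  \int[mu2]_(p in Om) f p = \int[mu2]_(p in A) f p.
Proof.
move=> OA f0; rewrite [LHS]Rintegral_mkcond [RHS]Rintegral_mkcond.
apply: eq_Rintegral => p _; rewrite !patchE; case: ifPn => pO.
  by rewrite ifT// inE; apply: OA; rewrite inE in pO.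
case: ifPn => // _; apply/esym/f0 => h; move: pO; rewrite notin_setE; exact.
Qed.

Lemma C1cD phi psi t : C1c Om phi -> C1c Om psi ->
  [/\ C1c Om (fun p => phi p + t * psi p),
   partial1 (fun p => phi p + t * psi p) = (fun p => partial1 phi p + t * partial1 psi p) &
   partial2 (fun p => phi p + t * psi p) = (fun p => partial2 phi p + t * partial2 psi p)].
Proof.
move=> cphi cpsi.
have H := C1funD (C1c_C1fun cphi) (C1funZ t (C1c_C1fun cpsi)).
split; last 2 first.
- exact: C1fun_partial1 H.
- exact: C1fun_partial2 H.
have [_ _ k1 s1] := cphi; have [_ _ k2 s2] := cpsi.
apply: (C1cI H (compactU k1 k2)); first by rewrite subUset.
move=> p /not_orP[n1 n2].
have -> : phi p = 0 by apply/eqP/negPn/negP => h; apply: n1; exact: subset_closure.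
have -> : psi p = 0 by apply/eqP/negPn/negP => h; apply: n2; exact: subset_closure.
by rewrite mulr0 addr0.
Qed.

Definition mass phi := nsq mu2 Om phi.
Definition energy phi := nsq mu2 Om (partial1 phi) + nsq mu2 Om (partial2 phi).

Lemma nsq_partial_le_energy phi :
  nsq mu2 Om (partial1 phi) <= energy phi /\ nsq mu2 Om (partial2 phi) <= energy phi.
Proof. by split; [rewrite lerDl nsq_ge0|rewrite lerDr nsq_ge0]. Qed.

Lemma massD phi psi t : C1c Om phi -> C1c Om psi ->
  mass (fun p => phi p + t * psi p) =
  mass phi + 2 * t * ip mu2 Om phi psi + t ^+ 2 * mass psi.
Proof. by move=> /C1c_sqint[? _ _] /C1c_sqint[? _ _]; exact: nsqD. Qed.

Lemma energyD phi psi t : C1c Om phi -> C1c Om psi ->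
  energy (fun p => phi p + t * psi p) =
  energy phi + 2 * t * (ip mu2 Om (partial1 phi) (partial1 psi)
    + ip mu2 Om (partial2 phi) (partial2 psi)) + t ^+ 2 * energy psi.
Proof.
move=> cphi cpsi; have [_ e1 e2] := C1cD t cphi cpsi.
have [_ s1 s2] := C1c_sqint cphi; have [_ t1 t2] := C1c_sqint cpsi.
rewrite /energy e1 e2 (nsqD mOm t s1 t1) (nsqD mOm t s2 t2).
have aux (a b c a' b' c' : R) : (a + 2 * t * b + t ^+ 2 * c) +
    (a' + 2 * t * b' + t ^+ 2 * c') = (a + a') + 2 * t * (b + b') + t ^+ 2 * (c + c').
  by ring.
exact: aux.
Qed.

Lemma mass_ge0 phi : 0 <= mass phi. Proof. exact: nsq_ge0. Qed.

Lemma energy_ge0 phi : 0 <= energy phi.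
Proof. by rewrite addr_ge0// nsq_ge0. Qed.

Lemma C1cZ phi t : C1c Om phi -> C1c Om (fun p => t * phi p) /\
  mass (fun p => t * phi p) = t ^+ 2 * mass phi /\
  energy (fun p => t * phi p) = t ^+ 2 * energy phi.
Proof.
move=> cphi.
have c0 : C1c Om (fun=> 0).
  by apply: (C1cI (C1fun_cst 0) compact0) => //; exact: sub0set.
have [s0 _ _] := C1c_sqint c0; have [sp p1 p2] := C1c_sqint cphi.
have [s01 s02] : partial1 (fun=> 0 : R) = (fun=> 0) /\ partial2 (fun=> 0 : R) = (fun=> 0).
  by split; [exact: (C1fun_partial1 (C1fun_cst 0))|exact: (C1fun_partial2 (C1fun_cst 0))].
have n0 : nsq mu2 Om (fun=> 0) = 0.
  rewrite /nsq (@eq_Rintegral _ _ _ _ _ (fun=> 0)).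
    by rewrite Rintegral_cst// mul0r.
  by move=> x _; rewrite expr0n.
have i0 f : ip mu2 Om (fun=> 0) f = 0.
  rewrite /ip (@eq_Rintegral _ _ _ _ _ (fun=> 0)).
    by rewrite Rintegral_cst// mul0r.
  by move=> x _; rewrite mul0r.
have E : (fun p => 0 + t * phi p) = (fun p => t * phi p) by apply/funext => p; rewrite add0r.
have [cc _ _] := C1cD t c0 cphi.
have m := massD t c0 cphi; have e := energyD t c0 cphi.
rewrite E in cc m e; split => //; rewrite m e /mass /energy s01 s02 n0 !i0.
by move: (nsq _ _ _) (nsq _ _ _) (nsq _ _ _) => a b c; split; ring.
Qed.

End CompactlySupported.

(** * The variational characterization of the lowest eigenvalue *)

Section SubsequenceFamily.

Lemma increasing_seq_comp (s t : nat -> nat) :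
  increasing_seq s -> increasing_seq t -> increasing_seq (s \o t).
Proof. by move=> hs ht m n; rewrite /= -ht; exact: hs. Qed.

Lemma increasing_seq_cvgny (s : nat -> nat) : increasing_seq s -> s @ \oo --> \oo.
Proof.
move=> hs.
have ge n : (n <= s n)%N.
  elim: n => // n IH; apply: leq_ltn_trans IH _.
  by have := hs n.+1 n; rewrite !leEnat ltnn ltnNge => ->.
move=> A [N _ NA]; exists N => // n /= Nn; apply: NA => /=.
exact: leq_trans Nn (ge n).
Qed.

(** The index type is finite, so subsequences can be extracted one index after the
    other. *)
Lemma bolzano_weierstrass_family (R : realType) (I : finType) (u : I -> nat -> R) :
  (forall i, exists M, forall n, `|u i n| <= M) ->
  exists2 s : nat -> nat, increasing_seq s & forall i, cvgn (u i \o s).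
Proof.
move=> bu.
have [s hs cs] : exists2 s : nat -> nat, increasing_seq s &
    forall i, i \in enum I -> cvgn (u i \o s).
  elim: (enum I) => [|i l [s hs cs]]; first by exists id => //; move=> m n.
  have [M HM] := bu i.
  have [|t ht ct] := @bolzano_weierstrass R (u i \o s).
    exists M; split; first exact: num_real.
    by move=> x Mx n _ /=; apply: le_trans (HM _) (ltW Mx).
  exists (s \o t); first exact: increasing_seq_comp.
  move=> j; rewrite inE => /predU1P[->//|jl].
  have := cs j jl; move=> /cvg_ex[l0 cl]; apply/cvg_ex; exists l0.
  exact: (cvg_comp _ _ (increasing_seq_cvgny ht) cl).
by exists s => // i; apply: cs; rewrite mem_enum.
Qed.

Lemma cvg_sum0 (R : realType) (I : Type) (r : seq I) (f : I -> nat -> R) :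
  (forall i, f i @ \oo --> 0) -> (fun n => \sum_(i <- r) f i n) @ \oo --> 0.
Proof.
move=> f0; elim: r => [|i r IH].
  by under eq_fun do rewrite big_nil; exact: cvg_cst.
rewrite (_ : (fun n => _) = (fun n => f i n + \sum_(j <- r) f j n)); last first.
  by apply/funext => n; rewrite big_cons.
by rewrite -[X in _ --> X](addr0 (0 : R)); apply: cvgD.
Qed.

End SubsequenceFamily.

Section LowestEigenvalue.
Variable R : realType.
Notation T2 := (measurableTypeR R * measurableTypeR R)%type.
Notation mu2 := (@plane_measure R).
Variable Om : set (R * R).
Hypothesis mOm : measurable (Om : set T2).
Implicit Types (phi psi : R * R -> R).
Local Notation mass := (mass Om).
Local Notation energy := (energy Om).

(** Functions supported in the domain extend by zero to the square [0, L]^2, which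
    a grid of (n+1)^2 cells covers exactly. *)
Lemma mass_le_grid (L : R) (n : nat) phi : 0 < L -> Om `<=` rect 0 L 0 L ->
  C1c Om phi -> let h := L / n.+1%:R in
  mass phi <= h ^- 2 * (\sum_(j < n.+1) \sum_(i < n.+1) (\int[mu2]_(p in cell 0 0 h i j) phi p) ^+ 2)
    + h ^+ 2 * energy phi.
Proof.
move=> L0 OL cphi /=; set h := L / _.
have h0 : 0 < h by rewrite divr_gt0.
have := poincare_grid 0 0 n.+1 n.+1 h0 (C1c_C1fun cphi).
have -> : 0 + n.+1%:R * h = L by rewrite add0r mulrC divfK.
have out := C1c_out cphi.
have -> : \int[mu2]_(p in rect 0 L 0 L) (phi p ^+ 2) = mass phi.
  apply/esym/(Rintegral_subset_support OL) => p /out[-> _ _]; exact: expr0n.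
have -> // : \int[mu2]_(p in rect 0 L 0 L) (partial1 phi p ^+ 2 + partial2 phi p ^+ 2)
    = energy phi.
have [_ s1 s2] := C1c_sqint mOm cphi.
have [_ e] := has_RintD mOm (has_Rint_int s1.2) (has_Rint_int s2.2).
transitivity (\int[mu2]_(p in Om) (partial1 phi p ^+ 2 + partial2 phi p ^+ 2)); last exact: e.
apply/esym/(Rintegral_subset_support OL) => p /out[_ -> ->].
by rewrite expr0n addr0.
Qed.

Lemma sqr_integral_rect_le phi a b c d : C1c Om phi ->
  (\int[mu2]_(p in rect a b c d) phi p) ^+ 2 <= fine (mu2 (rect a b c d)) * mass phi.
Proof.
move=> cphi; set Q := rect a b c d.
have [cc0 _ _] := C1c_cc cphi; have [cf _] := cc0.
have mQ : measurable (Q : set T2) by exact: measurable_rect.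
have s1 : sqint mu2 Q phi.
  split; first exact: continuous_measurable_plane_on.
  by apply: continuous_Rintegrable_rect => p; apply: cvgM; exact: cf.
have s2 : sqint mu2 Q (fun=> 1).
  split; first exact: measurable_cst.
  by apply: Rintegrable_cst => //; exact: rect_finite.
have := cauchy_schwarz mQ s1 s2.
have -> : ip mu2 Q phi (fun=> 1) = \int[mu2]_(p in Q) phi p.
  by apply: eq_Rintegral => p _; rewrite mulr1.
have -> : nsq mu2 Q (fun=> 1) = fine (mu2 Q).
  by rewrite /nsq Rintegral_cst// expr1n mul1r.
move=> /le_trans; apply; rewrite mulrC; apply: ler_wpM2l; first exact: fine_ge0.
have -> : mass phi = \int[mu2]_p (phi p ^+ 2).
  apply: Rintegral_subset_support => // p /(C1c_out cphi)[-> _ _].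
  exact: expr0n.
have I2 := integrable_cc (cc_sqr cc0).
rewrite /nsq /Rintegral fine_le//.
- apply: integrable_fin_num => //; exact: s1.2.
- exact: integrable_fin_num.
- apply: ge0_subset_integral => //.
  + by apply/measurable_EFinP; apply: measurable_funX; exact: continuous_measurable_plane.
  + by move=> p _; rewrite lee_fin sqr_ge0.
Qed.

Variables (L : R) (phi0 : R * R -> R).
Hypotheses (L0 : 0 < L) (OmL : Om `<=` rect 0 L 0 L).
Hypotheses (cphi0 : C1c Om phi0) (mphi0 : 0 < mass phi0).

Let rayleigh : set R := [set energy phi | phi in [set phi | C1c Om phi /\ mass phi = 1]].

Let normalize phi : C1c Om phi -> 0 < mass phi -> rayleigh (energy phi / mass phi).
Proof.
move=> cphi m0; have [c [m e]] := C1cZ mOm (Num.sqrt (mass phi))^-1 cphi.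
have sq : (Num.sqrt (mass phi))^-1 ^+ 2 = (mass phi)^-1.
  by rewrite exprVn sqr_sqrtr// ltW.
exists (fun p => (Num.sqrt (mass phi))^-1 * phi p).
  by split => //; rewrite m sq mulVf// gt_eqF.
by rewrite e sq mulrC.
Qed.

Let lam := inf rayleigh.

Let has_inf_rayleigh : has_inf rayleigh.
Proof.
split; first by exists (energy phi0 / mass phi0); exact: normalize.
by exists 0 => _ [phi _ <-]; exact: energy_ge0.
Qed.

Let lam_ge0 : 0 <= lam.
Proof.
apply: lb_le_inf; first by case: has_inf_rayleigh.
by move=> _ [phi _ <-]; exact: energy_ge0.
Qed.

Let lam_le phi : C1c Om phi -> lam * mass phi <= energy phi.
Proof.
move=> cphi; have := mass_ge0 Om phi; rewrite le_eqVlt => /predU1P[<-|m0].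
  by rewrite mulr0 energy_ge0.
rewrite -ler_pdivlMr//; apply: ge_inf; first by case: has_inf_rayleigh.
exact: normalize.
Qed.

Let quot phi := energy phi - lam * mass phi.

Let quot_ge0 phi : C1c Om phi -> 0 <= quot phi.
Proof. by move=> /lam_le; rewrite subr_ge0. Qed.

(** The parallelogram identity, [quot] being nonnegative on the sum. *)
Let quotB phi psi : C1c Om phi -> C1c Om psi ->
  C1c Om (fun p => phi p - psi p) /\
  quot (fun p => phi p - psi p) <= 2 * quot phi + 2 * quot psi.
Proof.
move=> c1 c2.
have E : (fun p => phi p - psi p) = (fun p => phi p + (-1) * psi p).
  by apply/funext => p; rewrite mulN1r.
have [cm _ _] := C1cD (-1) c1 c2; have [cp _ _] := C1cD 1 c1 c2.
split; first by rewrite E.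
have := quot_ge0 cp; rewrite E /quot.
rewrite (energyD mOm (-1) c1 c2) (energyD mOm 1 c1 c2) (massD mOm (-1) c1 c2)
  (massD mOm 1 c1 c2).
have aux (a b c a' b' c' : R) :
    0 <= a + 2 * 1 * b + 1 ^+ 2 * c - lam * (a' + 2 * 1 * b' + 1 ^+ 2 * c') ->
    a + 2 * -1 * b + (-1) ^+ 2 * c - lam * (a' + 2 * -1 * b' + (-1) ^+ 2 * c') <=
    2 * (a - lam * a') + 2 * (c - lam * c') by lra.
exact: aux.
Qed.

Let minimizing : exists phi : nat -> R * R -> R, forall n,
  [/\ C1c Om (phi n), mass (phi n) = 1 & quot (phi n) <= n.+1%:R^-1].
Proof.
have H n : exists phi, [/\ C1c Om phi, mass phi = 1 & quot phi <= n.+1%:R^-1].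
  have e0 : 0 < n.+1%:R^-1 :> R by rewrite invr_gt0.
  have [_ [phi [cphi m1] <-] lt] := inf_adherent e0 has_inf_rayleigh.
  exists phi; split => //; rewrite /quot m1 mulr1 lerBlDl; exact: ltW.
by have [phi Hphi] := choice H; exists phi.
Qed.

(** The step h of the grid is chosen with lam h^2 <= 1/2, so that in
    energy = quot + lam * mass the part of the mass that [mass_le_grid] bounds by
    the energy is absorbed.  What remains is the quotient defect and the
    differences of finitely many cell integrals, which converge along a
    subsequence. *)
Let minimizing_cauchy : exists (phi : nat -> R * R -> R) (r : nat -> R) (C : R),
  [/\ forall n, C1c Om (phi n), forall n, mass (phi n) = 1,
    (fun n => quot (phi n)) @ \oo --> 0, r @ \oo --> 0 & 0 <= C /\
    forall n m, mass (fun p => phi n p - phi m p) <= C * (r n + r m) /\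
     energy (fun p => phi n p - phi m p) <= C * (r n + r m)].
Proof.
have [phi Hphi] := minimizing.
have [n hn] : exists n : nat, lam * (L / n.+1%:R) ^+ 2 <= 1 / 2.
  have /cvgr0Pnorm_le/(_ (1 / 2)) : (fun n => lam * (L / n.+1%:R) ^+ 2) @ \oo --> 0.
    rewrite -[X in _ --> X](mulr0 lam); apply: cvgMl_tmp.
    rewrite -[X in _ --> X](_ : (L * 0) ^+ 2 = 0); last by rewrite mulr0 expr0n.
    by apply: cvgM; apply: cvgMl_tmp; exact: cvg_harmonic.
  rewrite divr_gt0// => /(_ isT)[n _ /(_ n (leqnn n))/= h].
  by exists n; apply: le_trans h; exact: ler_norm.
set h := L / n.+1%:R in hn.
have h0 : 0 < h by rewrite divr_gt0.
pose I := ('I_n.+1 * 'I_n.+1)%type.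
pose l (f : R * R -> R) (k : I) := \int[mu2]_(p in cell 0 0 h k.2 k.1) f p.
have [k|s hs cs] := @bolzano_weierstrass_family R I (fun k n => l (phi n) k).
  exists (1 + fine (mu2 (cell 0 0 h k.2 k.1))) => m.
  have [cm m1 _] := Hphi m.
  have := sqr_integral_rect_le (0 + k.2%:R * h) (0 + k.2%:R * h + h)
    (0 + k.1%:R * h) (0 + k.1%:R * h + h) cm.
  rewrite m1 mulr1 -[\int[_]_(_ in _) _]/(l (phi m) k) -[fine _]/(fine (mu2 (cell 0 0 h k.2 k.1))).
  move: (l _ _) (fine _) => x y.
  have := sqr_ge0 (`|x| - 1); rewrite -(real_normK (num_real x)).
  have := normr_ge0 x; nra.
have cs' k : exists c : R, (fun n => l (phi (s n)) k) @ \oo --> c.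
  by have /cvg_ex := cs k.
have [c hc] := choice cs'.
pose S m := \sum_(k : I) (l (phi (s m)) k - c k) ^+ 2.
have S0 : S @ \oo --> 0.
  apply: cvg_sum0 => k; rewrite -[X in _ --> X](mulr0 0).
  by apply: cvgM; apply/subr_cvg0; exact: hc.
have q0 : (fun n => quot (phi (s n))) @ \oo --> 0.
  apply: (@squeeze_cvgr _ _ _ _ (fun=> 0) (fun n => (s n).+1%:R^-1)).
  - by apply: nearW => m; have [cm _ qm] := Hphi (s m); rewrite quot_ge0.
  - exact: cvg_cst.
  - exact: (cvg_comp _ _ (increasing_seq_cvgny hs) (@cvg_harmonic R)).
(* K bounds the energy of a difference and C both its energy and its mass *)
pose K := 4 + 2 * lam * (h ^- 2 * 2).
pose C := K + h ^+ 2 * K + h ^- 2 * 2.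
exists (phi \o s), (fun n => quot (phi (s n)) + S n), C; split => //.
- by move=> m; have [] := Hphi (s m).
- by move=> m; have [] := Hphi (s m).
- by rewrite -[X in _ --> X](addr0 0); apply: cvgD.
have hm2 : 0 <= h ^- 2 by rewrite invr_ge0 exprn_ge0// ltW.
have h2 : 0 <= h ^+ 2 by rewrite exprn_ge0// ltW.
have w0 : 0 <= 2 * lam * (h ^- 2 * 2) by rewrite !mulr_ge0.
have K0 : 0 <= K by rewrite /K addr_ge0.
have hK : 0 <= h ^+ 2 * K by rewrite mulr_ge0.
have h22 : 0 <= h ^- 2 * 2 by rewrite mulr_ge0.
have C0 : 0 <= C by rewrite /C !addr_ge0.
split => // i j /=.
have [ci _ _] := Hphi (s i); have [cj _ _] := Hphi (s j).
have [cD qD] := quotB ci cj.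
have := mass_le_grid n L0 OmL cD; rewrite /= -/h.
have SD : \sum_(j0 < n.+1) \sum_(i0 < n.+1)
    (\int[mu2]_(p in cell 0 0 h i0 j0) (phi (s i) p - phi (s j) p)) ^+ 2
    <= 2 * (S i + S j).
  rewrite pair_big/= -big_split/= mulr_sumr; apply: ler_sum => k _.
  have [[ccf _] _ _] := C1c_cc ci; have [[ccg _] _ _] := C1c_cc cj.
  rewrite RintegralB; last 3 first.
  - exact: measurable_rect.
  - exact: continuous_Rintegrable_rect.
  - exact: continuous_Rintegrable_rect.
  rewrite -[X in X - _]/(l (phi (s i)) k) -[X in _ - X]/(l (phi (s j)) k).
  move: (l _ _) (l _ _) (c k) => x y z.
  have := sqr_ge0 ((x - z) + (y - z)); nra.
have := quot_ge0 ci; have := quot_ge0 cj.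
have Si : 0 <= S i by apply: sumr_ge0 => k _; exact: sqr_ge0.
have Sj : 0 <= S j by apply: sumr_ge0 => k _; exact: sqr_ge0.
have := energy_ge0 Om (fun p => phi (s i) p - phi (s j) p).
have := mass_ge0 Om (fun p => phi (s i) p - phi (s j) p).
move: qD SD; rewrite {1}/quot.
move: (\sum_(j0 < n.+1) _) (mass _) (energy _) (quot (phi (s i))) (quot (phi (s j))) Si Sj => X m e qi qj.
move: (S i) (S j) => si sj Si Sj qD SD m0 e0 qj0 qi0 mle.
have X1 : h ^- 2 * X <= h ^- 2 * (2 * (si + sj)) by apply: ler_wpM2l.
have m1 : lam * m <= lam * (h ^- 2 * (2 * (si + sj))) + 1 / 2 * e.
  apply: le_trans (ler_wpM2l lam_ge0 mle) _; rewrite mulrDr lerD//; first exact: ler_wpM2l.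
  by rewrite mulrA ler_wpM2r.
have e1 : e <= K * ((qi + si) + (qj + sj)).
  have : e <= 4 * (qi + qj) + 2 * lam * (h ^- 2 * 2) * (si + sj) by lra.
  move=> /le_trans; apply; rewrite /K; move: w0; move: (_ * (_ * 2)) => w w0; nra.
have r0 : 0 <= (qi + si) + (qj + sj) by rewrite !addr_ge0.
split; last first.
  apply: le_trans e1 _; rewrite ler_wpM2r// /C.
  by rewrite -addrA lerDl addr_ge0.
apply: le_trans (_ : (h ^+ 2 * K + h ^- 2 * 2) * ((qi + si) + (qj + sj)) <= _).
  rewrite mulrDl addrC; apply: le_trans mle _; apply: lerD.
    apply: le_trans X1 _; rewrite mulrA ler_wpM2l//; lra.
  by rewrite -mulrA ler_wpM2l.
by rewrite ler_wpM2r// /C -addrA lerDr.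
Qed.

Let minimizer : exists (phi : nat -> R * R -> R) (u g1 g2 : R * R -> R),
  [/\ forall n, C1c Om (phi n), forall n, mass (phi n) = 1,
    (fun n => quot (phi n)) @ \oo --> 0,
    [/\ measurable_fun (Om : set T2) (u : T2 -> R), measurable_fun (Om : set T2) (g1 : T2 -> R)
     & measurable_fun (Om : set T2) (g2 : T2 -> R)] &
    [/\ cvg_sq mu2 Om phi u, cvg_sq mu2 Om (fun n => partial1 (phi n)) g1 &
      cvg_sq mu2 Om (fun n => partial2 (phi n)) g2]].
Proof.
have [phi [r [C [cphi m1 q0 r0 [C0 H]]]]] := minimizing_cauchy.
have small e : 0 < e -> exists N, forall n m, (N <= n)%N -> (N <= m)%N ->
    C * (r n + r m) <= e.
  move=> e0.
  have e'0 : 0 < e / (2 * (C + 1)) by rewrite divr_gt0// mulr_gt0// ltr_wpDl.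
  have /cvgr0Pnorm_le/(_ _ e'0)[N _ HN] := r0.
  exists N => n m Nn Nm.
  have hn : r n <= e / (2 * (C + 1)) by apply: le_trans (ler_norm _) (HN n Nn).
  have hm : r m <= e / (2 * (C + 1)) by apply: le_trans (ler_norm _) (HN m Nm).
  apply: le_trans (ler_wpM2l C0 (lerD hn hm)) _.
  rewrite -mulr2n -mulr_natl (_ : C * _ = C * e / (C + 1)); last by field; lra.
  by rewrite ler_pdivrMr ?ltr_wpDl// mulrDr mulr1 mulrC lerDl ltW.
have pd n m : partial1 (fun p => phi n p - phi m p) = (fun p => partial1 (phi n) p - partial1 (phi m) p)
   /\ partial2 (fun p => phi n p - phi m p) = (fun p => partial2 (phi n) p - partial2 (phi m) p).
  have E : (fun p => phi n p - phi m p) = (fun p => phi n p + (-1) * phi m p).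
    by apply/funext => p; rewrite mulN1r.
  have [_ e1 e2] := C1cD (-1) (cphi n) (cphi m).
  by rewrite E e1 e2; split; apply/funext => p; rewrite mulN1r.
have [|e e0|u mu cu] := @sq_complete _ _ _ mu2 Om mOm phi.
- by move=> n; exact: (C1c_sqint0 mOm (cphi n)).
- have [N HN] := small e e0; exists N => n m Nn Nm.
  by apply: le_trans (HN n m Nn Nm); exact: (H n m).1.
have [|e e0|g1 mg1 cg1] := @sq_complete _ _ _ mu2 Om mOm (fun n => partial1 (phi n)).
- by move=> n; exact: (C1c_sqint1 mOm (cphi n)).
- have [N HN] := small e e0; exists N => n m Nn Nm.
  apply: le_trans (HN n m Nn Nm); apply: le_trans (H n m).2.
  rewrite -(pd n m).1; exact: (nsq_partial_le_energy _ _).1.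
have [|e e0|g2 mg2 cg2] := @sq_complete _ _ _ mu2 Om mOm (fun n => partial2 (phi n)).
- by move=> n; exact: (C1c_sqint2 mOm (cphi n)).
- have [N HN] := small e e0; exists N => n m Nn Nm.
  apply: le_trans (HN n m Nn Nm); apply: le_trans (H n m).2.
  rewrite -(pd n m).2; exact: (nsq_partial_le_energy _ _).2.
by exists phi, u, g1, g2.
Qed.

Let H10_limits (v h1 h2 : R * R -> R) : H10 Om v h1 h2 ->
  [/\ sqint mu2 Om v, sqint mu2 Om h1, sqint mu2 Om h2 &
    exists psi : nat -> R * R -> R,
     [/\ forall n, C1c Om (psi n), cvg_sq mu2 Om psi v,
      cvg_sq mu2 Om (fun n => partial1 (psi n)) h1 &
      cvg_sq mu2 Om (fun n => partial2 (psi n)) h2]].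
Proof.
move=> [mv mh1 mh2 [psi [cpsi cv c1 c2]]].
split; last by exists psi.
- exact: (@cvg_sq_sqint _ _ _ mu2 Om mOm psi v (fun n => C1c_sqint0 mOm (cpsi n)) mv cv).
- exact: (@cvg_sq_sqint _ _ _ mu2 Om mOm _ h1 (fun n => C1c_sqint1 mOm (cpsi n)) mh1 c1).
- exact: (@cvg_sq_sqint _ _ _ mu2 Om mOm _ h2 (fun n => C1c_sqint2 mOm (cpsi n)) mh2 c2).
Qed.

(** The bilinear form of energy - lam * mass, on functions given with their weak
    gradients. *)
Let form (u g1 g2 v h1 h2 : R * R -> R) :=
  ip mu2 Om g1 h1 + ip mu2 Om g2 h2 - lam * ip mu2 Om u v.

Let form_cvg (phi psi : nat -> R * R -> R) (u g1 g2 v h1 h2 : R * R -> R) :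
  H10 Om u g1 g2 -> H10 Om v h1 h2 ->
  (forall n, C1c Om (phi n)) -> (forall n, C1c Om (psi n)) ->
  cvg_sq mu2 Om phi u -> cvg_sq mu2 Om (fun n => partial1 (phi n)) g1 ->
  cvg_sq mu2 Om (fun n => partial2 (phi n)) g2 ->
  cvg_sq mu2 Om psi v -> cvg_sq mu2 Om (fun n => partial1 (psi n)) h1 ->
  cvg_sq mu2 Om (fun n => partial2 (psi n)) h2 ->
  (fun n => form (phi n) (partial1 (phi n)) (partial2 (phi n))
     (psi n) (partial1 (psi n)) (partial2 (psi n))) @ \oo --> form u g1 g2 v h1 h2.
Proof.
move=> [mu mg1 mg2 _] [mv mh1 mh2 _] cphi cpsi cu cg1 cg2 cv ch1 ch2.
apply: cvgB; first apply: cvgD.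
- exact: (@ip_cvg _ _ _ mu2 Om mOm (fun n => partial1 (phi n)) (fun n => partial1 (psi n)) g1 h1
    (fun n => C1c_sqint1 mOm (cphi n)) (fun n => C1c_sqint1 mOm (cpsi n)) mg1 mh1 cg1 ch1).
- exact: (@ip_cvg _ _ _ mu2 Om mOm (fun n => partial2 (phi n)) (fun n => partial2 (psi n)) g2 h2
    (fun n => C1c_sqint2 mOm (cphi n)) (fun n => C1c_sqint2 mOm (cpsi n)) mg2 mh2 cg2 ch2).
- apply: cvgMl_tmp; exact: (@ip_cvg _ _ _ mu2 Om mOm phi psi u v
    (fun n => C1c_sqint0 mOm (cphi n)) (fun n => C1c_sqint0 mOm (cpsi n)) mu mv cu cv).
Qed.

Let form_ge0 v h1 h2 : H10 Om v h1 h2 -> 0 <= form v h1 h2 v h1 h2.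
Proof.
move=> Hv; have [_ _ _ [psi [cpsi cv c1 c2]]] := H10_limits Hv.
have cf := form_cvg Hv Hv cpsi cpsi cv c1 c2 cv c1 c2.
rewrite -(cvg_lim (@Rhausdorff R) cf); apply: limr_ge; first by apply/cvg_ex; exists (form v h1 h2 v h1 h2).
by apply: nearW => n; exact: quot_ge0 (cpsi n).
Qed.

(** The limit u of a minimizing sequence annihilates the nonnegative form
    energy - lam * mass, hence by Cauchy-Schwarz its polar form vanishes on (u, v)
    for every v: this is the eigenvalue equation.  Any other eigenvalue is the
    Rayleigh quotient of its eigenfunction, hence at least lam. *)
Theorem lowest_dirichlet_eigenvalue_variational : exists lam : R,
  [/\ lowest_dirichlet_eigenvalue Om lam,
    forall phi, C1c Om phi -> lam * mass phi <= energy phi &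
    forall c, (forall phi, C1c Om phi -> c * mass phi <= energy phi) -> c <= lam].
Proof.
exists lam; split; last 2 first.
- exact: lam_le.
- move=> c Hc; apply: lb_le_inf; first by case: has_inf_rayleigh.
  by move=> _ [phi [cphi m1] <-]; have := Hc _ cphi; rewrite m1 mulr1.
have [phi [u [g1 [g2 [cphi m1 q0 [mu mg1 mg2] [cu cg1 cg2]]]]]] := minimizer.
have Hu : H10 Om u g1 g2 := And4 mu mg1 mg2 (ex_intro _ phi (And4 cphi cu cg1 cg2)).
have [su sg1 sg2 _] := H10_limits Hu.
have uu : ip mu2 Om u u = 1.
  have h : ip mu2 Om (phi n) (phi n) @[n --> \oo] --> ip mu2 Om u u.
    exact: (@ip_cvg _ _ _ mu2 Om mOm phi phi u u (fun n => C1c_sqint0 mOm (cphi n)) (fun n => C1c_sqint0 mOm (cphi n)) mu mu cu cu).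
  rewrite -(cvg_lim (@Rhausdorff R) h); apply: cvg_lim => //.
  rewrite (_ : (fun n => _) = fun=> 1); first exact: cvg_cst.
  by apply/funext => n; exact: m1.
have fu0 : form u g1 g2 u g1 g2 = 0.
  have h := form_cvg Hu Hu cphi cphi cu cg1 cg2 cu cg1 cg2.
  by rewrite -(cvg_lim (@Rhausdorff R) h); apply: cvg_lim.
have product_form (u' k1 k2 v h1 h2 : R * R -> R) : H10 Om u' k1 k2 -> H10 Om v h1 h2 ->
    \int[mu2]_(p in Om) (k1 p * h1 p + k2 p * h2 p) = ip mu2 Om k1 h1 + ip mu2 Om k2 h2.
  move=> /H10_limits[_ s1 s2 _] /H10_limits[_ t1 t2 _].
  by have [_ ->] := has_RintD mOm (has_Rint_int (sqintM mOm s1 t1)) (has_Rint_int (sqintM mOm s2 t2)).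
split.
  exists u, g1, g2; split => //.
    move=> /(nsq_eq0 mOm su) n0; have : ip mu2 Om u u = 0 by exact: n0.
    by rewrite uu => /eqP; rewrite oner_eq0.
  move=> v h1 h2 Hv; rewrite (product_form _ _ _ _ _ _ Hu Hv).
  have [sv sh1 sh2 [psi [cpsi cv c1 c2]]] := H10_limits Hv.
  have : form u g1 g2 v h1 h2 ^+ 2 <= 0 * form v h1 h2 v h1 h2.
    apply: quadratic_ge0; first exact: form_ge0.
    move=> t.
    (* passing to the limit extends the nonnegativity of the form to u + t v *)
    have Hc : (fun n => quot (fun p => phi n p + t * psi n p)) @ \oo -->
        0 + 2 * t * form u g1 g2 v h1 h2 + t ^+ 2 * form v h1 h2 v h1 h2.
      have E n : quot (fun p => phi n p + t * psi n p) =
        form (phi n) (partial1 (phi n)) (partial2 (phi n)) (phi n) (partial1 (phi n)) (partial2 (phi n))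
        + 2 * t * form (phi n) (partial1 (phi n)) (partial2 (phi n)) (psi n) (partial1 (psi n)) (partial2 (psi n))
        + t ^+ 2 * form (psi n) (partial1 (psi n)) (partial2 (psi n)) (psi n) (partial1 (psi n)) (partial2 (psi n)).
        rewrite /quot (energyD mOm t (cphi n) (cpsi n)) (massD mOm t (cphi n) (cpsi n)) /form.
        have aux (e1 e2 m b1 b2 b f1 f2 n' : R) :
            (e1 + e2) + 2 * t * (b1 + b2) + t ^+ 2 * (f1 + f2) - lam * (m + 2 * t * b + t ^+ 2 * n')
            = (e1 + e2 - lam * m) + 2 * t * (b1 + b2 - lam * b) + t ^+ 2 * (f1 + f2 - lam * n').
          by ring.
        exact: aux.
      rewrite (funext E) -fu0; apply: cvgD; first apply: cvgD.
      - exact: (form_cvg Hu Hu cphi cphi cu cg1 cg2 cu cg1 cg2).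
      - apply: cvgMl_tmp; exact: (form_cvg Hu Hv cphi cpsi cu cg1 cg2 cv c1 c2).
      - apply: cvgMl_tmp; exact: (form_cvg Hv Hv cpsi cpsi cv c1 c2 cv c1 c2).
    rewrite -(cvg_lim (@Rhausdorff R) Hc); apply: limr_ge.
      by apply/cvg_ex; eexists; exact: Hc.
    apply: nearW => n; apply: quot_ge0; by have [] := C1cD t (cphi n) (cpsi n).
  rewrite mul0r => f0; have {f0} : form u g1 g2 v h1 h2 == 0.
    by rewrite -sqrf_eq0 eq_le f0 sqr_ge0.
  by rewrite subr_eq0 => /eqP.
move=> mu' [u' [k1 [k2 [Hu' nae H]]]].
have [su' _ _ _] := H10_limits Hu'.
have m0 : 0 < nsq mu2 Om u'.
  rewrite lt_neqAle nsq_ge0 andbT eq_sym; apply/eqP => /(nsq_eq0 mOm su'); exact: nae.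
have := form_ge0 Hu'; rewrite subr_ge0 -(product_form _ _ _ _ _ _ Hu' Hu') (H _ _ _ Hu').
by rewrite -[\int[_]_(_ in _) (u' _ * _)]/(nsq mu2 Om u') ler_pM2r.
Qed.

End LowestEigenvalue.

(** * Bessel functions *)

Section BesselSeries.
Variable R : realType.
Implicit Types (l m : nat) (x s : R).

Definition clifford_coef l m : R := (-1) ^+ m / (m`! * (m + l)`!)%:R.

(** The Bessel-Clifford function, entire and related to the Bessel function by
    J_l(x) = (x/2)^l clifford l (x^2/4), see [besselE].  Unlike J_l it is smooth
    as a function of the squared distance to the origin. *)
Definition clifford l s : R := limn (pseries (clifford_coef l) s).

Lemma fact_neq0 n : (n`!)%:R != 0 :> R.
Proof. by rewrite pnatr_eq0 -lt0n fact_gt0. Qed.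

Lemma is_cvg_clifford l s : cvgn (pseries (clifford_coef l) s).
Proof.
apply: normed_cvg.
apply: (@series_le_cvg _ _ (fun m => exp_coeff `|s| m)).
- by move=> m /=.
- by move=> m; rewrite exp_coeff_ge0.
- move=> m /=; rewrite /exp_coeff/= normrM normrX mulrC ler_wpM2l ?exprn_ge0//.
  rewrite normrM normrX normrN normr1 expr1n mul1r normfV ger0_norm//.
  rewrite lef_pV2 ?posrE ?ltr0n ?muln_gt0 ?fact_gt0// ler_nat.
  by rewrite leq_pmulr ?fact_gt0.
- exact: is_cvg_series_exp_coeff.
Qed.

Lemma clifford_coefS l m :
  clifford_coef l m = (m + l.+1)%:R * clifford_coef l.+1 m.
Proof.
rewrite /clifford_coef addnS factS !natrM; field.
by rewrite !fact_neq0/= andbT -natrD nat1r pnatr_eq0.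
Qed.

Lemma pseries_diffs_clifford l :
  pseries_diffs (clifford_coef l) = (fun m => - clifford_coef l.+1 m).
Proof.
apply/funext => m; rewrite /pseries_diffs /clifford_coef addSnnS factS exprS !natrM; field.
by rewrite !fact_neq0/= nat1r pnatr_eq0.
Qed.

Lemma pseriesN (c : nat -> R) s : pseries (fun m => - c m) s = - pseries c s.
Proof.
apply/funext => n; rewrite /pseries [RHS]/GRing.opp/= /series/= -sumrN.
by apply: eq_bigr => i _; rewrite mulNr.
Qed.

Lemma lim_pseriesN_clifford l s :
  pseries (fun m => - clifford_coef l m) s @ \oo --> - clifford l s.
Proof. by rewrite pseriesN; apply: cvgN; exact: is_cvg_clifford. Qed.

Lemma is_derive_clifford l s : is_derive s 1 (clifford l) (- clifford l.+1 s).
Proof.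
have h := @pseries_snd_diffs R (clifford_coef l) (`|s| + 1) s.
have e1 := pseries_diffs_clifford l.
have e2 : pseries_diffs (pseries_diffs (clifford_coef l)) = clifford_coef l.+2.
  rewrite e1; apply/funext => m.
  have := congr1 (fun f => - f m) (pseries_diffs_clifford l.+1).
  by rewrite opprK => <-; rewrite /pseries_diffs mulrN.
rewrite e2 e1 in h.
have -> : - clifford l.+1 s = limn (pseries (fun m => - clifford_coef l.+1 m) s).
  by apply/esym/cvg_lim => //; exact: lim_pseriesN_clifford.
apply: h.
- exact: is_cvg_clifford.
- by apply/cvg_ex; eexists; exact: lim_pseriesN_clifford.
- exact: is_cvg_clifford.
- by rewrite [ltRHS]ger0_norm// ltrDl.
Qed.

Lemma continuous_clifford l : continuous (clifford l).
Proof.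
move=> s; apply: differentiable_continuous; apply/derivable1_diffP.
by have [] := is_derive_clifford l s.
Qed.

(** This is the Bessel differential equation, since
    the derivative of clifford l is - clifford l.+1. *)
Lemma clifford_recurrence l s :
  clifford l s = l.+1%:R * clifford l.+1 s - s * clifford l.+2 s.
Proof.
have C1 : pseries (clifford_coef l.+1) s @ \oo --> clifford l.+1 s.
  exact: is_cvg_clifford.
have d1 : cvgn (pseries (pseries_diffs (clifford_coef l.+1)) s).
  rewrite pseries_diffs_clifford; apply/cvg_ex; eexists; exact: lim_pseriesN_clifford.
have := pseries_diffs_equiv d1; rewrite /= pseries_diffs_clifford.
rewrite (cvg_lim _ (@lim_pseriesN_clifford l.+2 s))// => D.
apply: cvg_lim => //.
rewrite (_ : pseries (clifford_coef l) s = fun n =>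
  l.+1%:R * pseries (clifford_coef l.+1) s n +
  s * series (fun i => i%:R * clifford_coef l.+1 i * s ^+ i.-1) n); last first.
  apply/funext => n; rewrite /pseries/series/= !mulr_sumr -big_split/=.
  apply: eq_bigr => i _; rewrite (clifford_coefS l i) natrD.
  case: i => [|i]; first by rewrite /=; ring.
  by rewrite /= exprS; ring.
rewrite -mulrN; apply: cvgD; apply: cvgM => //; exact: cvg_cst.
Qed.

Lemma besselE l x : bessel l x = (x / 2) ^+ l * clifford l ((x / 2) ^+ 2).
Proof.
rewrite /bessel; have C : pseries (clifford_coef l) ((x / 2) ^+ 2) @ \oo --> clifford l ((x / 2) ^+ 2).
  exact: is_cvg_clifford.
apply: cvg_lim => //.
rewrite (_ : series _ = fun n => (x / 2) ^+ l * pseries (clifford_coef l) ((x / 2) ^+ 2) n).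
  apply: cvgM => //; exact: cvg_cst.
apply/funext => n; rewrite /pseries/series/= mulr_sumr.
apply: eq_bigr => m _; rewrite /bessel_coef /clifford_coef -exprM exprD -muln2 [(2 * m)%N]mulnC.
by ring.
Qed.

Lemma clifford0_gt0 l : 0 < clifford l 0.
Proof.
have -> : clifford l 0 = clifford_coef l 0.
  apply: cvg_lim => //; rewrite -(cvg_shiftS (pseries (clifford_coef l) 0)).
  rewrite (_ : (fun n => _) = fun=> clifford_coef l 0); first exact: cvg_cst.
  apply/funext => n; rewrite /pseries/series/= big_nat_recl//= expr0 mulr1 big1 ?addr0//.
  by move=> i _; rewrite exprS mul0r mulr0.
by rewrite /clifford_coef expr0 divr_gt0// ltr0n muln_gt0 !fact_gt0.
Qed.

Lemma clifford_gt0 l s : 0 <= s -> (forall t, 0 < t <= s -> clifford l t != 0) ->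
  0 < clifford l s.
Proof.
move=> s0 nz; rewrite ltNge; apply/negP => gs.
have g0 := clifford0_gt0 l.
have [||c] := @IVT R (clifford l) 0 s 0 s0.
- exact/continuous_subspaceT/continuous_clifford.
- by rewrite ge_min le_max gs orbT (ltW g0).
rewrite in_itv/= => /andP[c0 cs] gc.
have := nz c; rewrite cs andbT gc eqxx lt_neqAle c0 andbT; case: eqVneq => [c00|_]; last first.
  by move=> /(_ isT).
by move=> _; move: g0; rewrite {2}c00 gc ltxx.
Qed.

(** The infimum defining the first zero is attained and positive: the set of zeros
    of clifford l is closed and stays away from 0. *)
Lemma bessel_zero1_spec l : (exists2 s, 0 < s & clifford l s = 0) ->
  [/\ 0 < bessel_zero R l 1, clifford l ((bessel_zero R l 1 / 2) ^+ 2) = 0 &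
    forall s, 0 <= s -> s < (bessel_zero R l 1 / 2) ^+ 2 -> 0 < clifford l s].
Proof.
move=> [s0 s00 gs0]; set j := bessel_zero R l 1.
pose S := [set x : R | 0 < x /\ bessel l x = 0].
have jE : j = inf S by [].
have SP x : 0 < x -> S x <-> clifford l ((x / 2) ^+ 2) = 0.
  move=> x0; rewrite /S/= besselE; split=> [[_ /eqP]|->]; last by rewrite mulr0.
  by rewrite mulf_eq0 expf_eq0 gt_eqF ?divr_gt0// andbF => /eqP.
have root s : 0 < s -> clifford l s = 0 -> S (2 * Num.sqrt s).
  move=> s1 gs; apply/SP; first by rewrite mulr_gt0// sqrtr_gt0.
  by rewrite mulrC mulKf// sqr_sqrtr// ltW.
have hS : has_inf S.
  split; first by exists (2 * Num.sqrt s0); exact: root.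
  by exists 0 => x [/ltW].
have j0 : 0 < j.
  have [d /= d0 hd] : exists2 d : R, 0 < d & forall t, `|t| < d -> 0 < clifford l t.
    have /nbhs_ballP[d d0 hd] : \forall t \near (0 : R), 0 < clifford l t.
      have c0 := @continuous_clifford l 0.
      exact: (cvgr_gt _ c0 _ (clifford0_gt0 l)).
    by exists d => // t td; apply: hd; rewrite /ball/= sub0r normrN.
  have dd : 0 < 2 * Num.sqrt d by rewrite mulr_gt0// sqrtr_gt0.
  apply: lt_le_trans dd _; rewrite jE; apply: lb_le_inf; first by case: hS.
  move=> x Sx; have x0 : 0 < x by case: Sx.
  rewrite leNgt; apply/negP => xd; have := (SP x x0).1 Sx.
  have := hd ((x / 2) ^+ 2); rewrite ger0_norm ?sqr_ge0// => H gx.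
  move: H; rewrite gx ltxx => /(_ _)/notF; apply.
  have xs : x / 2 < Num.sqrt d by rewrite ltr_pdivrMr// mulrC.
  have : (x / 2) ^+ 2 < Num.sqrt d ^+ 2.
    by rewrite ltr_pXn2r// ?nnegrE ?sqrtr_ge0// divr_ge0// ltW.
  by rewrite (sqr_sqrtr (ltW d0)).
have gj : clifford l ((j / 2) ^+ 2) = 0.
  apply/eqP/negPn/negP => gj.
  have cg : {for j, continuous (fun x => clifford l ((x / 2) ^+ 2))}.
    apply: (@continuous_comp _ _ _ (fun x : R => (x / 2) ^+ 2) (clifford l)).
      by apply: cvgM; apply: cvgMr_tmp; exact: cvg_id.
    exact: continuous_clifford.
  have /nbhs_ballP[d /= d0 hd] : \forall x \near j, clifford l ((x / 2) ^+ 2) != 0.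
    exact: (cvgr_neq0 _ cg gj).
  have [x Sx xj] := inf_adherent d0 hS.
  have jx : j <= x by rewrite jE; apply: ge_inf => //; case: hS.
  have /eqP : clifford l ((x / 2) ^+ 2) = 0 by apply/SP => //; case: Sx.
  apply/negP; apply: hd; rewrite /ball/= distrC ger0_norm ?subr_ge0//.
  by rewrite ltrBlDl; rewrite jE.
split => // s s1 sj; apply: clifford_gt0 => // t /andP[t0 ts].
apply/eqP => /(root t t0) St.
have : j <= 2 * Num.sqrt t by rewrite jE; apply: ge_inf => //; case: hS.
rewrite leNgt => /negP; apply.
rewrite mulrC -ltr_pdivlMr// -(ltr_pXn2r (ltn0Sn 1)) ?nnegrE ?sqrtr_ge0 ?divr_ge0 ?(ltW j0)//.
by rewrite sqr_sqrtr ?(ltW t0)// (le_lt_trans ts).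
Qed.

End BesselSeries.

(** * The Picone identity *)

Section Picone.
Variable R : realType.
Notation T2 := (measurableTypeR R * measurableTypeR R)%type.
Notation mu2 := (@plane_measure R).
Variables (w w1 w2 w11 w12 w21 w22 : R * R -> R) (L : R).
Hypotheses (Hw : C1fun w w1 w2) (Hw1 : C1fun w1 w11 w12) (Hw2 : C1fun w2 w21 w22).
Hypothesis laplace_w : forall p, w11 p + w22 p = - (L * w p).

(** |grad(w psi)|^2 = div(psi^2 w grad w) + L w^2 psi^2 + w^2 |grad psi|^2, and the
    divergence integrates to 0. *)
Lemma picone_identity psi psi1 psi2 M : C1fun psi psi1 psi2 ->
  (forall p : R * R, M < `|p| -> psi p = 0) ->
  \int[mu2]_p ((w p * psi1 p + psi p * w1 p) ^+ 2 + (w p * psi2 p + psi p * w2 p) ^+ 2) =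
  L * \int[mu2]_p ((w p * psi p) ^+ 2)
    + \int[mu2]_p (w p ^+ 2 * (psi1 p ^+ 2 + psi2 p ^+ 2)).
Proof.
move=> Hpsi psiM.
have [ccp cc1 cc2] := C1fun_cc Hpsi psiM.
have cw := C1fun_continuous Hw; have [_ cw1 cw2] := Hw.
have [_ cw11 _] := Hw1; have [_ _ cw22] := Hw2.
have cM (f g : R * R -> R) : continuous f -> continuous g -> continuous (fun p => f p * g p).
  by move=> cf cg p; apply: cvgM; [exact: cf|exact: cg].
have D1 := C1funM (C1funM Hpsi Hpsi) (C1funM Hw Hw1).
have D2 := C1funM (C1funM Hpsi Hpsi) (C1funM Hw Hw2).
have z p : M < `|p| -> psi p * psi p * (w p * w1 p) = 0 by move=> /psiM->; rewrite !mul0r.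
have z2 p : M < `|p| -> psi p * psi p * (w p * w2 p) = 0 by move=> /psiM->; rewrite !mul0r.
have I1 := divergence1 D1 z; have I2 := divergence2 D2 z2.
have [_ cD1 _] := C1fun_cc D1 z; have [_ _ cD2] := C1fun_cc D2 z2.
have [mT] : measurable (setT : set T2) /\ True by [].
have H1 : has_Rint mu2 setT _ 0 := conj (integrable_cc cD1) I1.
have H2 : has_Rint mu2 setT _ 0 := conj (integrable_cc cD2) I2.
have i1 : cc (fun p => (w p * psi p) ^+ 2) by apply: cc_sqr; exact: ccMr.
have i2 : cc (fun p => w p ^+ 2 * (psi1 p ^+ 2 + psi2 p ^+ 2)).
  apply: ccMr; first exact: cM.
  by apply: ccD; exact: cc_sqr.
have H3 := has_RintZ mT L (has_Rint_int (integrable_cc i1)).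
have H4 := has_Rint_int (integrable_cc i2).
have [_ E] := has_RintD mT (has_RintD mT (has_RintD mT H1 H2) H3) H4.
move: E; rewrite !add0r => <- _.
apply: eq_Rintegral => p _.
have := laplace_w p.
move: (w p) (w1 p) (w2 p) (w11 p) (w22 p) (psi p) (psi1 p) (psi2 p) => a a1 a2 a11 a22 f f1 f2 E.
have -> : a11 = - (L * a) - a22 by lra.
ring.
Qed.

Lemma mass_setT (Om : set (R * R)) phi : C1c Om phi ->
  mass Om phi = \int[mu2]_p (phi p ^+ 2).
Proof.
move=> cphi.
apply: (@Rintegral_subset_support _ Om setT (fun p => phi p ^+ 2)) => // p /(C1c_out cphi)[-> _ _].
exact: expr0n.
Qed.

Lemma energy_setT (Om : set (R * R)) phi : measurable (Om : set T2) -> C1c Om phi ->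
  energy Om phi = \int[mu2]_p (partial1 phi p ^+ 2 + partial2 phi p ^+ 2).
Proof.
move=> mOm cphi.
have s1 := C1c_sqint1 mOm cphi; have s2 := C1c_sqint2 mOm cphi.
have [_ e] := has_RintD mOm (has_Rint_int s1.2) (has_Rint_int s2.2).
transitivity (\int[mu2]_(p in Om) (partial1 phi p ^+ 2 + partial2 phi p ^+ 2)).
  exact/esym/e.
apply: (@Rintegral_subset_support _ Om setT (fun p => partial1 phi p ^+ 2 + partial2 phi p ^+ 2)) => //.
by move=> p /(C1c_out cphi)[_ -> ->]; rewrite expr0n addr0.
Qed.

Lemma energy_mul (Om : set (R * R)) psi psi1 psi2 M : measurable (Om : set T2) ->
  C1fun psi psi1 psi2 -> (forall p : R * R, M < `|p| -> psi p = 0) ->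
  C1c Om (fun p => w p * psi p) ->
  energy Om (fun p => w p * psi p) = L * mass Om (fun p => w p * psi p)
    + \int[mu2]_p (w p ^+ 2 * (psi1 p ^+ 2 + psi2 p ^+ 2)).
Proof.
move=> mOm Hpsi psiM cphi.
have H := C1funM Hw Hpsi.
rewrite (energy_setT mOm cphi) (mass_setT cphi) (C1fun_partial1 H) (C1fun_partial2 H).
exact: (picone_identity Hpsi psiM).
Qed.

Section Division.
Variables (Om : set (R * R)) (phi : R * R -> R).
Hypotheses (cphi : C1c Om phi) (w_gt0 : forall p, Om p -> 0 < w p).

Let psi p := phi p / w p.
Let psi1 p := (partial1 phi p - psi p * w1 p) / w p.
Let psi2 p := (partial2 phi p - psi p * w2 p) / w p.

Let support := closure [set p | phi p != 0].

Let out p : ~ support p -> \forall q \near p, [/\ phi q = 0, partial1 phi q = 0 & partial2 phi q = 0].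
Proof.
move=> nS.
have cphi' : C1c support phi by case: cphi => d c k _; split.
have o : open (~` support) by apply: closed_openC; exact: closed_closure.
have := open_nbhs_nbhs (conj o nS); apply: filterS => q /= nq.
exact: C1c_out nq.
Qed.

Let near_zero (f g : R * R -> R) p : (\forall q \near p, f q = g q) ->
  {for p, continuous f} -> {for p, continuous g}.
Proof.
move=> fg cf; have e : f p = g p by exact: nbhs_singleton fg.
have cf' : f x @[x --> p] --> g p by rewrite -e; exact: cf.
suff : g x @[x --> p] --> g p by [].
by apply: cvg_trans cf'; exact: near_eq_cvg.
Qed.

(** The quotient phi / w is of class C^1 in the whole plane although w may vanish:
    w is positive on the domain, and phi vanishes in the neighborhood of every
    point outside its support. *)
Lemma C1fun_div : C1fun psi psi1 psi2.
Proof.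
have Hphi := C1c_C1fun cphi; have [hphi cp1 cp2] := Hphi.
have cp := C1fun_continuous Hphi; have cw := C1fun_continuous Hw.
have [hw cw1 cw2] := Hw.
have SO : support `<=` Om by case: cphi.
have cV p : Om p -> {for p, continuous (fun q => (w q)^-1)}.
  by move=> Op; apply: cvgV; [rewrite gt_eqF ?w_gt0|exact: cw].
have zero p : ~ support p -> \forall q \near p, [/\ psi q = 0, psi1 q = 0 & psi2 q = 0].
  move=> /out; apply: filterS => q [h h1 h2].
  by rewrite /psi1 /psi2 /psi h h1 h2 !mul0r !subr0 mul0r.
split => p; have [/SO Op|nS] := pselect (support p).
- have hV : has_grad (fun q => (w q)^-1) p (- (w p) ^- 2 * w1 p) (- (w p) ^- 2 * w2 p).
    apply: (has_grad_comp (hw p)).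
    have wn0 : w p != 0 by rewrite gt_eqF ?w_gt0.
    have dV : derivable (GRing.inv : R -> R) (w p) 1.
      by apply/derivable1_diffP; exact: differentiable_Rinv.
    split => //; rewrite deriveE; last exact/derivable1_diffP.
    by rewrite diff_Rinv//= /GRing.scale/= mulr1.
  have wn0 : w p != 0 by rewrite gt_eqF ?w_gt0.
  apply: (has_grad_eq (has_gradM (hphi p) hV)); rewrite /psi1 /psi2 /psi; by field.
- have [h h1 h2] := nbhs_singleton (zero p nS); rewrite h1 h2.
  apply: (has_grad_near _ (has_grad_cst 0 p)).
  by apply: filterS (zero p nS) => q [-> _ _].
- apply: cvgM; last exact: cV.
  apply: cvgB; first exact: cp1.
  by apply: cvgM; [apply: cvgM; [exact: cp|exact: cV]|exact: cw1].
- apply: (@near_zero (fun=> 0)); last exact: cvg_cst.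
  by apply: filterS (zero p nS) => q [_ -> _].
- apply: cvgM; last exact: cV.
  apply: cvgB; first exact: cp2.
  by apply: cvgM; [apply: cvgM; [exact: cp|exact: cV]|exact: cw2].
- apply: (@near_zero (fun=> 0)); last exact: cvg_cst.
  by apply: filterS (zero p nS) => q [_ _ ->].
Qed.

Hypothesis mOm : measurable (Om : set T2).

Lemma energy_ge_of_positive_solution : L * mass Om phi <= energy Om phi.
Proof.
have [M HM] := C1c_support cphi.
have psiM p : M < `|p| -> psi p = 0 by move=> /HM h; rewrite /psi h mul0r.
have := picone_identity C1fun_div psiM.
have outO p := @C1c_out _ _ _ p cphi.
have E1 : \int[mu2]_p ((w p * psi p) ^+ 2) = mass Om phi.
  rewrite (mass_setT cphi); apply: eq_Rintegral => p _; have [Op|nO] := pselect (Om p).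
    by rewrite /psi mulrC divfK// gt_eqF ?w_gt0.
  by have [e _ _] := outO p nO; rewrite /psi e mul0r mulr0.
have E2 : \int[mu2]_p ((w p * psi1 p + psi p * w1 p) ^+ 2 + (w p * psi2 p + psi p * w2 p) ^+ 2)
    = energy Om phi.
  rewrite (energy_setT mOm cphi).
  apply: eq_Rintegral => p _; have [Op|nO] := pselect (Om p).
    have wn0 : w p != 0 by rewrite gt_eqF ?w_gt0.
    by rewrite /psi1 /psi2 /psi; field.
  have [e0 e1 e2] := outO p nO; rewrite /psi1 /psi2 /psi e0 e1 e2 !mul0r subr0 mul0r mulr0.
  by rewrite addr0 expr0n.
rewrite E1 E2 => ->; rewrite lerDl; apply: Rintegral_ge0 => p _.
by rewrite mulr_ge0 ?addr_ge0 ?sqr_ge0.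
Qed.

End Division.
End Picone.

(** * The cracked quarter disc in Cartesian coordinates *)

Section Geometry.
Variable R : realType.
Notation T2 := (measurableTypeR R * measurableTypeR R)%type.
Implicit Types (p : R * R) (r : R).

Definition sqdist p : R := p.1 ^+ 2 + p.2 ^+ 2.

Lemma sqdist_polar r (t : R) : sqdist (polar (r, t)) = r ^+ 2.
Proof. by rewrite /sqdist /polar/= !exprMn -mulrDr cos2Dsin2 mulr1. Qed.

Lemma polar_coordinates p : 0 < p.1 -> 0 < p.2 ->
  exists2 t, 0 < t < pi / 2 & p = polar (Num.sqrt (sqdist p), t).
Proof.
case: p => x y /= x0 y0; set r := Num.sqrt _.
have s0 : 0 < sqdist (x, y) by rewrite addr_gt0// exprn_gt0.
have r0 : 0 < r by rewrite sqrtr_gt0.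
have r2 : r ^+ 2 = x ^+ 2 + y ^+ 2 by rewrite sqr_sqrtr// ltW.
have xr : x < r.
  by rewrite -(ltr_pXn2r (ltn0Sn 1)) ?nnegrE ?ltW// r2 ltrDl exprn_gt0.
have c0 : 0 < x / r by rewrite divr_gt0.
have c1 : x / r < 1 by rewrite ltr_pdivrMr// mul1r.
have c01 : -1 <= x / r <= 1 by rewrite (ltW c1) andbT (le_trans _ (ltW c0))// lerN10.
have tE : cos (acos (x / r)) = x / r by apply: acosK; rewrite in_itv.
exists (acos (x / r)).
  rewrite acos_gt0 ?c1 ?andbT; last by case/andP: c01.
  rewrite -acos0 -ltr_cos ?in_itv/=.
  - by rewrite tE acosK// in_itv/= lerN10 ler01.
  - by rewrite acos_ge0 ?acos_lepi ?lerN10 ?ler01.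
  - by rewrite acos_ge0 ?acos_lepi ?lerN10 ?ler01.
rewrite /polar/= tE sin_acos// mulrC divfK ?gt_eqF//; congr pair.
rewrite -[LHS](gtr0_norm y0) -sqrtr_sqr -[r in r * _](gtr0_norm r0) -sqrtr_sqr -sqrtrM ?sqr_ge0//.
congr Num.sqrt; transitivity (r ^+ 2 - x ^+ 2); first by rewrite r2; ring.
by field; rewrite gt_eqF.
Qed.

(** On the circle of radius R1 in the open quadrant, theta >= eps means
    x <= R1 cos eps. *)
Lemma cracked_quarter_discE (R1 R2 eps : R) : 0 < R1 -> R1 < R2 -> 0 < eps < pi / 2 ->
  cracked_quarter_disc R1 R2 eps = [set p | [/\ 0 < p.1, 0 < p.2, sqdist p < R2 ^+ 2 &
    ~ (sqdist p = R1 ^+ 2 /\ p.1 <= R1 * cos eps)]].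
Proof.
move=> R10 R12 /andP[e0 e1]; have R20 : 0 < R2 by rewrite (lt_trans R10).
have pi2 : pi / 2 < pi :> R by rewrite ltr_pdivrMr// ltr_pMr ?pi_gt0// ltr1n.
apply/seteqP; split => [p [[[r t] [/= /andP[r0 rR] /andP[t0 t1]] <-] nc]|p [x0 y0 pR nc]].
  split.
  - by rewrite /polar/= mulr_gt0// cos_gt0_pihalf// t1 (lt_trans _ t0)// oppr_lt0 divr_gt0// pi_gt0.
  - by rewrite /polar/= mulr_gt0// sin_gt0_pihalf// t0 t1.
  - by rewrite sqdist_polar ltr_pXn2r// nnegrE ltW.
  - rewrite sqdist_polar => -[rR1 xc]; apply: nc; exists (r, t) => //=.
    have rE : r = R1.
      by apply/eqP; rewrite -(eqrXn2 (ltn0Sn 1)) ?ltW// rR1.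
    split => //; rewrite t1 andbT leNgt; apply/negP => te.
    move: xc; rewrite /polar/= rE ler_pM2l// leNgt => /negP; apply.
    by rewrite ltr_cos// in_itv/= ltW ?(ltW (lt_trans _ pi2))// (lt_trans te).
have [t /andP[t0 t1] pE] := polar_coordinates x0 y0.
split.
  exists (Num.sqrt (sqdist p), t) => //=; split; last by rewrite t0.
  rewrite sqrtr_gt0 addr_gt0 ?exprn_gt0//= -(gtr0_norm R20) -sqrtr_sqr ltr_sqrt//.
  by rewrite exprn_gt0.
move=> [[r s] [/= -> /andP[es s1]] rp]; apply: nc; split.
  by rewrite -rp sqdist_polar.
rewrite -rp /polar/= ler_pM2l// leNgt ltr_cos -?leNgt// in_itv/=.
  by rewrite (le_trans (ltW e0) es) (ltW (lt_trans s1 pi2)).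
by rewrite (ltW e0) (ltW (lt_trans e1 pi2)).
Qed.

(** cos eps = sin (pi/2 - eps), and the sine is below the identity. *)
Lemma cos_le_complement (eps : R) : 0 < eps < pi / 2 -> cos eps <= pi / 2 - eps.
Proof.
move=> /andP[e0 e1]; have d0 : 0 < pi / 2 - eps by rewrite subr_gt0.
have -> : cos eps = sin (pi / 2 - eps).
  by rewrite -cosBpihalf addrAC subrr add0r cosN.
have [c _ E] := @MVT R sin cos 0 (pi / 2 - eps) d0 (fun x _ => is_derive_sin x)
  (continuous_subspaceT (@continuous_sin R)).
rewrite sin0 !subr0 in E; rewrite E -[leRHS]mul1r ler_pM2r//; exact: cos_le1.
Qed.

Lemma continuous_sqdist : continuous sqdist.
Proof.
move=> p; apply: cvgD; apply: cvgM;
  by [exact: fst_continuous|exact: snd_continuous].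
Qed.

End Geometry.

(** * The ground state of the quarter disc *)

Section GroundState.
Variables (R : realType) (k : R).
Implicit Types (p : R * R).

Lemma C1fun_sqdist :
  C1fun (@sqdist R) (fun p => 2 * p.1) (fun p => 2 * p.2).
Proof.
apply: (C1fun_eq (C1funD (C1funM (@C1fun_fst R) (@C1fun_fst R))
  (C1funM (@C1fun_snd R) (@C1fun_snd R)))) => p /=; ring.
Qed.

Lemma C1fun_clifford l :
  C1fun (fun p => clifford l (k * sqdist p))
    (fun p => - clifford l.+1 (k * sqdist p) * (k * (2 * p.1)))
    (fun p => - clifford l.+1 (k * sqdist p) * (k * (2 * p.2))).
Proof.
apply: (C1fun_comp (h := clifford l) (h' := fun s => - clifford l.+1 s)
  (C1funZ k C1fun_sqdist)) => t; first exact: is_derive_clifford.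
by apply: cvgN; exact: continuous_clifford.
Qed.

(** Up to a constant factor, this is J_2(2 sqrt(k) r) sin(2 theta). *)
Definition ground_state p : R := p.1 * p.2 * clifford 2 (k * sqdist p).

Definition ground_state1 p : R :=
  p.2 * clifford 2 (k * sqdist p) - 2 * k * (p.1 * p.1 * p.2 * clifford 3 (k * sqdist p)).

Definition ground_state2 p : R :=
  p.1 * clifford 2 (k * sqdist p) - 2 * k * (p.1 * p.2 * p.2 * clifford 3 (k * sqdist p)).

Lemma C1fun_ground_state : C1fun ground_state ground_state1 ground_state2.
Proof.
apply: (C1fun_eq (C1funM (C1funM (@C1fun_fst R) (@C1fun_snd R)) (C1fun_clifford 2))) => p /=;
  rewrite /ground_state1 /ground_state2; ring.
Qed.

(** The mixed second derivatives stay existential: only the Laplacian matters, and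
    it is computed with [clifford_recurrence]. *)
Lemma ground_state_laplace : exists w11 w12 w21 w22 : R * R -> R,
  [/\ C1fun ground_state1 w11 w12, C1fun ground_state2 w21 w22 &
    forall p, w11 p + w22 p = - (4 * k * ground_state p)].
Proof.
have X := @C1fun_fst R; have Y := @C1fun_snd R.
have G2 := C1fun_clifford 2; have G3 := C1fun_clifford 3.
have D1 := C1funD (C1funM Y G2) (C1funZ (- (2 * k)) (C1funM (C1funM (C1funM X X) Y) G3)).
have D2 := C1funD (C1funM X G2) (C1funZ (- (2 * k)) (C1funM (C1funM (C1funM X Y) Y) G3)).
have E1 : ground_state1 = fun p => p.2 * clifford 2 (k * sqdist p) +
    - (2 * k) * (p.1 * p.1 * p.2 * clifford 3 (k * sqdist p)).
  by apply/funext => p; rewrite /ground_state1 mulNr.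
have E2 : ground_state2 = fun p => p.1 * clifford 2 (k * sqdist p) +
    - (2 * k) * (p.1 * p.2 * p.2 * clifford 3 (k * sqdist p)).
  by apply/funext => p; rewrite /ground_state2 mulNr.
do 4 eexists; split; [rewrite E1; exact: D1|rewrite E2; exact: D2|].
move=> p /=; rewrite /ground_state (clifford_recurrence 2) /sqdist.
move: (clifford _ _) (clifford _ _) => a b; ring.
Qed.

Lemma energy_ge_positive_ground_state (Om : set (R * R)) phi :
  measurable (Om : set (measurableTypeR R * measurableTypeR R)) ->
  (forall p, Om p -> [/\ 0 < p.1, 0 < p.2 & 0 < clifford 2 (k * sqdist p)]) ->
  C1c Om phi -> 4 * k * mass Om phi <= energy Om phi.
Proof.
move=> mOm pos cphi.
have [w11 [w12 [w21 [w22 [H1 H2 lap]]]]] := ground_state_laplace.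
apply: (energy_ge_of_positive_solution C1fun_ground_state H1 H2 lap cphi) => //.
by move=> p /pos[x0 y0 g0]; rewrite /ground_state !mulr_gt0.
Qed.

End GroundState.

(** * Cutoff functions *)

Section Cutoff.
Variable R : realType.
Implicit Types s t : R.

Definition sqpos s : R := Num.max 0 s ^+ 2.

(** This criterion makes the square of the positive part differentiable by case
    analysis alone, also at 0. *)
Lemma is_derive_of_quadratic_bound (f : R -> R) t a :
  (forall h, `|f (h + t) - f t - a * h| <= h ^+ 2) -> is_derive t 1 f a.
Proof.
move=> H.
have lin : linear (fun h : R => a * h).
  by move=> c x y /=; rewrite /GRing.scale/=; ring.
pose L := GRing.isLinear.Build _ _ _ _ _ lin.
pose l : {linear R -> R} := HB.pack (fun h : R => a * h) L.
have cl : continuous l by move=> h; apply: cvgM; [exact: cvg_cst|exact: cvg_id].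
have D : is_diff t f l.
  apply/(is_diff_linearP f t cl) => e e0.
  apply/nbhs_ballP; exists e => //= h; rewrite /ball/= sub0r normrN => he.
  apply: le_trans (H h) _; rewrite -(real_normK (num_real h)) expr2.
  by rewrite ler_wpM2r// ltW.
case: D => d E.
have df : derivable f t 1 by exact/derivable1_diffP.
by split => //; rewrite deriveE// E /= mulr1.
Qed.

Lemma is_derive_sqpos t : is_derive t 1 sqpos (2 * Num.max 0 t).
Proof.
apply: is_derive_of_quadratic_bound => h; rewrite /sqpos /Num.max ler_norml.
case: ltP => [a|a]; case: ltP => [b|b]; apply/andP; split; nra.
Qed.

Lemma continuous_max0 : continuous (fun s : R => Num.max 0 s).
Proof. by move=> s; apply: continuous_max; [exact: cvg_cst|exact: cvg_id]. Qed.

Lemma max0_ge0 s : 0 <= Num.max 0 s. Proof. by rewrite le_max lexx. Qed.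

(** A C^1 step from 0, reached for s <= 1 - 1/sqrt 2 and hence for s <= 1/4, to 1,
    reached for s >= 1. *)
Definition cutoff s : R := sqpos (1 - 2 * sqpos (1 - s)).
Definition cutoff' s : R := 8 * Num.max 0 (1 - 2 * sqpos (1 - s)) * Num.max 0 (1 - s).

Lemma continuous_sqpos : continuous sqpos.
Proof. by move=> s; apply: cvgM; exact: continuous_max0. Qed.

Lemma continuous_cutoff' : continuous cutoff'.
Proof.
have c1 : continuous (fun s : R => 1 - s).
  by move=> s; apply: cvgB; [exact: cvg_cst|exact: cvg_id].
have c2 : continuous (fun s : R => 1 - 2 * sqpos (1 - s)).
  move=> s; apply: cvgB; first exact: cvg_cst.
  apply: cvgM; first exact: cvg_cst.
  by apply: (continuous_comp (c1 s)); exact: continuous_sqpos.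
move=> s; apply: cvgM; first apply: cvgM; first exact: cvg_cst.
  by apply: (continuous_comp (c2 s)); exact: continuous_max0.
by apply: (continuous_comp (c1 s)); exact: continuous_max0.
Qed.

Lemma is_derive_cutoff s : is_derive s 1 cutoff (cutoff' s).
Proof.
have d1 : is_derive s 1 (fun s : R => 1 - s) (-1).
  by apply: (is_derive_eq (is_deriveB (is_derive_cst (1 : R) s 1) (is_derive_id s 1))); rewrite sub0r.
have d2 := @is_derive1_comp R sqpos (fun s => 1 - s) s _ _ (is_derive_sqpos (1 - s)) d1.
have d3 : is_derive s 1 (fun s => 1 - 2 * sqpos (1 - s))
    (4 * Num.max 0 (1 - s)).
  have d := is_deriveB (is_derive_cst (1 : R) s 1) (is_deriveZ 2 d2).
  by apply: (is_derive_eq d); rewrite /GRing.scale/=; ring.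
have d4 := @is_derive1_comp R sqpos _ s _ _ (is_derive_sqpos (1 - 2 * sqpos (1 - s))) d3.
by apply: (is_derive_eq d4); rewrite /cutoff'; ring.
Qed.

Lemma cutoff_ge0 s : 0 <= cutoff s. Proof. exact: sqr_ge0. Qed.

Lemma cutoff_le1 s : cutoff s <= 1.
Proof.
rewrite /cutoff /sqpos; have := sqr_ge0 (Num.max 0 (1 - s)).
move: (_ ^+ 2) => a a0; rewrite expr_le1 ?max0_ge0// ge_max ler01/=; lra.
Qed.

Lemma cutoff_inner s : s <= 1 / 4 -> 1 - 2 * sqpos (1 - s) <= 0.
Proof. by move=> h; rewrite /sqpos max_r; [nra|lra]. Qed.

Lemma cutoff_eq0 s : s <= 1 / 4 -> cutoff s = 0.
Proof. by move=> /cutoff_inner h; rewrite /cutoff /sqpos max_l// expr0n. Qed.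

Lemma cutoff'_eq0 s : s <= 1 / 4 -> cutoff' s = 0.
Proof. by move=> /cutoff_inner h; rewrite /cutoff' [Num.max 0 (1 - 2 * _)]max_l// mulr0 mul0r. Qed.

Lemma cutoff_eq1 s : 1 <= s -> cutoff s = 1.
Proof.
move=> h; have e : sqpos (1 - s) = 0 by rewrite /sqpos max_l ?expr0n// subr_le0.
by rewrite /cutoff e mulr0 subr0 /sqpos max_r ?expr1n// ler01.
Qed.

Lemma cutoff'_eq0_ge1 s : 1 <= s -> cutoff' s = 0.
Proof. by move=> h; rewrite /cutoff' [Num.max 0 (1 - s)]max_l ?mulr0// subr_le0. Qed.

Lemma cutoff'_bound s : `|cutoff' s| <= 8.
Proof.
rewrite /cutoff' ger0_norm ?mulr_ge0 ?max0_ge0//.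
rewrite /sqpos; have := max0_ge0 (1 - s); move: (Num.max 0 (1 - s)) => a a0.
by rewrite /Num.max; case: ltP => b; nra.
Qed.

End Cutoff.

Section Bump.
Variable R : realType.
Implicit Types (p : R * R).

(** For small t this approximates the indicator of the quarter disc of squared
    radius r2; the three factors cut off near the two radii and near the arc. *)
Definition bump (r2 t : R) p : R :=
  cutoff (p.1 / t) * cutoff (p.2 / t) * cutoff ((r2 - sqdist p) / t).

Definition bump1 (r2 t : R) p : R :=
  (cutoff' (p.1 / t) / t) * (cutoff (p.2 / t) * cutoff ((r2 - sqdist p) / t))
  - cutoff (p.1 / t) * cutoff (p.2 / t) * (cutoff' ((r2 - sqdist p) / t) * (2 * p.1 / t)).

Definition bump2 (r2 t : R) p : R :=
  (cutoff' (p.2 / t) / t) * (cutoff (p.1 / t) * cutoff ((r2 - sqdist p) / t))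
  - cutoff (p.1 / t) * cutoff (p.2 / t) * (cutoff' ((r2 - sqdist p) / t) * (2 * p.2 / t)).

Lemma C1fun_cutoff (f f1 f2 : R * R -> R) : C1fun f f1 f2 ->
  C1fun (fun p => cutoff (f p)) (fun p => cutoff' (f p) * f1 p) (fun p => cutoff' (f p) * f2 p).
Proof.
move=> Hf; apply: (C1fun_comp (h := @cutoff R) (h' := @cutoff' R) Hf).
  by move=> s; exact: is_derive_cutoff.
exact: continuous_cutoff'.
Qed.

Lemma C1fun_bump r2 t : C1fun (bump r2 t) (bump1 r2 t) (bump2 r2 t).
Proof.
have X := C1fun_cutoff (C1funZ t^-1 (@C1fun_fst R)).
have Y := C1fun_cutoff (C1funZ t^-1 (@C1fun_snd R)).
have Z := C1fun_cutoff (C1funZ t^-1 (C1funD (C1fun_cst r2) (C1funZ (-1) (@C1fun_sqdist R)))).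
have E : bump r2 t = fun p => cutoff (t^-1 * p.1) * cutoff (t^-1 * p.2)
    * cutoff (t^-1 * (r2 + -1 * sqdist p)).
  by apply/funext => p; rewrite /bump mulN1r ![t^-1 * _]mulrC.
rewrite E; apply: (C1fun_eq (C1funM (C1funM X Y) Z)) => p /=;
  rewrite /bump1 /bump2 mulN1r ![t^-1 * p.1]mulrC ![t^-1 * p.2]mulrC ![t^-1 * (r2 - _)]mulrC;
  move: (cutoff _) (cutoff _) (cutoff _) (cutoff' _) (cutoff' _) (cutoff' _) => a b c a' b' c'; ring.
Qed.

Lemma bump_ge0 r2 t p : 0 <= bump r2 t p.
Proof.
by apply: mulr_ge0; [apply: mulr_ge0|]; exact: cutoff_ge0.
Qed.

Lemma bump_le1 r2 t p : bump r2 t p <= 1.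
Proof.
have c0 := @cutoff_ge0 R; have c1 := @cutoff_le1 R.
by apply: mulr_ile1 => //; [exact: mulr_ge0|exact: mulr_ile1].
Qed.

Lemma bump_eq1 (r2 t : R) p : 0 < t -> t <= p.1 -> t <= p.2 -> sqdist p <= r2 - t ->
  bump r2 t p = 1.
Proof.
move=> t0 h1 h2 h3; rewrite /bump !cutoff_eq1 ?mulr1// ler_pdivlMr// mul1r//.
by rewrite lerBrDr -lerBrDl.
Qed.

Definition inner_quarter_disc (r2 t : R) : set (R * R) :=
  [set p | [/\ t / 4 <= p.1, t / 4 <= p.2 & sqdist p <= r2 - t / 4]].

Lemma closed_superlevel (f : R * R -> R) c : continuous f -> closed [set p | c <= f p].
Proof.
move=> cf; apply: (@closed_comp _ _ f [set x | c <= x]); last exact: closed_ge.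
by move=> p _; exact: cf.
Qed.

Lemma closed_sublevel (f : R * R -> R) c : continuous f -> closed [set p | f p <= c].
Proof.
move=> cf; apply: (@closed_comp _ _ f [set x | x <= c]); last exact: closed_le.
by move=> p _; exact: cf.
Qed.

Lemma sqdist_cube p (r : R) : 0 <= r -> sqdist p <= r ^+ 2 -> cube r p.
Proof.
move=> r0 h; split; rewrite /= in_itv/= -ler_norml -(ler_pXn2r (ltn0Sn 1)) ?nnegrE//
  real_normK ?num_real//; apply: le_trans h; rewrite /sqdist ?lerDl ?lerDr sqr_ge0//.
Qed.

Lemma compact_inner_quarter_disc (r2 t : R) : 0 < t -> compact (inner_quarter_disc r2 t).
Proof.
move=> t0.
have c : closed (inner_quarter_disc r2 t).
  have -> : inner_quarter_disc r2 t = [set p | t / 4 <= p.1] `&` [set p | t / 4 <= p.2]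
      `&` [set p | sqdist p <= r2 - t / 4].
    by apply/seteqP; split => p [] // [? ?] ?; split.
  apply: closedI; first apply: closedI.
  - by apply: closed_superlevel; exact: fst_continuous.
  - by apply: closed_superlevel; exact: snd_continuous.
  - by apply: closed_sublevel; exact: continuous_sqdist.
apply: (subclosed_compact c (@compact_cube R (`|r2| + 1))) => p [_ _ h].
apply: sqdist_cube; first by rewrite addr_ge0.
apply: le_trans h _; have := normr_ge0 r2; have := ler_norm r2; nra.
Qed.

Lemma bump_out (r2 t : R) p : 0 < t -> ~ inner_quarter_disc r2 t p ->
  [/\ bump r2 t p = 0, bump1 r2 t p = 0 & bump2 r2 t p = 0].
Proof.
move=> t0 np.
have tt s : s < t / 4 -> s / t <= 1 / 4.
  by move=> /ltW h; rewrite ler_pdivrMr// mulrC mulrA mulr1.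
rewrite /bump /bump1 /bump2.
have [x1|x1] := ltP p.1 (t / 4).
  by rewrite (cutoff_eq0 (tt _ x1)) (cutoff'_eq0 (tt _ x1)) !(mul0r, mulr0, subrr).
have [x2|x2] := ltP p.2 (t / 4).
  by rewrite (cutoff_eq0 (tt _ x2)) (cutoff'_eq0 (tt _ x2)) !(mul0r, mulr0, subrr).
have x3 : r2 - sqdist p < t / 4.
  by rewrite ltNge; apply/negP => h; apply: np; split => //; lra.
by rewrite (cutoff_eq0 (tt _ x3)) (cutoff'_eq0 (tt _ x3)) !(mul0r, mulr0, subrr).
Qed.

Lemma bump_C1c (Om : set (R * R)) (r2 t : R) : 0 < t -> inner_quarter_disc r2 t `<=` Om ->
  C1c Om (bump r2 t).
Proof.
move=> t0 sub.
have cK := @compact_inner_quarter_disc r2 t t0.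
have Hb := @C1fun_bump r2 t.
apply: (C1cI Hb cK sub).
by move=> p /(bump_out t0)[].
Qed.

End Bump.

(** * Test functions and upper bounds *)

Section InnerSquare.
Variable R : realType.
Notation T2 := (measurableTypeR R * measurableTypeR R)%type.
Notation mu2 := (@plane_measure R).

Lemma sqdist_ge0 (p : R * R) : 0 <= sqdist p.
Proof. by rewrite addr_ge0 ?sqr_ge0. Qed.

Lemma Rintegral_ge_subset (A : set (R * R)) (f : R * R -> R) : measurable (A : set T2) ->
  cc f -> (forall p, 0 <= f p) -> \int[mu2]_(p in A) f p <= \int[mu2]_p f p.
Proof.
move=> mA cf f0; have I := integrable_cc cf.
rewrite /Rintegral fine_le//.
- apply: integrable_fin_num => //; by apply: integrableS I.
- exact: integrable_fin_num.
- apply: ge0_subset_integral => //.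
  + by apply/measurable_EFinP; apply: continuous_measurable_plane; case: cf.
  + by move=> p _; rewrite lee_fin.
Qed.

Lemma bump_cc (r2 t : R) : 0 < t -> cc (bump r2 t).
Proof.
by move=> t0; have [] := C1c_cc (bump_C1c t0 (@subsetT _ (inner_quarter_disc r2 t))).
Qed.

Variable r : R.
Hypothesis r_gt0 : 0 < r.

Let r4_gt0 : 0 < r / 4. Proof. by rewrite divr_gt0. Qed.

(** A fixed square in the quarter disc of radius r, away from its boundary and in
    particular from the point (0, r): it bounds masses from below. *)
Definition inner_square : set (R * R) := rect (r / 4) (r / 4 + r / 4) (r / 4) (r / 4 + r / 4).

Lemma inner_squareP p : inner_square p ->
  [/\ r / 4 <= p.1, r / 4 <= p.2, p.2 <= r / 2 & sqdist p <= r ^+ 2 / 2].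
Proof.
case: p => x y; rewrite /inner_square /rect /sqdist /= !in_itv/= => -[/andP[h1 h2] /andP[h3 h4]].
have := r_gt0; split => //; nra.
Qed.

Lemma measurable_inner_square : measurable (inner_square : set T2).
Proof. exact: measurable_rect. Qed.

Lemma Rintegral_inner_square_gt0 (f : R * R -> R) (m : R) : continuous f -> 0 < m ->
  (forall p, inner_square p -> m <= f p) -> 0 < \int[mu2]_(p in inner_square) f p.
Proof.
move=> cf m0 H; have mQ := measurable_inner_square.
have If : Rintegrable mu2 inner_square f by exact: continuous_Rintegrable_rect.
have fQ : (mu2 inner_square < +oo)%E by exact: rect_finite.
apply: lt_le_trans (has_Rint_le mQ (has_Rint_cst mQ m fQ) (has_Rint_int If) H).
by rewrite square_measure// mulr_gt0 ?exprn_gt0.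
Qed.

Lemma bump_mass_gt0 : exists2 t, 0 < t & 0 < \int[mu2]_p (bump (r ^+ 2) t p ^+ 2).
Proof.
pose t := Num.min (r / 4) (r ^+ 2 / 2).
have t0 : 0 < t by rewrite lt_min r4_gt0 divr_gt0 ?exprn_gt0.
have [tc tR] : t <= r / 4 /\ t <= r ^+ 2 / 2 by apply/andP; rewrite -le_min.
exists t => //; have ccb := bump_cc (r ^+ 2) t0.
have cc2 : cc (fun p => bump (r ^+ 2) t p ^+ 2) by exact: cc_sqr.
apply: lt_le_trans (Rintegral_ge_subset measurable_inner_square cc2 (fun p => sqr_ge0 _)).
apply: (@Rintegral_inner_square_gt0 _ 1) => //; first by case: cc2.
move=> p /inner_squareP[h1 h2 _ h3].
by rewrite bump_eq1 ?expr1n ?(le_trans tc)//; lra.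
Qed.

End InnerSquare.

Section TestFunctions.
Variable R : realType.
Notation T2 := (measurableTypeR R * measurableTypeR R)%type.
Notation mu2 := (@plane_measure R).
Variables (R1 R2 k : R).
Hypotheses (R1_gt0 : 0 < R1) (R12 : R1 < R2) (k_gt0 : 0 < k).
Hypothesis clifford_gt0_disc : forall s, 0 <= s -> s < k * R2 ^+ 2 -> 0 < clifford 2 s.
Hypothesis clifford_root : clifford 2 (k * R2 ^+ 2) = 0.
Local Notation w := (ground_state k).

Let R2_gt0 : 0 < R2. Proof. exact: lt_trans R1_gt0 R12. Qed.

Definition quarter_disc : set (R * R) :=
  [set p | [/\ 0 < p.1, 0 < p.2 & sqdist p < R2 ^+ 2]].

Lemma clifford_bounded l (S : R) : 0 <= S ->
  exists2 B, 0 < B & forall s, 0 <= s <= S -> `|clifford l s| <= B.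
Proof.
move=> S0.
have cn : continuous (fun s : R => `|clifford l s|).
  by move=> s; apply: cvg_norm; exact: continuous_clifford.
have [c _ Hc] := EVT_max S0 (continuous_subspaceT cn).
exists (`|clifford l c| + 1) => [|s s0S]; first by rewrite ltr_wpDl.
by apply: le_trans (Hc s _) _; rewrite ?in_itv// lerDl.
Qed.

Lemma quarter_disc_le p : quarter_disc p -> [/\ p.1 <= R2, p.2 <= R2 & 0 <= k * sqdist p <= k * R2 ^+ 2].
Proof.
move=> [x0 y0 pR]; have /sqdist_cube : sqdist p <= R2 ^+ 2 by exact: ltW.
move=> /(_ (ltW R2_gt0))[] /=; rewrite !in_itv/= => /andP[_ h1] /andP[_ h2]; split => //.
by rewrite mulr_ge0 ?sqdist_ge0 ?(ltW k_gt0)// ler_pM2l// ltW.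
Qed.

(** The ground state is at most a constant times the distance to each part of the
    boundary; on the arc this follows from the mean value theorem, clifford 2
    vanishing at k R2^2. *)
Lemma ground_state_bound : exists2 A, 0 < A & forall p, quarter_disc p ->
  [/\ 0 <= w p, w p <= A * p.1, w p <= A * p.2 & w p <= A * (R2 ^+ 2 - sqdist p)].
Proof.
have S0 : 0 <= k * R2 ^+ 2 by rewrite mulr_ge0 ?sqr_ge0 ?ltW.
have [B2 B20 HB2] := clifford_bounded 2 S0.
have [B3 B30 HB3] := clifford_bounded 3 S0.
exists (R2 * B2 + R2 ^+ 2 * (B3 * k)).
  by rewrite addr_gt0 ?mulr_gt0 ?exprn_gt0.
move=> p Dp; have [xR yR /andP[s0 sS]] := quarter_disc_le Dp; have [x0 y0 pR] := Dp.
have sS' : k * sqdist p < k * R2 ^+ 2 by rewrite ltr_pM2l.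
have g0 := clifford_gt0_disc s0 sS'.
have gB : clifford 2 (k * sqdist p) <= B2.
  by apply: le_trans (ler_norm _) (HB2 _ _); rewrite s0 sS.
have gL : clifford 2 (k * sqdist p) <= B3 * k * (R2 ^+ 2 - sqdist p).
  have [c] := @MVT R (clifford 2) (fun s => - clifford 3 s) _ _ sS' (fun s _ => is_derive_clifford 2 s)
    (continuous_subspaceT (@continuous_clifford R 2)).
  rewrite in_itv/= => /andP[c1 c2]; rewrite clifford_root sub0r => E.
  have h : clifford 3 c <= B3.
    by apply: le_trans (ler_norm _) (HB3 _ _); rewrite (le_trans s0 (ltW c1)) ltW.
  have -> : clifford 2 (k * sqdist p) = clifford 3 c * (k * (R2 ^+ 2 - sqdist p)).
    by apply: oppr_inj; rewrite E; ring.
  by rewrite -mulrA ler_wpM2r// mulr_ge0 ?(ltW k_gt0)// subr_ge0 ltW.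
have q0 : 0 <= R2 ^+ 2 - sqdist p by rewrite subr_ge0 ltW.
rewrite /w; move: (clifford _ _) g0 gB gL => g g0 gB gL.
move: (R2 ^+ 2 - sqdist p) q0 gL => q q0 gL.
have K0 : 0 <= R2 ^+ 2 * (B3 * k) by rewrite !mulr_ge0 ?sqr_ge0// ltW.
have RB0 : 0 <= R2 * B2 by rewrite mulr_ge0 ?ltW.
split.
- by rewrite !mulr_ge0 ?ltW.
- rewrite mulrAC -mulrA mulrC ler_wpM2r ?(ltW x0)//.
  apply: le_trans (_ : R2 * B2 <= _); last by rewrite lerDl.
  by rewrite mulrC ler_pM ?(ltW y0) ?(ltW g0).
- rewrite mulrAC ler_wpM2r ?(ltW y0)//.
  apply: le_trans (_ : R2 * B2 <= _); last by rewrite lerDl.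
  by rewrite ler_pM ?(ltW x0) ?(ltW g0).
- apply: le_trans (_ : R2 ^+ 2 * (B3 * k) * q <= _); last by rewrite ler_wpM2r// lerDr.
  rewrite (_ : R2 ^+ 2 * (B3 * k) * q = R2 * R2 * (B3 * k * q)); last by ring.
  have xy : p.1 * p.2 <= R2 * R2 by apply: ler_pM => //; exact: ltW.
  by apply: ler_pM => //; [rewrite mulr_ge0 ?ltW|exact: ltW].
Qed.

Lemma inner_quarter_disc_sub (r2 t : R) : 0 < t -> r2 <= R2 ^+ 2 ->
  inner_quarter_disc r2 t `<=` quarter_disc.
Proof.
move=> t0 rR p [h1 h2 h3]; have t4 : 0 < t / 4 by rewrite divr_gt0.
by split; lra.
Qed.

Lemma measurable_quarter_disc : measurable (quarter_disc : set T2).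
Proof.
apply: open_measurable_plane.
have -> : quarter_disc = [set p | 0 < p.1] `&` [set p | 0 < p.2]
    `&` [set p : R * R | sqdist p < R2 ^+ 2].
  by apply/seteqP; split => p [] // [? ?] ?; split.
apply: openI; first apply: openI.
- by apply: (@open_comp _ _ fst [set x : R | 0 < x]); [move=> ? _; exact: fst_continuous|exact: open_gt].
- by apply: (@open_comp _ _ snd [set x : R | 0 < x]); [move=> ? _; exact: snd_continuous|exact: open_gt].
- by apply: (@open_comp _ _ (@sqdist R) [set x : R | x < R2 ^+ 2]);
    [move=> ? _; exact: continuous_sqdist|exact: open_lt].
Qed.

Lemma quarter_disc_cube : quarter_disc `<=` cube R2.
Proof.
by move=> p [_ _ pR]; apply: sqdist_cube; rewrite ltW.
Qed.

Definition bump_energy t p : R :=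
  w p ^+ 2 * (bump1 (R2 ^+ 2) t p ^+ 2 + bump2 (R2 ^+ 2) t p ^+ 2).

(** The gradient of the cutoff is O(1/t), and it vanishes unless the distance to
    some part of the boundary is at most t, where the ground state is O(t). *)
Let bump_energy_bound : exists2 B, 0 < B & forall t p, 0 < t -> quarter_disc p ->
  bump_energy t p <= B.
Proof.
have [A A0 HA] := ground_state_bound.
exists (2 * (8 * A + 16 * A * R2) ^+ 2).
  by rewrite mulr_gt0// exprn_gt0// addr_gt0// !mulr_gt0.
move=> t p t0 Dp; have [w0 wx wy wq] := HA p Dp; have [x0 y0 pR] := Dp.
have [xR yR _] := quarter_disc_le Dp.
have C0 : 0 <= 8 * A + 16 * A * R2 by rewrite addr_ge0// !mulr_ge0// ltW.
have side v : 0 < v -> w p <= A * v -> w p * `|cutoff' (v / t) / t| <= 8 * A.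
  move=> v0 wv; have [tv|vt] := leP t v.
    rewrite cutoff'_eq0_ge1 ?mul0r ?normr0 ?mulr0; last by rewrite ler_pdivlMr// mul1r.
    by rewrite mulr_ge0// ltW.
  rewrite normrM [`|t^-1|]gtr0_norm ?invr_gt0// mulrA ler_pdivrMr//.
  have h1 : w p <= A * t by apply: le_trans wv _; rewrite ler_pM2l// ltW.
  have := cutoff'_bound (v / t); have := normr_ge0 (cutoff' (v / t)).
  rewrite (_ : 8 * A * t = A * t * 8); last by ring.
  by move=> c0 c8; apply: ler_pM.
have arc v : 0 < v -> v <= R2 ->
    w p * `|cutoff' ((R2 ^+ 2 - sqdist p) / t) * (2 * v / t)| <= 16 * A * R2.
  move=> v0 vR; have q0 : 0 < R2 ^+ 2 - sqdist p by rewrite subr_gt0.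
  have := side _ q0 wq; move: (cutoff' _) => c0; rewrite !normrM [`|t^-1|]gtr0_norm ?invr_gt0//.
  rewrite [`|2|]gtr0_norm// [`|v|]gtr0_norm//; move: (`|c0|) => c h.
  have -> : w p * (c * (2 * v / t)) = 2 * v * (w p * (c / t)) by ring.
  have -> : 16 * A * R2 = 2 * R2 * (8 * A) by ring.
  have := mulr_ge0 (ltW v0) (ltW A0); have := mulr_ge0 (ltW R2_gt0) (ltW A0).
  move=> h1 h2; apply: le_trans (_ : 2 * v * (8 * A) <= _).
    by rewrite ler_wpM2l// mulr_ge0// ltW.
  by rewrite ler_wpM2r ?ler_wpM2l// mulr_ge0// ltW.
have mul01 (a b : R) : 0 <= a <= 1 -> 0 <= b <= 1 -> 0 <= a * b <= 1.
  by move=> /andP[? ?] /andP[? ?]; rewrite mulr_ge0//= mulr_ile1.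
have c01 s : 0 <= @cutoff R s <= 1 by rewrite cutoff_ge0 cutoff_le1.
have part (a b c e : R) : 0 <= b <= 1 -> 0 <= c <= 1 -> w p * `|a| <= 8 * A -> w p * `|e| <= 16 * A * R2 ->
    w p ^+ 2 * (a * b - c * e) ^+ 2 <= (8 * A + 16 * A * R2) ^+ 2.
  move=> /andP[b0 b1] /andP[c0 c1] ha he; rewrite -exprMn -real_normK ?num_real//.
  rewrite ler_pXn2r ?nnegrE//; rewrite normrM (ger0_norm w0).
  apply: le_trans (_ : w p * (`|a| + `|e|) <= _); last by rewrite mulrDr lerD.
  rewrite ler_wpM2l//; apply: le_trans (ler_normB _ _) _; rewrite !normrM (ger0_norm b0) (ger0_norm c0).
  by rewrite lerD// ?ler_piMr ?ler_piMl.
rewrite /bump_energy mulrDr [2 * _]mulr_natl mulr2n lerD//.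
  by apply: part; [exact: mul01|exact: mul01|exact: side|exact: arc].
by apply: part; [exact: mul01|exact: mul01|exact: side|exact: arc].
Qed.

(** Dominated convergence: at every point of the open quarter disc the gradient of
    the cutoff vanishes as soon as t is small. *)
Lemma ground_state_bump_energy_cvg0 :
  (fun n => \int[mu2]_p bump_energy n.+1%:R^-1 p) @ \oo --> 0.
Proof.
have [B B0 HB] := bump_energy_bound.
pose t n : R := n.+1%:R^-1.
have t0 n : 0 < t n by rewrite invr_gt0.
have mD := measurable_quarter_disc.
have cw := C1fun_continuous (C1fun_ground_state k).
have cbe n : continuous (bump_energy (t n)).
  have [_ c1 c2] := C1fun_bump (R2 ^+ 2) (t n).
  move=> p; apply: cvgM; first by apply: cvgM; exact: cw.
  by apply: cvgD; apply: cvgM; [exact: c1|exact: c1|exact: c2|exact: c2].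
have red n : \int[mu2]_p bump_energy (t n) p = \int[mu2]_(p in quarter_disc) bump_energy (t n) p.
  apply/esym/(@Rintegral_subset_support _ quarter_disc setT) => // p nD.
  have [|_ e1 e2] := @bump_out _ (R2 ^+ 2) (t n) p (t0 n).
    by apply: contra_not nD; apply: inner_quarter_disc_sub.
  by rewrite /bump_energy e1 e2 expr0n addr0 mulr0.
have fD : (mu2 quarter_disc < +oo)%E by apply: bounded_set_finite mD quarter_disc_cube.
have := @dominated_convergence _ _ _ mu2 quarter_disc mD
  (fun n p => (bump_energy (t n) p)%:E) (fun=> 0%E) (fun=> B%:E).
case.
- move=> n; apply/measurable_EFinP; exact: continuous_measurable_plane_on.
- exact: measurable_cst.
- apply: aeW => p Dp; have [x0 y0 pR] := Dp.
  have q0 : 0 < R2 ^+ 2 - sqdist p by rewrite subr_gt0.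
  pose m := Num.min p.1 (Num.min p.2 (R2 ^+ 2 - sqdist p)).
  have m0 : 0 < m by rewrite !lt_min x0 y0 q0.
  apply: cvg_near_cst.
  have /cvgr0Pnorm_le/(_ m m0) := @cvg_harmonic R.
  apply: filterS => n /=; rewrite ger0_norm ?(ltW (t0 n))// => tm.
  move: tm; rewrite !le_min => /andP[h1 /andP[h2 h3]].
  have z v : t n <= v -> cutoff' (v / t n) = 0.
    by move=> h; apply: cutoff'_eq0_ge1; rewrite ler_pdivlMr// mul1r.
  rewrite /bump_energy /bump1 /bump2 (z _ h1) (z _ h2) (z _ h3) !(mul0r, mulr0, subrr, expr0n)/=.
  by rewrite addr0 mulr0.
- exact: Rintegrable_cst.
- apply: aeW => p n Dp /=; rewrite lee_fin ger0_norm ?HB//.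
  by rewrite mulr_ge0 ?addr_ge0 ?sqr_ge0.
move=> _ _ /=; rewrite integral0 => /fine_cvgP[_]; apply: cvg_trans.
rewrite [X in _ `=>` X @ _](_ : _ = (fun n => \int[mu2]_p bump_energy n.+1%:R^-1 p))//.
by apply/funext => n; rewrite red.
Qed.

Definition crack_sqdist (p : R * R) : R := p.1 ^+ 2 + (p.2 - R1) ^+ 2.

(** It vanishes within distance 2 d of the point (0, R1), where the crack meets the
    boundary, and equals 1 beyond distance 4 d. *)
Definition hole (d : R) (p : R * R) : R := cutoff (crack_sqdist p / (16 * d ^+ 2)).
Definition hole1 (d : R) (p : R * R) : R :=
  cutoff' (crack_sqdist p / (16 * d ^+ 2)) * (2 * p.1 / (16 * d ^+ 2)).
Definition hole2 (d : R) (p : R * R) : R :=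
  cutoff' (crack_sqdist p / (16 * d ^+ 2)) * (2 * (p.2 - R1) / (16 * d ^+ 2)).

Lemma continuous_crack_sqdist : continuous crack_sqdist.
Proof.
have cs : continuous (fun p : R * R => p.2 - R1).
  by move=> p; apply: cvgB; [exact: snd_continuous|exact: cvg_cst].
by move=> p; apply: cvgD; apply: cvgM; try exact: fst_continuous; exact: cs.
Qed.

Lemma C1fun_hole d : C1fun (hole d) (hole1 d) (hole2 d).
Proof.
have Y := C1funD (@C1fun_snd R) (C1fun_cst (- R1)).
have H := C1fun_cutoff (C1funZ (16 * d ^+ 2)^-1
  (C1funD (C1funM (@C1fun_fst R) (@C1fun_fst R)) (C1funM Y Y))).
have E : hole d = fun p => cutoff ((16 * d ^+ 2)^-1 * (p.1 * p.1 + (p.2 + - R1) * (p.2 + - R1))).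
  by apply/funext => p; rewrite /hole /crack_sqdist [in LHS]mulrC !expr2.
rewrite E; apply: (C1fun_eq H) => p /=; rewrite /hole1 /hole2 /crack_sqdist !expr2;
  move: (_^-1) => i;
  rewrite [X in cutoff' X](mulrC i); move: (cutoff' _) => a; ring.
Qed.

Lemma hole_ge0 d p : 0 <= hole d p. Proof. exact: cutoff_ge0. Qed.
Lemma hole_le1 d p : hole d p <= 1. Proof. exact: cutoff_le1. Qed.

(** Where grad (hole d) is not 0, one has x <= 4 d, so that the ground state is O(d)
    while the gradient is O(1/d). *)
Lemma hole_energy_bound : exists2 B, 0 < B & forall (d : R) p, 0 < d -> quarter_disc p ->
  w p ^+ 2 * (hole1 d p ^+ 2 + hole2 d p ^+ 2) <= B /\
  (~ rect (- (5 * d)) (- (5 * d) + 10 * d) (R1 - 5 * d) (R1 - 5 * d + 10 * d) p ->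
    hole1 d p ^+ 2 + hole2 d p ^+ 2 = 0).
Proof.
have [A A0 HA] := ground_state_bound.
(* (4 A d)^2 * 8^2 / (2 d)^2 = 256 A^2, from w <= A x, |cutoff'| <= 8 and
   |grad hole| <= |cutoff'| / (2 d) *)
exists (256 * A ^+ 2); first by apply: mulr_gt0; [exact: ltr0n|exact: exprn_gt0].
move=> d p d0 Dp; have [w0 wx _ _] := HA p Dp.
have D0 : 0 < d ^+ 2 by rewrite exprn_gt0.
set q := crack_sqdist p.
have qE : q = p.1 ^+ 2 + (p.2 - R1) ^+ 2 by [].
have [h|h] := leP (16 * d ^+ 2) q.
  have z : cutoff' (q / (16 * d ^+ 2)) = 0.
    by apply: cutoff'_eq0_ge1; rewrite ler_pdivlMr ?mul1r// mulr_gt0.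
  rewrite /hole1 /hole2 -/q z !mul0r expr0n/= addr0 mulr0; split=> [|_]; last by [].
  by apply: mulr_ge0; [exact: ler0n|exact: sqr_ge0].
split; last first.
  move=> nr; exfalso; apply: nr; rewrite /rect/= !in_itv/=.
  have x2 : p.1 ^+ 2 < 16 * d ^+ 2 by apply: le_lt_trans h; rewrite qE lerDl sqr_ge0.
  have y2 : (p.2 - R1) ^+ 2 < 16 * d ^+ 2 by apply: le_lt_trans h; rewrite qE lerDr sqr_ge0.
  by split; apply/andP; split; nra.
have -> : hole1 d p ^+ 2 + hole2 d p ^+ 2 = cutoff' (q / (16 * d ^+ 2)) ^+ 2 * (q / (64 * d ^+ 2 ^+ 2)).
  rewrite /hole1 /hole2 -/q qE; move: (cutoff' _) => c.
  by field; rewrite gt_eqF.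
have q0 : 0 <= q by rewrite qE addr_ge0 ?sqr_ge0.
have c64 : cutoff' (q / (16 * d ^+ 2)) ^+ 2 <= 64.
  rewrite -real_normK ?num_real// (_ : 64 = 8 ^+ 2); last by ring.
  by rewrite ler_pXn2r ?nnegrE// cutoff'_bound.
have w2 : w p ^+ 2 <= A ^+ 2 * (16 * d ^+ 2).
  apply: le_trans (_ : (A * p.1) ^+ 2 <= _).
    by rewrite ler_pXn2r ?nnegrE// (le_trans w0).
  rewrite exprMn ler_pM2l ?exprn_gt0//; apply: le_trans (ltW h); by rewrite qE lerDl sqr_ge0.
move: (cutoff' _ ^+ 2) (sqr_ge0 (cutoff' (q / (16 * d ^+ 2)))) c64 => c c0 c64.
have E : 256 * A ^+ 2 = A ^+ 2 * (16 * d ^+ 2) * (64 * (16 * d ^+ 2 / (64 * d ^+ 2 ^+ 2))).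
  by field; rewrite gt_eqF.
rewrite E; apply: ler_pM => //; first exact: sqr_ge0.
  by rewrite mulr_ge0// mulr_ge0// invr_ge0 mulr_ge0// sqr_ge0.
apply: ler_pM => //; first by rewrite mulr_ge0// invr_ge0 mulr_ge0// sqr_ge0.
by rewrite ler_pM2r ?(ltW h)// invr_gt0 mulr_gt0// exprn_gt0.
Qed.

(** The integrand is bounded and lives in a square of side 10 d. *)
Lemma ground_state_hole_energy : exists2 B, 0 < B & forall d t, 0 < d -> 0 < t ->
  \int[mu2]_p (bump (R2 ^+ 2) t p ^+ 2 * (w p ^+ 2 * (hole1 d p ^+ 2 + hole2 d p ^+ 2)))
    <= B * d ^+ 2.
Proof.
have [B B0 HB] := hole_energy_bound.
exists (B * 100) => [|d t d0 t0]; first by rewrite mulr_gt0.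
set Q := rect (- (5 * d)) (- (5 * d) + 10 * d) (R1 - 5 * d) (R1 - 5 * d + 10 * d).
have mQ : measurable (Q : set T2) by exact: measurable_rect.
have cw := C1fun_continuous (C1fun_ground_state k).
have [_ c1 c2] := C1fun_hole d.
have cF : cc (fun p => bump (R2 ^+ 2) t p ^+ 2 * (w p ^+ 2 * (hole1 d p ^+ 2 + hole2 d p ^+ 2))).
  apply: ccMl; first by apply: cc_sqr; exact: bump_cc.
  move=> p; apply: cvgM; first by apply: cvgM; exact: cw.
  by apply: cvgD; apply: cvgM; [exact: c1|exact: c1|exact: c2|exact: c2].
have out p : ~ quarter_disc p -> bump (R2 ^+ 2) t p = 0.
  move=> nD; have [|e _ _] := @bump_out _ (R2 ^+ 2) t p t0; last exact: e.
  by apply: contra_not nD; apply: inner_quarter_disc_sub.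
rewrite -(@Rintegral_subset_support _ Q setT)//; last first.
  move=> p nQ; have [Dp|nD] := pselect (quarter_disc p); last by rewrite (out p nD) expr0n mul0r.
  by have [_ ->] := HB d p d0 Dp; rewrite // !mulr0.
have fQ : (mu2 Q < +oo)%E by exact: rect_finite.
have IF : Rintegrable mu2 Q (fun p => bump (R2 ^+ 2) t p ^+ 2 *
    (w p ^+ 2 * (hole1 d p ^+ 2 + hole2 d p ^+ 2))).
  by apply: continuous_Rintegrable_rect; case: cF.
have := has_Rint_le mQ (has_Rint_int IF) (has_Rint_cst mQ B fQ).
rewrite square_measure ?mulr_gt0//.
rewrite (_ : B * (10 * d) ^+ 2 = B * 100 * d ^+ 2); last by ring.
apply=> p _; have [Dp|nD] := pselect (quarter_disc p); last first.
  by rewrite (out p nD) expr0n mul0r ltW.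
have [h _] := HB d p d0 Dp; apply: le_trans h.
apply: ler_piMl; last by apply: exprn_ile1; [exact: bump_ge0|exact: bump_le1].
by apply: mulr_ge0; [exact: sqr_ge0|apply: addr_ge0; exact: sqr_ge0].
Qed.

Lemma cracked_quarter_discP eps p : 0 < eps < pi / 2 ->
  cracked_quarter_disc R1 R2 eps p <->
  quarter_disc p /\ ~ (sqdist p = R1 ^+ 2 /\ p.1 <= R1 * cos eps).
Proof.
move=> he; rewrite (cracked_quarter_discE R1_gt0 R12 he).
by split=> [[? ? ? ?]|[[? ? ?] ?]]; split.
Qed.

Lemma measurable_cracked_quarter_disc eps : 0 < eps < pi / 2 ->
  measurable (cracked_quarter_disc R1 R2 eps : set T2).
Proof.
move=> he.
have -> : cracked_quarter_disc R1 R2 eps = quarter_disc `\`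
    ([set p | sqdist p <= R1 ^+ 2] `&` [set p | R1 ^+ 2 <= sqdist p]
      `&` [set p | p.1 <= R1 * cos eps]).
  apply/seteqP; split => p.
    move=> /(cracked_quarter_discP p he)[Dp nc]; split => // -[[/= h1 h2] h3]; apply: nc.
    by split => //; apply/eqP; rewrite eq_le h1.
  by move=> [Dp nc]; apply/(cracked_quarter_discP p he); split => // -[h1 h2]; apply: nc; rewrite /= h1 lexx.
apply: measurableD; first exact: measurable_quarter_disc.
have closed_measurable_plane (A : set (R * R)) : closed A -> measurable (A : set T2).
  move=> cA; rewrite -(setCK A); apply: measurableC; apply: open_measurable_plane.
  exact: closed_openC.
apply: measurableI; first apply: measurableI.
- by apply: closed_measurable_plane; apply: closed_sublevel; exact: continuous_sqdist.
- by apply: closed_measurable_plane; apply: closed_superlevel; exact: continuous_sqdist.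
- by apply: closed_measurable_plane; apply: closed_sublevel; exact: fst_continuous.
Qed.

Lemma inner_quarter_disc_sub_cracked eps t : 0 < eps < pi / 2 -> 0 < t ->
  inner_quarter_disc (R1 ^+ 2) t `<=` cracked_quarter_disc R1 R2 eps.
Proof.
move=> he t0 p Ip; apply/(cracked_quarter_discP p he); split.
  apply: inner_quarter_disc_sub Ip => //.
  by apply: ltW; rewrite ltr_pXn2r ?nnegrE ?ltW.
case: Ip => _ _ h [e _]; move: h; rewrite e => h; lra.
Qed.

(** A point of the crack has R1 - x <= y <= R1. *)
Lemma crack_near_corner p (d : R) : 0 < p.1 -> 0 < p.2 -> sqdist p = R1 ^+ 2 -> p.1 <= d ->
  crack_sqdist p <= 2 * d ^+ 2.
Proof.
case: p => x y /= x0 y0; rewrite /sqdist/crack_sqdist/= => h xd.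
have yR : y <= R1 by rewrite -(ler_pXn2r (ltn0Sn 1)) ?nnegrE ?ltW// -h ltrDr exprn_gt0.
have R1xy : R1 <= x + y.
  by rewrite -(ler_pXn2r (ltn0Sn 1)) ?nnegrE ?(ltW R1_gt0)// ?addr_ge0 ?ltW// -h; nra.
nra.
Qed.

Lemma crack_tip_abscissa_gt0 eps : 0 < eps < pi / 2 -> 0 < R1 * cos eps.
Proof.
move=> /andP[e0 ep]; apply: mulr_gt0 => //; apply: cos_gt0_pihalf; rewrite ep andbT.
by apply: lt_trans e0; rewrite oppr_lt0 divr_gt0// pi_gt0.
Qed.

(** The crack is within distance sqrt 2 * d of (0, R1), inside the region where
    the hole function vanishes. *)
Lemma test_function_C1c eps t : 0 < eps < pi / 2 -> 0 < t ->
  C1c (cracked_quarter_disc R1 R2 eps)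
    (fun p => w p * (bump (R2 ^+ 2) t p * hole (R1 * cos eps) p)).
Proof.
move=> he t0; set d := R1 * cos eps.
have d0 : 0 < d := crack_tip_abscissa_gt0 he.
pose K := inner_quarter_disc (R2 ^+ 2) t `&` [set p | 4 * d ^+ 2 <= crack_sqdist p].
have cK : compact K.
  have cI := @compact_inner_quarter_disc R (R2 ^+ 2) t t0.
  apply: (@subclosed_compact _ K (inner_quarter_disc (R2 ^+ 2) t)) => //.
    apply: closedI; first by apply: compact_closed => //; exact: norm_hausdorff.
    by apply: closed_superlevel; exact: continuous_crack_sqdist.
  by move=> p [].
apply: (C1cI (C1funM (C1fun_ground_state k) (C1funM (C1fun_bump (R2 ^+ 2) t) (C1fun_hole d))) cK).
  move=> p [Ip /= h]; have Dp := inner_quarter_disc_sub t0 (lexx _) Ip.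
  apply/(cracked_quarter_discP p he); split => // -[pR xd].
  have [x0 y0 _] := Dp.
  have := crack_near_corner x0 y0 pR xd; rewrite -/d; have : 0 < d ^+ 2 by rewrite exprn_gt0.
  by lra.
move=> p nK; have [Ip|nI] := pselect (inner_quarter_disc (R2 ^+ 2) t p); last first.
  by have [-> _ _] := bump_out t0 nI; rewrite mul0r mulr0.
have h : crack_sqdist p < 4 * d ^+ 2.
  by rewrite ltNge; apply/negP => h; apply: nK.
rewrite /hole cutoff_eq0 ?mulr0// ler_pdivrMr; last by apply: mulr_gt0 => //; exact: exprn_gt0.
by apply: le_trans (ltW h) _; rewrite le_eqVlt; apply/orP; left; apply/eqP; field.
Qed.

(** A lower bound, uniform in eps, for the mass of the test functions. *)
Let core_mass := \int[mu2]_(p in inner_square R1) (w p ^+ 2).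

Let core_mass_gt0 : 0 < core_mass.
Proof.
have cw := C1fun_continuous (C1fun_ground_state k).
have RR : R1 ^+ 2 / 2 < R2 ^+ 2.
  have : R1 ^+ 2 < R2 ^+ 2 by rewrite ltr_pXn2r ?nnegrE ?ltW.
  have := exprn_gt0 2 R1_gt0; lra.
have S0 : 0 <= k * (R1 ^+ 2 / 2) by rewrite !mulr_ge0 ?ltW ?exprn_gt0.
have [s] := EVT_min S0 (continuous_subspaceT (@continuous_clifford R 2)).
rewrite in_itv/= => /andP[s0 sS] Hs.
have g0 : 0 < clifford 2 s.
  by apply: clifford_gt0_disc => //; apply: le_lt_trans sS _; rewrite ltr_pM2l.
set m := clifford 2 s in g0 Hs.
have c0 : 0 < R1 / 4 by rewrite divr_gt0.
apply: (@Rintegral_inner_square_gt0 _ _ R1_gt0 _ ((R1 / 4 * (R1 / 4) * m) ^+ 2)).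
- by move=> p; apply: cvgM; exact: cw.
- by rewrite exprn_gt0// mulr_gt0// mulr_gt0.
move=> p /(inner_squareP R1_gt0)[h1 h2 _ h3].
have gm : m <= clifford 2 (k * sqdist p).
  apply: Hs; rewrite in_itv/=; apply/andP; split.
    by apply: mulr_ge0; [exact: ltW|exact: sqdist_ge0].
  by rewrite ler_pM2l.
have cm0 : 0 <= R1 / 4 * (R1 / 4) * m by rewrite !mulr_ge0 ?ltW.
have le : R1 / 4 * (R1 / 4) * m <= w p.
  rewrite /ground_state; apply: ler_pM => //; [by apply: mulr_ge0; exact: ltW|exact: ltW|].
  by apply: ler_pM => //; exact: ltW.
by rewrite ler_pXn2r ?nnegrE// (le_trans cm0).
Qed.

(** The test function is the ground state times [bump] times [hole].  By the Picone
    identity its energy exceeds 4 k times its mass by an integral bounded by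
    O(d^2) plus a term due to [bump], which vanishes when the boundary cutoff is
    removed.  The hypothesis d <= R1 / 8 keeps [inner_square] at distance at
    least 4 d from (0, R1). *)
Lemma small_crack_upper_bound : exists2 C, 0 < C & forall eps lam, 0 < eps < pi / 2 ->
  R1 * cos eps <= R1 / 8 ->
  (forall phi, C1c (cracked_quarter_disc R1 R2 eps) phi ->
     lam * mass (cracked_quarter_disc R1 R2 eps) phi
       <= energy (cracked_quarter_disc R1 R2 eps) phi) ->
  lam <= 4 * k + C * (R1 * cos eps) ^+ 2.
Proof.
have [B B0 HB] := ground_state_hole_energy.
exists (2 * B / core_mass) => [|eps lam he dR Hlam]; first by apply: divr_gt0; [exact: mulr_gt0|exact: core_mass_gt0].
set Om := cracked_quarter_disc R1 R2 eps in Hlam.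
have mOm : measurable (Om : set T2) := measurable_cracked_quarter_disc he.
set d := R1 * cos eps in dR *.
have d0 : 0 < d := crack_tip_abscissa_gt0 he.
have [le|lt] := leP lam (4 * k).
  by rewrite (le_trans le)// lerDl mulr_ge0 ?sqr_ge0// divr_ge0 ?mulr_ge0 ?(ltW B0) ?(ltW core_mass_gt0).
suff H : (lam - 4 * k) * core_mass <= 2 * (B * d ^+ 2).
  rewrite -lerBlDl mulrAC ler_pdivlMr ?core_mass_gt0//; apply: le_trans H _.
  by rewrite mulrA.
have RR : R1 ^+ 2 / 2 < R2 ^+ 2.
  have : R1 ^+ 2 < R2 ^+ 2 by rewrite ltr_pXn2r ?nnegrE ?ltW.
  have := exprn_gt0 2 R1_gt0; lra.
pose t n : R := n.+1%:R^-1.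
have t0 n : 0 < t n by rewrite invr_gt0.
pose tmax := Num.min (R1 / 4) (R2 ^+ 2 - R1 ^+ 2 / 2).
have tmax0 : 0 < tmax by rewrite lt_min divr_gt0// subr_gt0.
have small : \forall n \near \oo, t n <= tmax.
  have /cvgr0Pnorm_le/(_ tmax tmax0) := @cvg_harmonic R.
  by apply: filterS => n /=; rewrite ger0_norm ?(ltW (t0 n)).
have cvg2 : (fun n => 2 * (B * d ^+ 2) + 2 * \int[mu2]_p bump_energy n.+1%:R^-1 p) @ \oo
    --> 2 * (B * d ^+ 2).
  rewrite -[X in _ --> X]addr0 -[X in _ --> _ + X](mulr0 2).
  apply: cvgD; first exact: cvg_cst.
  by apply: cvgMl_tmp; exact: ground_state_bump_energy_cvg0.
rewrite -(cvg_lim (@Rhausdorff R) cvg2); apply: limr_ge; first by apply/cvg_ex; eexists; exact: cvg2.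
apply: filterS small => n tn.
have {tn} [tc tR] : t n <= R1 / 4 /\ t n <= R2 ^+ 2 - R1 ^+ 2 / 2.
  by move: tn; rewrite le_min => /andP.
have cphi := test_function_C1c he (t0 n).
have Hpsi := C1funM (C1fun_bump (R2 ^+ 2) (t n)) (C1fun_hole d).
have [w11 [w12 [w21 [w22 [H1 H2 lap]]]]] := ground_state_laplace k.
have ccb := bump_cc (R2 ^+ 2) (t0 n); have [_ [M HM]] := ccb.
have psiM p : M < `|p| -> bump (R2 ^+ 2) (t n) p * hole d p = 0 by move=> /HM->; rewrite mul0r.
have E := energy_mul (C1fun_ground_state k) H1 H2 lap mOm Hpsi psiM cphi.
have L := Hlam _ cphi; rewrite E in L.
have cw := C1fun_continuous (C1fun_ground_state k).
have chole := C1fun_continuous (C1fun_hole d).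
have m0 : core_mass <= mass Om (fun p => w p * (bump (R2 ^+ 2) (t n) p * hole d p)).
  rewrite (mass_setT cphi).
  have ccphi : cc (fun p => (w p * (bump (R2 ^+ 2) (t n) p * hole d p)) ^+ 2).
    by apply: cc_sqr; apply: ccMr => //; apply: ccMl.
  have mQ := @measurable_inner_square R R1.
  apply: le_trans (Rintegral_ge_subset mQ ccphi (fun p => sqr_ge0 _)).
  rewrite le_eqVlt; apply/orP; left; apply/eqP.
  apply: eq_Rintegral => p /set_mem/(inner_squareP R1_gt0)[h1 h2 h3 h4].
  rewrite bump_eq1 ?(le_trans tc)//; last by lra.
  rewrite mul1r /hole cutoff_eq1 ?mulr1//.
  rewrite ler_pdivlMr; last by apply: mulr_gt0 => //; exact: exprn_gt0.
  rewrite mul1r.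
  rewrite /crack_sqdist; have := sqr_ge0 p.1.
  have : (R1 / 2) ^+ 2 <= (p.2 - R1) ^+ 2 by have := R1_gt0; nra.
  have := d0; have := dR; nra.
have grad : \int[mu2]_p (w p ^+ 2 * ((bump (R2 ^+ 2) (t n) p * hole1 d p + hole d p * bump1 (R2 ^+ 2) (t n) p) ^+ 2
     + (bump (R2 ^+ 2) (t n) p * hole2 d p + hole d p * bump2 (R2 ^+ 2) (t n) p) ^+ 2))
   <= 2 * (B * d ^+ 2) + 2 * \int[mu2]_p bump_energy (t n) p.
  have [_ chole1 chole2] := C1fun_hole d.
  have [_ ccb1 ccb2] := C1fun_cc (C1fun_bump (R2 ^+ 2) (t n)) HM.
  have mT : measurable (setT : set T2) by [].
  have cw2 : continuous (fun p => w p ^+ 2) by move=> p; apply: cvgM; exact: cw.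
  have ch2 : continuous (fun p => hole1 d p ^+ 2 + hole2 d p ^+ 2).
    by move=> p; apply: cvgD; apply: cvgM; [exact: chole1|exact: chole1|exact: chole2|exact: chole2].
  have I1 : Rintegrable mu2 setT (fun p => bump (R2 ^+ 2) (t n) p ^+ 2 * (w p ^+ 2 * (hole1 d p ^+ 2 + hole2 d p ^+ 2))).
    apply: integrable_cc; apply: ccMl; first exact: cc_sqr.
    by move=> p; apply: cvgM; [exact: cw2|exact: ch2].
  have I2 : Rintegrable mu2 setT (bump_energy (t n)).
    apply: integrable_cc; apply: ccMr => //.
    by apply: ccD; exact: cc_sqr.
  have I3 : Rintegrable mu2 setT (fun p => w p ^+ 2 *
     ((bump (R2 ^+ 2) (t n) p * hole1 d p + hole d p * bump1 (R2 ^+ 2) (t n) p) ^+ 2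
     + (bump (R2 ^+ 2) (t n) p * hole2 d p + hole d p * bump2 (R2 ^+ 2) (t n) p) ^+ 2)).
    apply: integrable_cc; apply: ccMr => //.
    by apply: ccD; apply: cc_sqr; apply: ccD; [exact: ccMl|exact: ccMr|exact: ccMl|exact: ccMr].
  have := has_Rint_le mT (has_Rint_int I3)
    (has_RintD mT (has_RintZ mT 2 (has_Rint_int I1)) (has_RintZ mT 2 (has_Rint_int I2))).
  move=> H; apply: le_trans (H _) _; last by rewrite lerD2r ler_pM2l// HB.
  move=> p _; rewrite /bump_energy.
  have := hole_ge0 d p; have := hole_le1 d p.
  move: (w p ^+ 2) (sqr_ge0 (w p)) (bump _ _ p) (hole d p) (hole1 d p) (hole2 d p)
    (bump1 _ _ p) (bump2 _ _ p) => W W0 b h h1 h2 b1 b2 hle hge.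
  have hh : h ^+ 2 <= 1 by rewrite exprn_ile1.
  have sq (x y z : R) : (b * x + h * z) ^+ 2 <= 2 * (b ^+ 2 * x ^+ 2) + 2 * z ^+ 2.
    have := sqr_ge0 (b * x - h * z); have := ler_wpM2r (sqr_ge0 z) hh.
    rewrite mul1r -exprMn -exprMn; move: (b * x) (h * z) => u v; nra.
  have := lerD (sq h1 h1 b1) (sq h2 h2 b2) => S.
  apply: le_trans (ler_wpM2l W0 S) _.
  by rewrite le_eqVlt; apply/orP; left; apply/eqP; ring.
apply: le_trans grad.
set G := \int[mu2]_p _ in L *; set m := mass _ _ in L m0.
have := ler_wpM2l (ltW (_ : 0 < lam - 4 * k)) m0; rewrite subr_gt0 => /(_ lt).
by move=> /le_trans; apply; rewrite mulrBl lerBlDl; exact: L.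
Qed.

(** A function supported in the quarter disc of radius R1 avoids every crack. *)
Lemma uniform_upper_bound : exists2 C, 0 < C & forall eps lam, 0 < eps < pi / 2 ->
  (forall phi, C1c (cracked_quarter_disc R1 R2 eps) phi ->
     lam * mass (cracked_quarter_disc R1 R2 eps) phi
       <= energy (cracked_quarter_disc R1 R2 eps) phi) ->
  lam <= C.
Proof.
have [t t0 m0] := bump_mass_gt0 R1_gt0.
set m := \int[mu2]_p _ in m0.
pose E := \int[mu2]_p (bump1 (R1 ^+ 2) t p ^+ 2 + bump2 (R1 ^+ 2) t p ^+ 2).
exists (`|E| / m + 1) => [|eps lam he Hlam]; first by rewrite ltr_wpDl// divr_ge0// ltW.
have cphi := bump_C1c t0 (inner_quarter_disc_sub_cracked he t0).
have L := Hlam _ cphi; rewrite (mass_setT cphi) (energy_setT (measurable_cracked_quarter_disc he) cphi) in L.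
have eE : \int[mu2]_p (partial1 (bump (R1 ^+ 2) t) p ^+ 2 + partial2 (bump (R1 ^+ 2) t) p ^+ 2) = E.
  have b := C1fun_bump (R1 ^+ 2) t.
  by apply: eq_Rintegral => p _; rewrite (C1fun_partial1 b) (C1fun_partial2 b).
rewrite eE in L; apply: le_trans (_ : `|E| / m <= _); last by rewrite lerDl.
by rewrite ler_pdivlMr//; apply: le_trans L (ler_norm _).
Qed.

End TestFunctions.

(** * Existence of the first zero, and the eigenvalue estimate *)

Section ConcludingFacts.
Variable R : realType.

(** If clifford 2 had no positive zero, [ground_state] would be positive for every
    k > 0, and 4 k would bound a fixed Rayleigh quotient from below for all k. *)
Lemma clifford2_root : exists2 s : R, 0 < s & clifford 2 s = 0.
Proof.
apply: contrapT => no_root.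
have pos (s : R) : 0 <= s -> 0 < clifford 2 s.
  move=> s0; apply: clifford_gt0 => // u /andP[u0 _].
  by apply/eqP => e; apply: no_root; exists u.
have [t t0] := bump_mass_gt0 (@ltr01 R).
have sub : inner_quarter_disc (1 ^+ 2) t `<=` @quarter_disc R 1.
  by apply: inner_quarter_disc_sub.
have cphi := bump_C1c t0 sub; rewrite -(mass_setT cphi) => m0.
set m := mass _ _ in m0; set E := energy (quarter_disc 1) (bump (1 ^+ 2) t).
pose k := (`|E| + 1) / m.
have k0 : 0 < k by apply: divr_gt0 => //; rewrite ltr_wpDl.
have : 4 * k * m <= E.
  apply: energy_ge_positive_ground_state cphi; first exact: measurable_quarter_disc.
  move=> p [x0 y0 _]; split => //; apply: pos.
  by apply: mulr_ge0; [exact: ltW|exact: sqdist_ge0].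
rewrite -mulrA divfK ?gt_eqF//; have := ler_norm E; have := normr_ge0 E; lra.
Qed.

End ConcludingFacts.

Theorem proposition7p1 (R : realType) (R1 R2 : R) (hR1 : 0 < R1)
    (hR12 : R1 < R2) :
  exists C : R, 0 < C /\
    forall eps : R, 0 < eps < pi / 2 ->
      exists lam : R,
        [/\ lowest_dirichlet_eigenvalue (cracked_quarter_disc R1 R2 eps) lam,
            bessel_zero R 2 1 ^+ 2 / R2 ^+ 2 <= lam &
            lam <= bessel_zero R 2 1 ^+ 2 / R2 ^+ 2 + C * (pi / 2 - eps) ^+ 2].
Proof.
have [j0 root pos] := bessel_zero1_spec (clifford2_root R).
set j := bessel_zero R 2 1 in j0 root pos *.
have R20 : 0 < R2 := lt_trans hR1 hR12.
(* with this k, the eigenvalue 4 k of the ground state is j^2 / R2^2 and the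
   ground state vanishes on the arc of radius R2 *)
pose k := (j / 2) ^+ 2 / R2 ^+ 2.
have k0 : 0 < k by rewrite divr_gt0 ?exprn_gt0 ?divr_gt0.
have kR : k * R2 ^+ 2 = (j / 2) ^+ 2 by rewrite divfK// gt_eqF ?exprn_gt0.
have k4 : j ^+ 2 / R2 ^+ 2 = 4 * k by rewrite /k; field; rewrite gt_eqF.
rewrite -kR in root pos; rewrite k4.
have [C C0 small] := small_crack_upper_bound hR1 hR12 k0 pos root.
have [C' C'0 large] := uniform_upper_bound hR1 hR12.
(* the second term serves cracks with cos eps > 1/8, where pi/2 - eps > 1/8 *)
exists (C * R1 ^+ 2 + 64 * C'); split.
  by rewrite addr_gt0// mulr_gt0// exprn_gt0.
move=> eps he.
have mOm := measurable_cracked_quarter_disc hR1 hR12 he.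
have [t t0 m0] := bump_mass_gt0 hR1.
have cphi := bump_C1c t0 (inner_quarter_disc_sub_cracked hR1 hR12 he t0).
rewrite -(mass_setT cphi) in m0.
have sub : cracked_quarter_disc R1 R2 eps `<=` rect 0 R2 0 R2.
  move=> p /(cracked_quarter_discP hR1 hR12 p he)[[x0 y0 pR] _].
  split; rewrite /= in_itv/=; apply/andP; split; [exact: ltW| |exact: ltW|];
    rewrite -(ltr_pXn2r (ltn0Sn 1)) ?nnegrE ?ltW//; apply: le_lt_trans pR;
    by rewrite /sqdist ?lerDl ?lerDr sqr_ge0.
have [lam [Hlam lam_le lam_ge]] := lowest_dirichlet_eigenvalue_variational mOm R20 sub cphi m0.
exists lam; split => //.
  apply: lam_ge => phi cp; apply: energy_ge_positive_ground_state cp => //.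
  move=> p /(cracked_quarter_discP hR1 hR12 p he)[[x0 y0 pR] _]; split => //.
  apply: pos; first by apply: mulr_ge0; [exact: ltW|exact: sqdist_ge0].
  by rewrite ltr_pM2l.
have cle := cos_le_complement he.
have c0 : 0 < R1 * cos eps := crack_tip_abscissa_gt0 hR1 he.
have cos0 : 0 < cos eps by rewrite -(pmulr_rgt0 _ hR1).
set h := pi / 2 - eps in cle *.
have h0 : 0 < h by exact: lt_le_trans cle.
have [cs|cl] := leP (R1 * cos eps) (R1 / 8).
  apply: le_trans (small eps lam he cs lam_le) _; rewrite lerD2l mulrDl.
  apply: (@le_trans _ _ (C * R1 ^+ 2 * h ^+ 2)).
    rewrite exprMn mulrA ler_pM2l; last by rewrite mulr_gt0// exprn_gt0.
    by rewrite ler_pXn2r ?nnegrE//; exact: ltW.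
  by rewrite lerDl mulr_ge0 ?sqr_ge0// mulr_ge0// ltW.
have h8 : 1 / 8 <= h.
  by apply: le_trans cle; apply: ltW; rewrite -(ltr_pM2l hR1) mul1r.
have hh : 1 <= 64 * h ^+ 2 by nra.
apply: le_trans (large eps lam he lam_le) _.
apply: le_trans (_ : 64 * C' * h ^+ 2 <= _).
  by rewrite mulrAC ler_peMl// ltW.
rewrite mulrDl; have K1 : 0 < C * R1 ^+ 2 * h ^+ 2 by rewrite !mulr_gt0 ?exprn_gt0.
have := k0; lra.
Qed.
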